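(* Let $L$ be a countable first-order signature and let $\varphi$ be a sentence of $L_{\omega_1\omega}$ that implies $(\exists x)(\exists y)\,x\neq y$. If $\varphi$ is scattered, then $\varphi$ has few separable randomizations.
   Context: A sentence $\varphi$ of $L_{\omega_1\omega}$ is scattered if there is no countable fragment $L_A$ of $L_{\omega_1\omega}$ such that $\varphi$ has a perfect set of countable models that are pairwise not $L_A$-equivalent (countable means of cardinality at most $\aleph_0$). Randomizations: the pure randomization theory $P^R$ is a continuous-logic theory (with axioms recursive in $L$) in a signature $L^R$ with a sort $\mathbb{K}$ of random elements and a sort $\mathbb{E}$ of events; for each first-order $L$-formula $\theta$ with $n$ free variables there is a function symbol $[\![\theta(\cdot)]\!]:\mathbb{K}^n\to\mathbb{E}$; there are Boolean operations $\sqcup,\sqcap,\neg$ on events, a predicate $\mu:\mathbb{E}\to[0,1]$, and metrics $d_{\mathbb{K}},d_{\mathbb{E}}$. The axioms say that the functions $[\![\theta]\!]$ respect validity, connectives and quantifiers, that every event equals $[\![\mathbf a=\mathbf b]\!]$ for some random elements $\mathbf a,\mathbf b$, that $\mu$ is an atomless probability measure on the events, and that $d_{\mathbb{K}}(\mathbf f,\mathbf g)=\mu([\![\mathbf f\neq\mathbf g]\!])$, $d_{\mathbb{E}}(\mathsf A,\mathsf B)=\mu(\mathsf A\triangle\mathsf B)$. Pre-models of $P^R$ are called randomizations; models of $P^R$ (complete metric structures) are complete randomizations. In a complete separable randomization $\mathcal P=(\mathcal K,\mathcal E)$ there is a unique family of maps $[\![\psi(\cdot)]\!]^{\mathcal P}:\mathcal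 K^n\to\mathcal E$ for all $L_{\omega_1\omega}$-formulas $\psi$ with $n$ free variables extending the first-order ones and satisfying $[\![\neg\psi]\!]=\neg[\![\psi]\!]$, $[\![\psi_1\vee\psi_2]\!]=[\![\psi_1]\!]\sqcup[\![\psi_2]\!]$, $[\![\bigvee_k\psi_k(\vec{\mathbf f})]\!]=\sup_k[\![\psi_k(\vec{\mathbf f})]\!]$, $[\![(\exists u)\theta(u,\vec{\mathbf f})]\!]=\sup_{\mathbf g\in\mathcal K}[\![\theta(\mathbf g,\vec{\mathbf f})]\!]$. A separable randomization $\mathcal N$ with completion $\mathcal P$ is a randomization of $\varphi$ if $\mu([\![\varphi]\!]^{\mathcal P})=1$. Basic randomizations: let $\mathcal L$ be the Borel subsets of $[0,1)$ with Lebesgue measure $\lambda$. Given a partition $[0,1)=\bigcup_n\mathsf B_n$ into countably many Borel sets of positive measure and countable models $\mathcal M_n\models\varphi$, let $\prod_n\mathcal M_n^{\mathsf B_n}$ be the set of functions $\mathbf f:[0,1)\to\bigcup_n M_n$ with $\mathbf f(t)\in M_n$ for $t\in\mathsf B_n$ and $\{t\in\mathsf B_n:\mathbf f(t)=a\}\in\mathcal L$ for each $a\in M_n$; the structure $(\prod_n\mathcal M_n^{\mathsf B_n},\mathcal L)$ with the usual Boolean operations, $\mu=\lambda$, and $[\![\theta(\vec{\mathbf f})]\!]=\bigcup_n\{t\in\mathsf B_n:\mathcal M_n\models\theta(\vec{\mathbf f}(t))\}$ is a basic randomization of $\varphi$. The sentence $\varphi$ has few separable randomizations if every complete separable randomization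 of $\varphi$ is isomorphic to a basic randomization of $\varphi$. *)

(* Defs.v *)
From HB Require Import structures.
From mathcomp Require Import all_boot all_order all_algebra.
From mathcomp Require Import all_classical all_reals all_analysis.

Set Implicit Arguments.
Unset Strict Implicit.
Unset Printing Implicit Defensive.

Import Order.TTheory GRing.Theory Num.Theory.
Import numFieldNormedType.Exports.

Local Open Scope classical_set_scope.
Local Open Scope ring_scope.

(* Constants are function symbols of arity 0. *)
Record signature := Signature {
  rel_sym : Type;
  fun_sym : Type;
  rel_ar : rel_sym -> nat;
  fun_ar : fun_sym -> nat }.

Definition countable_signature (L : signature) : Prop :=
  countable [set: rel_sym L] /\ countable [set: fun_sym L].

Inductive term (L : signature) (n : nat) : Type :=
| Var : 'I_n -> term L n
| App : forall f : fun_sym L, ('I_(fun_ar f) -> term L n) -> term L n.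
Arguments Var {L n}.
Arguments App {L n}.

(* [formula L inf n] is the type of formulas with free variables among n
   variables (well-scoped de Bruijn indices: Ex binds the variable ord0).
   Countable disjunctions are available only when inf = true: [formula L false n]
   consists of the first-order formulas and [formula L true n] of the formulas of
   L_{omega1 omega}. *)
Inductive formula (L : signature) (inf : bool) : nat -> Type :=
| Eq : forall n, term L n -> term L n -> formula L inf n
| Rel : forall n (r : rel_sym L), ('I_(rel_ar r) -> term L n) -> formula L inf n
| Neg : forall n, formula L inf n -> formula L inf n
| Or : forall n, formula L inf n -> formula L inf n -> formula L inf n
| BigOr : forall n, inf -> (nat -> formula L inf n) -> formula L inf n
| Ex : forall n, formula L inf n.+1 -> formula L inf n.
Arguments Eq {L inf n}.
Arguments Rel {L inf n}.
Arguments Neg {L inf n}.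
Arguments Or {L inf n}.
Arguments BigOr {L inf n}.
Arguments Ex {L inf n}.

Notation fo_form L := (formula L false).
Notation inf_form L := (formula L true).

Fixpoint fo_inf (L : signature) inf n (th : formula L inf n) : inf_form L n :=
  match th with
  | Eq _ s t => Eq s t
  | Rel _ r ts => Rel r ts
  | Neg _ th1 => Neg (fo_inf th1)
  | Or _ th1 th2 => Or (fo_inf th1) (fo_inf th2)
  | BigOr _ _ ths => BigOr isT (fun k => fo_inf (ths k))
  | Ex _ th1 => Ex (fo_inf th1)
  end.

Definition scons (T : Type) n (x : T) (v : 'I_n -> T) : 'I_n.+1 -> T :=
  fun i => if unlift ord0 i is Some j then v j else x.

Fixpoint tsubst (L : signature) n m (s : 'I_n -> term L m) (t : term L n) :
    term L m :=
  match t with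
  | Var i => s i
  | App f ts => App f (fun i => tsubst s (ts i))
  end.

Definition lift_subst (L : signature) n m (s : 'I_n -> term L m) :
    'I_n.+1 -> term L m.+1 :=
  scons (Var ord0) (fun i => tsubst (fun j => Var (lift ord0 j)) (s i)).

Fixpoint subst (L : signature) inf n (th : formula L inf n) :
    forall m, ('I_n -> term L m) -> formula L inf m :=
  match th with
  | Eq _ t1 t2 => fun _ s => Eq (tsubst s t1) (tsubst s t2)
  | Rel _ r ts => fun _ s => Rel r (fun i => tsubst s (ts i))
  | Neg _ th1 => fun _ s => Neg (subst th1 s)
  | Or _ th1 th2 => fun _ s => Or (subst th1 s) (subst th2 s)
  | BigOr _ p ths => fun _ s => BigOr p (fun k => subst (ths k) s)
  | Ex _ th1 => fun _ s => Ex (subst th1 (lift_subst s))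
  end.

Record structure (L : signature) := Structure {
  carrier :> Type;
  carrier_inhabited : inhabited carrier;
  rel_int : forall r : rel_sym L, ('I_(rel_ar r) -> carrier) -> Prop;
  fun_int : forall f : fun_sym L, ('I_(fun_ar f) -> carrier) -> carrier }.

Fixpoint eval (L : signature) (M : structure L) n (v : 'I_n -> M)
    (t : term L n) : M :=
  match t with
  | Var i => v i
  | App f ts => fun_int (fun i => eval v (ts i))
  end.

Fixpoint sat (L : signature) (M : structure L) inf n (th : formula L inf n) :
    ('I_n -> M) -> Prop :=
  match th with
  | Eq _ s t => fun v => eval v s = eval v t
  | Rel _ r ts => fun v => rel_int (fun i => eval v (ts i))
  | Neg _ th1 => fun v => ~ sat th1 v
  | Or _ th1 th2 => fun v => sat th1 v \/ sat th2 v
  | BigOr _ _ ths => fun v => exists k, sat (ths k) v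
  | Ex _ th1 => fun v => exists x, sat th1 (scons x v)
  end.

Definition no_vars (T : Type) : 'I_0 -> T :=
  fun i => False_rect T (notF (ltn_ord i)).

Definition models (L : signature) (M : structure L) inf (phi : formula L inf 0) :
    Prop :=
  sat phi (@no_vars M).

Definition valid (L : signature) inf n (th : formula L inf n) : Prop :=
  forall (M : structure L) (v : 'I_n -> M), sat th v.

Definition implies (L : signature) inf (phi psi : formula L inf 0) : Prop :=
  forall M : structure L, models M phi -> models M psi.

(* (exists x)(exists y) x <> y *)
Definition two_elements (L : signature) inf : formula L inf 0 :=
  Ex (Ex (Neg (Eq (Var (@ord_max 1)) (Var (@ord0 1))))).

Record countable_fragment (L : signature) (A : forall n, set (inf_form L n)) :
    Prop := CountableFragment {
  frag_countable :
    countable [set x : {n & inf_form L n} | A (projT1 x) (projT2 x)];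
  frag_eq : forall n (s t : term L n), A n (Eq s t);
  frag_rel : forall n (r : rel_sym L) (ts : 'I_(rel_ar r) -> term L n),
    A n (Rel r ts);
  frag_neg : forall n (psi : inf_form L n), A n (Neg psi) <-> A n psi;
  frag_or : forall n (psi1 psi2 : inf_form L n),
    A n (Or psi1 psi2) <-> A n psi1 /\ A n psi2;
  frag_bigor : forall n p (psis : nat -> inf_form L n) k,
    A n (BigOr p psis) -> A n (psis k);
  frag_ex : forall n (psi : inf_form L n.+1), A n (Ex psi) <-> A n.+1 psi;
  frag_subst : forall n m (psi : inf_form L n) (s : 'I_n -> term L m),
    A n psi -> A m (subst psi s) }.

Definition frag_equiv (L : signature) (A : forall n, set (inf_form L n))
    (M N : structure L) : Prop :=
  forall psi : inf_form L 0, A 0%N psi -> (models M psi <-> models N psi).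

(* Countable structures are taken with universe a nonempty subset of nat, so
   that finite ones are included. A code consists of the characteristic
   function of the universe, those of the relations, and the functions; the
   values outside the universe are irrelevant. The space of codes carries the
   product topology (bool and nat being discrete) and is Polish when L is
   countable; two distinct codes of one and the same structure satisfy the same
   sentences, so a set of pairwise inequivalent models contains at most one of
   them. *)
Definition code_space (L : signature) : topologicalType :=
  (prod_topology (fun _ : nat => bool) *
   prod_topology (fun _ : {r : rel_sym L & 'I_(rel_ar r) -> nat} => bool) *
   prod_topology (fun _ : {f : fun_sym L & 'I_(fun_ar f) -> nat} => nat))%type.

Definition code_univ (L : signature) (c : code_space L) (a : nat) : Prop :=
  c.1.1 a.

Definition code_rel (L : signature) (c : code_space L) (r : rel_sym L)
    (v : 'I_(rel_ar r) -> nat) : Prop :=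
  c.1.2 (existT _ r v).

Definition code_fun (L : signature) (c : code_space L) (f : fun_sym L)
    (v : 'I_(fun_ar f) -> nat) : nat :=
  c.2 (existT _ f v).

Record is_code (L : signature) (c : code_space L) : Prop := IsCode {
  code_inhabited : inhabited {a : nat | code_univ c a};
  code_closed : forall (f : fun_sym L) (v : 'I_(fun_ar f) -> nat),
    (forall i, code_univ c (v i)) -> code_univ c (code_fun c v) }.

Definition code_structure (L : signature) (c : code_space L) (hc : is_code c) :
    structure L :=
  @Structure L {a : nat | code_univ c a} (code_inhabited hc)
    (fun r v => code_rel c (fun i => sval (v i)))
    (fun f v => exist _ (code_fun c (fun i => sval (v i)))
                        (code_closed hc (fun i => proj2_sig (v i)))).

Definition perfectly_many_models (L : signature)
    (A : forall n, set (inf_form L n)) (phi : inf_form L 0) : Prop :=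
  exists P : set (code_space L),
    [/\ perfect_set P,
        P !=set0,
        forall c, P c -> exists hc : is_code c, models (code_structure hc) phi
      & forall c d (hc : is_code c) (hd : is_code d), P c -> P d -> c <> d ->
          ~ frag_equiv A (code_structure hc) (code_structure hd)].

Definition scattered (L : signature) (phi : inf_form L 0) : Prop :=
  ~ exists A : forall n, set (inf_form L n),
      countable_fragment A /\ perfectly_many_models A phi.

Record LR_prestructure (R : realType) (L : signature) := LRPrestructure {
  rK : Type;
  rE : Type;
  ev : forall n, fo_form L n -> ('I_n -> rK) -> rE;
  etop : rE;
  ebot : rE;
  ejoin : rE -> rE -> rE;
  emeet : rE -> rE -> rE;
  ecompl : rE -> rE;
  mu : rE -> R;
  dK : rK -> rK -> R;
  dE : rE -> rE -> R }.

Definition pseudometric1 (R : realType) (T : Type) (d : T -> T -> R) : Prop :=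
  [/\ forall x, d x x = 0,
      forall x y, d x y = d y x,
      forall x y z, d x z <= d x y + d y z
    & forall x y, 0 <= d x y <= 1].

(* Requirements of continuous logic on a pre-structure: pseudometrics and
   predicates with values in [0,1] and prescribed moduli of continuity, namely
   every symbol is 1-Lipschitz in each argument. *)
Record is_prestructure (R : realType) (L : signature)
    (P : LR_prestructure R L) : Prop := IsPrestructure {
  pre_dK : pseudometric1 (@dK _ _ P);
  pre_dE : pseudometric1 (@dE _ _ P);
  pre_mu01 : forall U : rE P, 0 <= mu U <= 1;
  pre_mu : forall U V : rE P, `|mu U - mu V| <= dE U V;
  pre_ev : forall n (th : fo_form L n) (f g : 'I_n -> rK P),
    dE (ev th f) (ev th g) <= \sum_(i < n) dK (f i) (g i);
  pre_join : forall U V U' V' : rE P,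
    dE (ejoin U V) (ejoin U' V') <= dE U U' + dE V V';
  pre_meet : forall U V U' V' : rE P,
    dE (emeet U V) (emeet U' V') <= dE U U' + dE V V';
  pre_compl : forall U V : rE P, dE (ecompl U) (ecompl V) <= dE U V }.

Definition symdiff (R : realType) (L : signature) (P : LR_prestructure R L)
    (U V : rE P) : rE P :=
  ejoin (emeet U (ecompl V)) (emeet V (ecompl U)).

Definition neq_form (L : signature) : fo_form L 2 :=
  Neg (Eq (Var (@ord0 1)) (Var (@ord_max 1))).
Definition eq_form (L : signature) : fo_form L 2 :=
  Eq (Var (@ord0 1)) (Var (@ord_max 1)).
Definition pair_val (T : Type) (x y : T) : 'I_2 -> T :=
  scons x (scons y (@no_vars T)).

(* [U =. V] of continuous logic: the condition dE U V = 0. *)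
Definition eeq (R : realType) (L : signature) (P : LR_prestructure R L)
    (U V : rE P) : Prop := dE U V = 0.

(* Pre-models of the pure randomization theory. As always in continuous logic
   an existential quantifier in an axiom is an infimum, hence is attained only
   up to every positive error (rand_full, rand_event and rand_atomless). *)
Record is_randomization (R : realType) (L : signature)
    (P : LR_prestructure R L) : Prop := IsRandomization {
  rand_pre : is_prestructure P;
  rand_valid : forall n (th : fo_form L n) (f : 'I_n -> rK P),
    valid th -> eeq (ev th f) (etop P);
  (* Renaming of variables. With named variables this is implicit, as the
     arguments of [[theta]] are the variables free in theta; here it links the
     symbols of one formula in different scopes, e.g. with dummy variables. *)
  rand_rename : forall n m (th : fo_form L n) (rho : 'I_n -> 'I_m)
      (f : 'I_m -> rK P),
    eeq (ev (subst th (fun i => Var (rho i))) f) (ev th (f \o rho));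
  rand_neg : forall n (th : fo_form L n) (f : 'I_n -> rK P),
    eeq (ev (Neg th) f) (ecompl (ev th f));
  rand_or : forall n (th1 th2 : fo_form L n) (f : 'I_n -> rK P),
    eeq (ev (Or th1 th2) f) (ejoin (ev th1 f) (ev th2 f));
  rand_full : forall n (th : fo_form L n.+1) (f : 'I_n -> rK P) (eps : R),
    0 < eps ->
    exists g : rK P, dE (ev th (scons g f)) (ev (Ex th) f) < eps;
  rand_joinC : forall U V : rE P, eeq (ejoin U V) (ejoin V U);
  rand_meetC : forall U V : rE P, eeq (emeet U V) (emeet V U);
  rand_joinA : forall U V W : rE P,
    eeq (ejoin U (ejoin V W)) (ejoin (ejoin U V) W);
  rand_meetA : forall U V W : rE P,
    eeq (emeet U (emeet V W)) (emeet (emeet U V) W);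
  rand_joinIr : forall U V W : rE P,
    eeq (ejoin U (emeet V W)) (emeet (ejoin U V) (ejoin U W));
  rand_meetUr : forall U V W : rE P,
    eeq (emeet U (ejoin V W)) (ejoin (emeet U V) (emeet U W));
  rand_join0 : forall U : rE P, eeq (ejoin U (ebot P)) U;
  rand_meet1 : forall U : rE P, eeq (emeet U (etop P)) U;
  rand_joinN : forall U : rE P, eeq (ejoin U (ecompl U)) (etop P);
  rand_meetN : forall U : rE P, eeq (emeet U (ecompl U)) (ebot P);
  rand_dK : forall f g : rK P, dK f g = mu (ev (neq_form L) (pair_val f g));
  rand_dE : forall U V : rE P, dE U V = mu (symdiff U V);
  rand_event : forall (U : rE P) (eps : R), 0 < eps ->
    exists a b : rK P, dE U (ev (eq_form L) (pair_val a b)) < eps;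
  rand_mu1 : mu (etop P) = 1;
  rand_mu0 : mu (ebot P) = 0;
  rand_muU : forall U V : rE P,
    mu U + mu V = mu (ejoin U V) + mu (emeet U V);
  rand_atomless : forall (U : rE P) (eps : R), 0 < eps ->
    exists V : rE P, `|mu (emeet U V) - mu U / 2%:R| < eps }.

Definition separated (R : realType) (T : Type) (d : T -> T -> R) : Prop :=
  forall x y, d x y = 0 -> x = y.

Definition complete_dist (R : realType) (T : Type) (d : T -> T -> R) : Prop :=
  forall u : nat -> T,
    (forall eps : R, 0 < eps -> exists N : nat, forall i j : nat,
       (N <= i)%N -> (N <= j)%N -> d (u i) (u j) < eps) ->
    exists x : T, forall eps : R, 0 < eps -> exists N : nat, forall i : nat,
       (N <= i)%N -> d (u i) x < eps.

Definition separable_dist (R : realType) (T : Type) (d : T -> T -> R) : Prop :=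
  exists D : set T, countable D /\
    forall (x : T) (eps : R), 0 < eps -> exists2 y, D y & d x y < eps.

Definition is_complete_randomization (R : realType) (L : signature)
    (P : LR_prestructure R L) : Prop :=
  [/\ is_randomization P,
      separated (@dK _ _ P) /\ separated (@dE _ _ P)
    & complete_dist (@dK _ _ P) /\ complete_dist (@dE _ _ P)].

Definition separable_LR (R : realType) (L : signature)
    (P : LR_prestructure R L) : Prop :=
  separable_dist (@dK _ _ P) /\ separable_dist (@dE _ _ P).

Definition ele (R : realType) (L : signature) (P : LR_prestructure R L)
    (U V : rE P) : Prop := emeet U V = U.

Definition is_esup (R : realType) (L : signature) (P : LR_prestructure R L)
    (S : set (rE P)) (U : rE P) : Prop :=
  (forall V, S V -> ele V U) /\
  (forall W, (forall V, S V -> ele V W) -> ele U W).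

Record inf_events (R : realType) (L : signature) (P : LR_prestructure R L)
    (J : forall n, inf_form L n -> ('I_n -> rK P) -> rE P) : Prop := InfEvents {
  inf_fo : forall n (th : fo_form L n) f, J n (fo_inf th) f = ev th f;
  inf_neg : forall n (psi : inf_form L n) f, J n (Neg psi) f = ecompl (J n psi f);
  inf_or : forall n (psi1 psi2 : inf_form L n) f,
    J n (Or psi1 psi2) f = ejoin (J n psi1 f) (J n psi2 f);
  inf_bigor : forall n p (psis : nat -> inf_form L n) f,
    is_esup (range (fun k => J n (psis k) f)) (J n (BigOr p psis) f);
  inf_ex : forall n (psi : inf_form L n.+1) f,
    is_esup (range (fun g : rK P => J n.+1 psi (scons g f))) (J n (Ex psi) f) }.

(* To be used for complete separable randomizations, where the family J exists
   and is unique. *)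
Definition randomization_of (R : realType) (L : signature) (phi : inf_form L 0)
    (P : LR_prestructure R L) : Prop :=
  exists J : forall n, inf_form L n -> ('I_n -> rK P) -> rE P,
    inf_events J /\ mu (J 0%N phi (@no_vars (rK P))) = 1.

(* Isomorphism of pre-structures: an isomorphism of their reductions, i.e. of
   the quotients by distance 0. *)
Record is_isomorphism (R : realType) (L : signature) (P Q : LR_prestructure R L)
    (hK : rK P -> rK Q) (hE : rE P -> rE Q) : Prop := IsIsomorphism {
  iso_dK : forall f g, dK (hK f) (hK g) = dK f g;
  iso_dE : forall U V, dE (hE U) (hE V) = dE U V;
  iso_mu : forall U, mu (hE U) = mu U;
  iso_ev : forall n (th : fo_form L n) (f : 'I_n -> rK P),
    eeq (hE (ev th f)) (ev th (hK \o f));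
  iso_top : eeq (hE (etop P)) (etop Q);
  iso_bot : eeq (hE (ebot P)) (ebot Q);
  iso_join : forall U V, eeq (hE (ejoin U V)) (ejoin (hE U) (hE V));
  iso_meet : forall U V, eeq (hE (emeet U V)) (emeet (hE U) (hE V));
  iso_compl : forall U, eeq (hE (ecompl U)) (ecompl (hE U));
  iso_surjK : forall g, exists f, dK (hK f) g = 0;
  iso_surjE : forall V, exists U, dE (hE U) V = 0 }.

Definition isomorphic (R : realType) (L : signature)
    (P Q : LR_prestructure R L) : Prop :=
  exists (hK : rK P -> rK Q) (hE : rE P -> rE Q), is_isomorphism hK hE.

Definition unit_co (R : realType) : Type := {t : R | 0 <= t < 1}.

Section BorelUnit.
Variable R : realType.
Implicit Types A B : set (unit_co R).

Definition to_line A : set (measurableTypeR R) := (@proj1_sig _ _) @` A.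

Definition borel A : Prop := measurable (to_line A).

Definition leb A : R := fine (lebesgue_measure (to_line A)).

Lemma to_lineE A (t : unit_co R) : to_line A (sval t) <-> A t.
Proof.
by split=> [[s As /val_inj <-]|At] //; exists t.
Qed.

Lemma to_lineT : to_line setT = `[0, 1[%classic.
Proof.
apply/seteqP; split=> [_ [t _ <-]|x] /=; rewrite in_itv /=; first by case: t.
by move=> x01; exists (exist (fun t : R => is_true (0 <= t < 1)) x x01).
Qed.

Lemma borelT : borel setT.
Proof. by rewrite /borel to_lineT; exact: measurable_itv. Qed.

Lemma borelC A : borel A -> borel (~` A).
Proof.
move=> mA; rewrite /borel.
suff -> : to_line (~` A) = to_line setT `\` to_line A.
  by apply: measurableD => //; exact: borelT.
apply/seteqP; split=> [_ [t nAt <-]|x [[t _ <-]] nA].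
  by split; [exact/to_lineE | move/to_lineE].
by apply/to_lineE => /to_lineE.
Qed.

Lemma borel0 : borel set0.
Proof. by rewrite -setCT; apply: borelC; exact: borelT. Qed.

Lemma borel_bigcupT (I : Type) (F : I -> set (unit_co R)) :
  countable [set: I] -> (forall i, borel (F i)) -> borel (\bigcup_i F i).
Proof.
move=> cI mF; rewrite /borel /to_line image_bigcup.
exact: countable_bigcupT_measurable.
Qed.

Lemma borelU A B : borel A -> borel B -> borel (A `|` B).
Proof.
by move=> mA mB; rewrite /borel /to_line image_setU; exact: measurableU.
Qed.

Lemma borelI A B : borel A -> borel B -> borel (A `&` B).
Proof.
move=> mA mB; rewrite -(setCK (A `&` B)) setCI.
by apply: borelC; apply: borelU; exact: borelC.
Qed.

Lemma borel_forall (n : nat) (F : 'I_n -> set (unit_co R)) :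
  (forall i, borel (F i)) -> borel [set t | forall i, F i t].
Proof.
move=> mF; have -> : [set t | forall i, F i t] = ~` \bigcup_i ~` F i.
  apply/seteqP; split=> [t Ft [i _]|t nF i]; first by apply; exact: Ft.
  by apply: contrapT => nFi; apply: nF; exists i.
apply: borelC; apply: borel_bigcupT => [|i]; first exact: countableP.
by apply: borelC; exact: mF.
Qed.
End BorelUnit.

Lemma countable_sigma_fun (I : Type) (M : I -> Type) (n : nat) :
  countable [set: I] -> (forall i, countable [set: M i]) ->
  countable [set: {i : I & 'I_n -> M i}].
Proof.
move=> /countable_injP[g gI] cM.
have /all_sig[h hI] : forall i, {h : M i -> nat | injective h}.
  move=> i; apply: cid; have /countable_injP[h hI] := cM i.
  by exists h => x y; apply: hI; rewrite inE.
pose e (x : {i : I & 'I_n -> M i}) : nat * {ffun 'I_n -> nat} :=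
  (g (projT1 x), [ffun j => h _ (projT2 x j)]).
have eI : injective e.
  move=> [i v] [i' v'] [] /= /(gI i i') ii'.
  have {}ii' : i = i' by apply: ii'; rewrite inE.
  subst i' => /ffunP vv'; congr existT; apply: funext => j.
  by have := vv' j; rewrite !ffunE => /hI.
by apply/countable_injP; exists (pickle \o e) => x y _ _ /(pcan_inj pickleK)/eI.
Qed.

Record basic_data (R : realType) (L : signature) (phi : inf_form L 0) :=
  BasicData {
    bidx : Type;
    bidx_countable : countable [set: bidx];
    block : bidx -> set (unit_co R);
    block_borel : forall i, borel (block i);
    block_pos : forall i, 0 < leb (block i);
    block_trivIset : trivIset setT block;
    block_cover : \bigcup_i block i = setT;
    bmod : bidx -> structure L;
    bmod_countable : forall i, countable [set: bmod i];
    bmod_models : forall i, models (bmod i) phi }.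

Section Basic.
Variables (R : realType) (L : signature) (phi : inf_form L 0).
Variable D : basic_data R phi.

(* The union of the models is taken as a disjoint one; f t lies in the model
   attached to the block of t. *)
Definition bK : Type :=
  {f : unit_co R -> {i : bidx D & bmod i} |
     (forall i t, block i t -> projT1 (f t) = i) /\
     (forall i (a : bmod i),
        borel [set t | block i t /\ f t = existT _ i a])}.

Definition bE : Type := {A : set (unit_co R) | borel A}.

Definition bev_set n (th : fo_form L n) (f : 'I_n -> bK) : set (unit_co R) :=
  [set t | exists i (v : 'I_n -> bmod i),
     [/\ block i t, forall j, sval (f j) t = existT _ i (v j) & sat th v]].

Lemma borel_bev n (th : fo_form L n) (f : 'I_n -> bK) : borel (bev_set th f).
Proof.
pose F (x : {i : bidx D & 'I_n -> bmod i}) : set (unit_co R) :=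
  [set t | [/\ block (projT1 x) t,
     forall j, sval (f j) t = existT _ (projT1 x) (projT2 x j)
     & sat th (projT2 x)]].
have -> : bev_set th f = \bigcup_x F x.
  apply/seteqP; split=> [t [i [v vt]]|t [[i v] _ vt]]; last by exists i, v.
  by exists (existT _ i v).
apply: borel_bigcupT => [|[i v]].
  by apply: countable_sigma_fun; [exact: bidx_countable|exact: bmod_countable].
have [sv|nsv] := pselect (sat th v); last first.
  suff -> : F (existT _ i v) = set0 by exact: borel0.
  by apply/seteqP; split=> t // [].
suff -> : F (existT _ i v) = block i `&`
    [set t | forall j, (block i `&` [set t | sval (f j) t = existT _ i (v j)]) t].
  apply: borelI; first exact: block_borel.
  by apply: borel_forall => j; exact: (proj2 (svalP (f j)) i (v j)).
apply/seteqP; split=> [t [Bt ft _]|t [Bt ft]] /=; first by split=> // j; split.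
by split=> // j; have [] := ft j.
Qed.

Definition bev n (th : fo_form L n) (f : 'I_n -> bK) : bE :=
  exist _ (bev_set th f) (borel_bev th f).
Definition bjoin (A B : bE) : bE :=
  exist _ (sval A `|` sval B) (borelU (svalP A) (svalP B)).
Definition bmeet (A B : bE) : bE :=
  exist _ (sval A `&` sval B) (borelI (svalP A) (svalP B)).
Definition bcompl (A : bE) : bE := exist _ (~` sval A) (borelC (svalP A)).

Definition basic_randomization : LR_prestructure R L :=
  @LRPrestructure R L bK bE bev
    (exist _ setT (@borelT R)) (exist _ set0 (@borel0 R))
    bjoin bmeet bcompl
    (fun A => leb (sval A))
    (fun f g => leb [set t | sval f t <> sval g t])
    (fun A B => leb ((sval A `\` sval B) `|` (sval B `\` sval A))).
End Basic.

Definition few_separable_randomizations (R : realType) (L : signature)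
    (phi : inf_form L 0) : Prop :=
  forall P : LR_prestructure R L,
    is_complete_randomization P -> separable_LR P -> randomization_of phi P ->
    exists D : basic_data R phi, isomorphic P (basic_randomization D).

(* Main.v *)
(* A complete separable randomization is a measurable field of countable
   structures (N_t), t in [0, 1): its events are identified with the Borel sets
   modulo null sets, and a dense sequence of random elements names the elements
   of every N_t.

   Suppose that, for some countable set of formulas, the type of a named tuple d
   in N_t is not almost surely one of countably many types. Then a Cantor scheme
   of compact sets W_s of positive measure yields points t_x (x in 2^omega) such
   that no tuple of N_(t_x) has the type of d in N_(t_y) for y <> x. The sentences
   "some tuple has its type in the closed set of types attached to the node s"
   separate the models N_(t_x), so phi is not scattered. Hence for scattered phi
   all these type distributions are purely atomic.

   The coincidence measure of {(s, t) : d in N_s and e in N_t have the same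
   A-type} decreases when the countable set A of formulas grows, so some A makes
   it minimal for all d and e at once. For such an A equality of A-types is, off
   a null set, a back-and-forth system: N_s and N_t are isomorphic as soon as
   they have the same A-theory, by an isomorphism which is measurable in t if
   the back-and-forth always makes the least choice. The countably many A-theories
   of positive probability are the blocks of the basic randomization. *)
From HB Require Import structures.
From mathcomp Require Import all_boot all_order all_algebra.
From mathcomp Require Import all_classical all_reals all_analysis.
From mathcomp Require Import measurable_realfun lra zify.
Require Import Defs.

Set Implicit Arguments.
Unset Strict Implicit.
Unset Printing Implicit Defensive.

Import Order.TTheory GRing.Theory Num.Theory.
Import numFieldNormedType.Exports.

Local Open Scope classical_set_scope.
Local Open Scope ring_scope.

(** * Formulas and countable fragments *)

(** Scatteredness speaks of sentences, whereas a type belongs to a chosen tuple, and one countable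
    model may realize many types. The points t_x must therefore be kept apart by formulas that fail
    at every tuple of the other model; there are only countably many tuples of names, and the j-th
    one is disposed of at all levels beyond j of the scheme. Minimality of the coincidence measures
    takes the place of Scott ranks. Let B extend A by the formulas saying that a given A-type of
    positive probability is realized by one more element. If two tuples had equal A-types but
    different B-types, the latter, being atoms, would span a rectangle of positive measure inside
    the A-coincidence set and outside the B-coincidence set, against minimality. So equal A-types
    allow the same extensions, which is the back-and-forth step. Everything on the measure side
    holds only up to null sets, so conditions are imposed countably many at a time, with a dense
    sequence standing for all random elements. Surjectivity of the final map needs more: gluing of
    random elements along events, and completeness. *)

Section Countability.

Lemma injective_countable (T U : Type) (f : T -> U) :
  injective f -> countable [set: U] -> countable [set: T].
Proof.
move=> fI /countable_injP[g gI]; apply/countable_injP; exists (g \o f).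
by move=> x y _ _ /= gxy; apply/fI/gI; rewrite ?inE.
Qed.

Lemma countable_inj (T : Type) :
  countable [set: T] -> exists g : T -> nat, injective g.
Proof.
by move=> /countable_injP[g gI]; exists g => x y; apply: gI; rewrite inE.
Qed.

Lemma countable_enum (T : Type) :
  countable [set: T] -> inhabited T -> exists g : nat -> T, forall x, exists n, g n = x.
Proof.
move=> /countable_inj[g gI] [x0].
exists (fun n => if pselect (exists x, g x = n) is left h then sval (cid h) else x0).
move=> x; exists (g x); case: pselect => [h|]; last by case; exists x.
by apply: gI; case: (cid h).
Qed.

Lemma countable_set_enum (T : Type) (A : set T) :
  countable A -> A !=set0 -> exists g : nat -> T, A = range g.
Proof.
move=> cA [x0 Ax0].
have cS : countable [set: {x | A x}].
  have /countable_injP[f fI] := cA.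
  apply/countable_injP; exists (f \o @sval _ A) => x y _ _ /= fxy.
  case: x y fxy => [x Ax] [y Ay] /= fxy.
  have xy : x = y by apply: fI fxy; rewrite inE.
  by subst y; congr exist; exact: Prop_irrelevance.
have [g gS] := countable_enum cS (inhabits (exist A x0 Ax0)).
exists (fun n => sval (g n)); apply/seteqP; split=> [x Ax|_ [n _ <-]].
  by have [n gn] := gS (exist A x Ax); exists n => //; rewrite gn.
exact: (svalP (g n)).
Qed.

Lemma countable_sigT (I : Type) (M : I -> Type) :
  countable [set: I] -> (forall i, countable [set: M i]) ->
  countable [set: {i : I & M i}].
Proof.
move=> /countable_inj[g gI] cM.
have /all_sig[h hI] : forall i, {h : M i -> nat | injective h}.
  by move=> i; apply: cid; exact: countable_inj.
pose e (x : {i : I & M i}) : nat * nat := (g (projT1 x), h _ (projT2 x)).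
have eI : injective e.
  by move=> [i v] [j w] [] /= /gI ij; subst j => /hI ->.
exact: injective_countable eI (countableP _).
Qed.

Lemma countable_ord_fun (T : Type) (n : nat) :
  countable [set: T] -> countable [set: 'I_n -> T].
Proof.
move=> /countable_inj[g gI]; pose e (v : 'I_n -> T) := [ffun i => g (v i)].
have eI : injective e.
  move=> v w /ffunP vw; apply: funext => i.
  by have := vw i; rewrite !ffunE => /gI.
exact: injective_countable eI (countableP _).
Qed.

Lemma countable_closure (T I : Type) (S : set T) (u : I -> T -> T)
    (b : T -> T -> T) :
  countable [set: I] -> countable S ->
  exists C : set T, [/\ countable C, S `<=` C,
    forall i x, C x -> C (u i x) & forall x y, C x -> C y -> C (b x y)].
Proof.
move=> cI cS.
pose next (X : set T) : set T :=
  X `|` (\bigcup_i (u i @` X)) `|` ((fun p => b p.1 p.2) @` (X `*` X)).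
pose X n := iter n next S.
have cX n : countable (X n).
  elim: n => //= n IHn.
  have cim (U V : Type) (f : U -> V) (A : set U) : countable A -> countable (f @` A).
    by move=> cA; apply: sub_countable cA; exact: card_image_le.
  rewrite /next -bigcup2E; apply: bigcup_countable; first exact: countableP.
  case=> [|[|?]] _ //=; last exact: cim (countableX IHn IHn).
  rewrite -bigcup2E; apply: bigcup_countable; first exact: countableP.
  case=> [|[|?]] _ //=.
  by apply: bigcup_countable => // i _; exact: cim.
(* The stages increase, so the two arguments of [b] can be found at a common stage. *)
have leX m n : (m <= n)%N -> X m `<=` X n.
  elim: n => [|n IHn]; first by rewrite leqn0 => /eqP ->.
  rewrite leq_eqVlt => /predU1P[-> //|]; rewrite ltnS => /IHn mn x /mn Xx.
  by left; left.
exists (\bigcup_n X n); split.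
- by apply: bigcup_countable => //; exact: countableP.
- by move=> x Sx; exists 0%N.
- by move=> i x [n _ Xx]; exists n.+1 => //; left; right; exists i => //; exists x.
- move=> x y [n _ Xx] [m _ Xy]; exists (maxn n m).+1 => //; right; exists (x, y) => //.
  by split; [apply: leX Xx; exact: leq_maxl|apply: leX Xy; exact: leq_maxr].
Qed.

End Countability.

Section Logic.
Variable L : signature.

Lemma scons0 (T : Type) n (x : T) (v : 'I_n -> T) : scons x v ord0 = x.
Proof. by rewrite /scons unlift_none. Qed.

Lemma sconsS (T : Type) n (x : T) (v : 'I_n -> T) i : scons x v (lift ord0 i) = v i.
Proof. by rewrite /scons liftK. Qed.

Lemma scons_eta (T : Type) n (v : 'I_n.+1 -> T) :
  v = scons (v ord0) (fun i => v (lift ord0 i)).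
Proof.
by apply: funext => i; case: (unliftP ord0 i) => [j ->|->]; rewrite ?scons0 ?sconsS.
Qed.

Lemma comp_scons (T U : Type) (g : T -> U) n (x : T) (v : 'I_n -> T) :
  g \o scons x v = scons (g x) (g \o v).
Proof.
apply: funext => i.
by case: (unliftP ord0 i) => [j ->|->]; rewrite /= ?scons0 ?sconsS.
Qed.

Lemma no_varsE (T : Type) (v : 'I_0 -> T) : v = @no_vars T.
Proof. by apply: funext => -[]. Qed.

Lemma comp_pair_val (T U : Type) (g : T -> U) x y :
  g \o pair_val x y = pair_val (g x) (g y).
Proof. by rewrite /pair_val !comp_scons; congr scons; congr scons; exact: no_varsE. Qed.

Lemma pair_val0 (T : Type) (x y : T) : pair_val x y ord0 = x.
Proof. exact: scons0. Qed.

Lemma pair_val1 (T : Type) (x y : T) : pair_val x y ord_max = y.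
Proof.
have -> : ord_max = lift ord0 ord0 :> 'I_2 by exact: val_inj.
by rewrite /pair_val sconsS scons0.
Qed.

Lemma term_eval_subst (M : structure L) n m (s : 'I_n -> term L m) (v : 'I_m -> M) t :
  eval v (tsubst s t) = eval (fun i => eval v (s i)) t.
Proof. by elim: t => [//|f ts IH] /=; congr fun_int; apply: funext. Qed.

Lemma eval_lift_subst (M : structure L) n m (s : 'I_n -> term L m) x (v : 'I_m -> M) :
  (fun i => eval (scons x v) (lift_subst s i)) = scons x (fun i => eval v (s i)).
Proof.
apply: funext => i; rewrite /lift_subst.
case: (unliftP ord0 i) => [j ->|->]; rewrite ?sconsS ?scons0 /= ?scons0 //.
by rewrite term_eval_subst; congr eval; apply: funext => k /=; rewrite sconsS.
Qed.

Lemma sat_subst (M : structure L) inf n (th : formula L inf n) :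
  forall m (s : 'I_n -> term L m) (v : 'I_m -> M),
  sat (subst th s) v <-> sat th (fun i => eval v (s i)).
Proof.
elim: th => {n} [n t1 t2|n r ts|n th IH|n th1 IH1 th2 IH2|n p ths IH|n th IH] m s v /=.
- by rewrite !term_eval_subst.
- suff -> : (fun i => eval v (tsubst s (ts i))) =
            (fun i => eval (fun j => eval v (s j)) (ts i)) by [].
  by apply: funext => i; rewrite term_eval_subst.
- by have := IH m s v; tauto.
- by have := IH1 m s v; have := IH2 m s v; tauto.
- by split=> -[k] /IH; exists k.
- split=> -[x]; first by move=> /IH; rewrite eval_lift_subst; exists x.
  by move=> hx; exists x; apply/IH; rewrite eval_lift_subst.
Qed.

Lemma sat_fo_inf (M : structure L) inf n (th : formula L inf n) (v : 'I_n -> M) :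
  sat (fo_inf th) v <-> sat th v.
Proof.
elim: th v => {n} [//|//|n th IH|n th1 IH1 th2 IH2|n p ths IH|n th IH] v /=.
- by have := IH v; tauto.
- by have := IH1 v; have := IH2 v; tauto.
- by split=> -[k] /IH; exists k.
- by split=> -[k] /IH; exists k.
Qed.

Lemma sat_Ex (M : structure L) inf n (th : formula L inf n.+1) (v : 'I_n -> M) :
  sat (Ex th) v = exists x, sat th (scons x v).
Proof. by []. Qed.

Lemma sat_BigOr (M : structure L) inf n p (ths : nat -> formula L inf n) (v : 'I_n -> M) :
  sat (BigOr p ths) v = exists k, sat (ths k) v.
Proof. by []. Qed.

Definition And inf n (a b : formula L inf n) := Neg (Or (Neg a) (Neg b)).

Lemma sat_And (M : structure L) inf n (a b : formula L inf n) (v : 'I_n -> M) :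
  sat (And a b) v <-> sat a v /\ sat b v.
Proof. by rewrite /=; split; have := EM (sat a v); have := EM (sat b v); tauto. Qed.

Definition Imp inf n (a b : formula L inf n) := Or (Neg a) b.

Lemma sat_Imp (M : structure L) inf n (a b : formula L inf n) (v : 'I_n -> M) :
  sat (Imp a b) v <-> (sat a v -> sat b v).
Proof. by rewrite /=; have := EM (sat a v); tauto. Qed.

Fixpoint Imps inf n k (F : 'I_k -> formula L inf n) (b : formula L inf n) : formula L inf n :=
  match k return ('I_k -> formula L inf n) -> formula L inf n with
  | 0 => fun _ => b
  | k'.+1 => fun F => Imp (F ord0) (Imps (fun i => F (lift ord0 i)) b)
  end F.

Lemma sat_Imps (M : structure L) inf n k (F : 'I_k -> formula L inf n) b (v : 'I_n -> M) :
  sat (Imps F b) v <-> ((forall i, sat (F i) v) -> sat b v).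
Proof.
elim: k F => [|k IH] F; first by split=> [sb _|]; [|apply=> -[]].
split=> [/sat_Imp + Fv|Fb]; first by move=> /(_ (Fv _))/IH; apply.
apply/sat_Imp => F0; apply/IH => Fl; apply: Fb => i.
by case: (unliftP ord0 i) => [j ->|->].
Qed.

Definition Falsum inf n : formula L inf n :=
  Ex (Neg (Eq (Var ord0) (Var ord0))).

Lemma sat_Falsum (M : structure L) inf n (v : 'I_n -> M) : sat (Falsum inf n) v <-> False.
Proof. by split=> // -[x []]. Qed.

(** [BigOr] takes sequences only; indices that code nothing, or nothing in [P], are filled with a
    false disjunct. *)
Definition BOr (T : countType) n (P : T -> Prop) (F : T -> inf_form L n) : inf_form L n :=
  BigOr isT (fun k => if unpickle k is Some x then
                        if pselect (P x) then F x else Falsum true n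
                      else Falsum true n).

Lemma sat_BOr (M : structure L) (T : countType) n (P : T -> Prop)
    (F : T -> inf_form L n) (v : 'I_n -> M) :
  sat (BOr P F) v <-> exists2 x, P x & sat (F x) v.
Proof.
rewrite sat_BigOr; split=> [[k]|[x Px Fx]].
  case: (unpickle k) => [x|]; last by move=> /sat_Falsum.
  by case: pselect => [Px Fx|nPx /sat_Falsum//]; exists x.
by exists (pickle x); rewrite pickleK; case: pselect.
Qed.

Definition BAnd (T : countType) n (P : T -> Prop) (F : T -> inf_form L n) : inf_form L n :=
  Neg (BOr P (fun x => Neg (F x))).

Lemma sat_BAnd (M : structure L) (T : countType) n (P : T -> Prop)
    (F : T -> inf_form L n) (v : 'I_n -> M) :
  sat (BAnd P F) v <-> forall x, P x -> sat (F x) v.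
Proof.
split=> [nor x Px|PF /sat_BOr[x /PF]//].
by apply: contrapT => nF; apply: nor; apply/sat_BOr; exists x.
Qed.

Fixpoint exists_closure inf n : formula L inf n -> formula L inf 0 :=
  match n with
  | 0 => id
  | n'.+1 => fun th => exists_closure (Ex th)
  end.

Lemma sat_exists_closure (M : structure L) inf n (th : formula L inf n) :
  models M (exists_closure th) <-> exists v : 'I_n -> M, sat th v.
Proof.
elim: n th => [|n IH] th /=.
  by split=> [|[v]]; [exists (@no_vars M)|rewrite (no_varsE v)].
split=> [/IH[v [x]]|[v]]; first by exists (scons x v).
by rewrite (scons_eta v) => sv; apply/IH; eexists; eexists; exact: sv.
Qed.

Lemma sat_bijection (M N : structure L) (h : M -> N) :
  (forall n (t : term L n) v, h (eval v t) = eval (h \o v) t) ->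
  (forall r v, rel_int (r := r) v <-> rel_int (r := r) (h \o v)) ->
  injective h -> (forall y, exists x, h x = y) ->
  forall inf n (th : formula L inf n) v, sat th v <-> sat th (h \o v).
Proof.
move=> hev hrel hI hS inf n th.
elim: th => {n} [n t1 t2|n r ts|n th IH|n th1 IH1 th2 IH2|n p ths IH|n th IH] v /=.
- by rewrite -!hev; split=> [->//|/hI].
- have -> : (fun i => eval (h \o v) (ts i)) = h \o (fun i => eval v (ts i)).
    by apply: funext => i /=; rewrite hev.
  exact: hrel.
- by have := IH v; tauto.
- by have := IH1 v; have := IH2 v; tauto.
- by split=> -[k] /IH; exists k.
- split=> [[x /IH]|[y]]; first by rewrite comp_scons; exists (h x).
  by have [x <-] := hS y; rewrite -comp_scons => /IH; exists x.
Qed.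

(** Agreement on atomic formulas makes the correspondence of [p i] with [q i] an isomorphism. Stated
    through names, it needs no function between the carriers, and names may repeat. *)
Lemma sat_named (I : Type) (M N : structure L) (p : I -> M) (q : I -> N) :
  (forall x, exists i, p i = x) -> (forall y, exists i, q i = y) ->
  (forall n (s t : term L n) (v : 'I_n -> I),
     sat (Eq (inf := true) s t) (p \o v) <-> sat (Eq (inf := true) s t) (q \o v)) ->
  (forall n r (ts : _ -> term L n) (v : 'I_n -> I),
     sat (Rel (inf := true) r ts) (p \o v) <-> sat (Rel (inf := true) r ts) (q \o v)) ->
  forall inf n (th : formula L inf n) v, sat th (p \o v) <-> sat th (q \o v).
Proof.
move=> pS qS hEq hRel inf n th.
elim: th => {n} [n t1 t2|n r ts|n th IH|n th1 IH1 th2 IH2|n b ths IH|n th IH] v /=.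
- exact: hEq.
- exact: hRel.
- by have := IH v; tauto.
- by have := IH1 v; have := IH2 v; tauto.
- by split=> -[k] /IH; exists k.
- split=> -[x]; [have [i <-] := pS x|have [i <-] := qS x];
    by rewrite -comp_scons => /IH; rewrite comp_scons; eexists; eassumption.
Qed.

(** * Countability of the syntax *)

Hypothesis hL : countable_signature L.

Lemma countable_term n : countable [set: term L n].
Proof.
have [g gI] := countable_inj hL.2.
pose fix enc (t : term L n) : GenTree.tree nat :=
  match t with
  | Var i => GenTree.Leaf (i : nat)
  | App f ts => GenTree.Node (g f) [seq enc (ts i) | i <- enum 'I_(fun_ar f)]
  end.
suff encI : injective enc by exact: injective_countable encI (countableP _).
move=> t; elim: t => [i|f ts IH] [j|f' ts'] //=; first by case=> /val_inj ->.
case=> /gI ff'; subst f' => /eq_in_map eqts; congr App; apply: funext => i.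
by apply: IH; apply: eqts; rewrite mem_enum.
Qed.

Lemma countable_atoms inf :
  countable ([set x : {n & formula L inf n} | exists n s t, x = existT _ n (Eq s t)] `|`
             [set x | exists n r ts, x = existT _ n (Rel r ts)]).
Proof.
have cim (U V : Type) (f : U -> V) : countable [set: U] -> countable (range f).
  by move=> cA; apply: sub_countable cA; exact: card_image_le.
rewrite -bigcup2E; apply: bigcup_countable; first exact: countableP.
case=> [|[|?]] _ //=.
  apply: sub_countable (cim _ _ (fun x : {n & (term L n * term L n)%type} =>
    existT (formula L inf) (projT1 x) (Eq (projT2 x).1 (projT2 x).2)) _).
    apply: subset_card_le => _ [n [s [t ->]]].
    by exists (existT (fun n => (term L n * term L n)%type) n (s, t)).
  apply: countable_sigT => [|n]; first exact: countableP.
  by rewrite -setXTT; apply: countableX; exact: countable_term.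
apply: sub_countable (cim _ _ (fun x : {n & {r : rel_sym L & 'I_(rel_ar r) -> term L n}} =>
  existT (formula L inf) (projT1 x) (Rel (projT1 (projT2 x)) (projT2 (projT2 x)))) _).
  apply: subset_card_le => _ [n [r [ts ->]]].
  by exists (existT (fun n => {r : rel_sym L & 'I_(rel_ar r) -> term L n}) n (existT _ r ts)).
apply: countable_sigT => [|n]; first exact: countableP.
apply: countable_sigT => [|r]; first exact: hL.1.
by apply: countable_ord_fun; exact: countable_term.
Qed.

(* Unary and binary operations on formulas of arbitrary arity, the identity
   where they make no sense; the last family of unary ones are the
   substitutions. *)
Inductive unop : Type :=
  uNeg | uEx | uUnneg | uLeft | uRight | uUnex | uNth of nat
| uSubst of {nm : nat * nat & 'I_nm.1 -> term L nm.2}.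

Definition unop_apply inf (o : unop) (x : {n & formula L inf n}) : {n & formula L inf n} :=
  match o with
  | uNeg => existT _ _ (Neg (projT2 x))
  | uEx => match x with
           | existT (n.+1) th => existT _ n (Ex th)
           | _ => x
           end
  | uUnneg => match projT2 x with @Neg _ _ n th => existT _ n th | _ => x end
  | uLeft => match projT2 x with @Or _ _ n th _ => existT _ n th | _ => x end
  | uRight => match projT2 x with @Or _ _ n _ th => existT _ n th | _ => x end
  | uUnex => match projT2 x with @Ex _ _ n th => existT _ _ th | _ => x end
  | uNth k => match projT2 x with @BigOr _ _ n _ ths => existT _ _ (ths k) | _ => x end
  | uSubst (existT nm s) =>
      match eqVneq (projT1 x) nm.1 with
      | EqNotNeq e => existT _ nm.2 (subst (ecast n (formula L inf n) e (projT2 x)) s)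
      | _ => x
      end
  end.

Definition or_apply inf (x y : {n & formula L inf n}) : {n & formula L inf n} :=
  match eqVneq (projT1 y) (projT1 x) with
  | EqNotNeq e => existT _ _ (Or (projT2 x) (ecast n (formula L inf n) e (projT2 y)))
  | _ => x
  end.

Lemma or_applyE inf n (a b : formula L inf n) :
  or_apply (existT _ n a) (existT _ n b) = existT _ n (Or a b).
Proof.
rewrite /or_apply /=; case: eqVneq => [e|/eqP//].
by rewrite (eq_irrelevance e erefl).
Qed.

Lemma subst_applyE inf n m (a : formula L inf n) (s : 'I_n -> term L m) :
  unop_apply (uSubst (existT _ (n, m) s)) (existT _ n a) = existT _ m (subst a s).
Proof.
rewrite /=; case: eqVneq => [e|/eqP//].
by rewrite (eq_irrelevance e erefl).
Qed.

Lemma countable_unop : countable [set: unop].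
Proof.
have [g gI] : exists g : {nm : nat * nat & 'I_nm.1 -> term L nm.2} -> nat, injective g.
  apply: countable_inj; apply: countable_sigT => [|nm]; first exact: countableP.
  by apply: countable_ord_fun; exact: countable_term.
pose e (o : unop) : nat * nat := match o with
  | uNeg => (0, 0) | uEx => (1, 0) | uUnneg => (2, 0) | uLeft => (3, 0)
  | uRight => (4, 0) | uUnex => (5, 0) | uNth k => (6, k) | uSubst s => (7, g s) end%N.
apply: (@injective_countable _ _ e); last exact: countableP.
by move=> [||||||k|s] [||||||k'|s'] //= [] => [->|/gI ->].
Qed.

Lemma countable_closed_formulas inf (S : set {n & formula L inf n}) :
  countable S ->
  exists C : set {n & formula L inf n}, [/\ countable C, S `<=` C,
    (forall n (s t : term L n), C (existT _ n (Eq s t))) /\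
    (forall n r (ts : _ -> term L n), C (existT _ n (Rel r ts))),
    forall o x, C x -> C (unop_apply o x)
  & forall n a b, C (existT _ n a) -> C (existT _ n b) -> C (existT _ n (Or a b))].
Proof.
move=> cS.
have [||C [cC SC uC bC]] := @countable_closure _ _ (S `|` (
     [set x : {n & formula L inf n} | exists n s t, x = existT _ n (Eq s t)] `|`
     [set x | exists n r ts, x = existT _ n (Rel r ts)]))
     (@unop_apply inf) (@or_apply inf).
- exact: countable_unop.
- rewrite -bigcup2E; apply: bigcup_countable; first exact: countableP.
  by case=> [|[|?]] _ //=; exact: countable_atoms.
exists C; split=> //.
- by move=> x Sx; apply: SC; left.
- split=> [n s t|n r ts]; apply: SC; right.
    by left; exists n, s, t.
  by right; exists n, r, ts.
- by move=> n a b Ca Cb; rewrite -or_applyE; exact: bC.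
Qed.

(** The inverse operations in [unop] give the directions of [countable_fragment] that pass to
    subformulas. *)
Lemma fragment_exists (S : set {n & inf_form L n}) :
  countable S -> exists A : forall n, set (inf_form L n),
    countable_fragment A /\ forall x, S x -> A (projT1 x) (projT2 x).
Proof.
move=> /countable_closed_formulas[C [cC SC [Ceq Crel] uC bC]].
exists (fun n psi => C (existT _ n psi)); split; last by case=> n psi /SC.
split=> //.
- by apply: sub_countable cC; apply: subset_card_le => -[].
- by move=> n psi; split=> [/(uC uUnneg)|/(uC uNeg)].
- move=> n a b; split=> [Cab|[]]; last exact: bC.
  by split; [exact: (uC uLeft _ Cab)|exact: (uC uRight _ Cab)].
- by move=> n p ths k /(uC (uNth k)).
- by move=> n psi; split=> [/(uC uUnex)|/(uC uEx)].
- by move=> n m psi s /(uC (uSubst (existT _ (n, m) s))); rewrite subst_applyE.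
Qed.

(** The countable closure of the empty set already contains every first-order formula, since [BigOr]
    cannot occur when [inf] is false. *)
Lemma countable_fo_form n : countable [set: fo_form L n].
Proof.
have [C [cC _ [Ceq Crel] uC bC]] := countable_closed_formulas (@countable0 {n & fo_form L n}).
have CT m (th : fo_form L m) : C (existT _ m th).
  elim: th => {m} [//|//|m th IH|m a IHa b IHb|m p ths IH|m th IH].
  - exact: (uC uNeg _ IH).
  - exact: bC.
  - by case: (notF p).
  - exact: (uC uEx _ IH).
have /countable_injP[g gI] := cC.
apply/countable_injP; exists (fun th => g (existT _ n th)) => x y _ _ gxy.
have /gI : g (existT _ n x) = g (existT _ n y) by [].
by rewrite !inE => /(_ (CT _ _) (CT _ _)) e; exact: (@eq_from_Tagged nat (fo_form L)).
Qed.

End Logic.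

(** * Henkin theories *)

Section Henkin.
Variable L : signature.

Notation rename th rho := (subst th (fun i => Var (rho i))).

(** A complete theory with the natural numbers as constants, closed under named witnesses.
    Substitution is given for variables only, as in the axioms of randomizations; terms are
    recovered below. *)
Record henkin_theory (val : forall n, fo_form L n -> ('I_n -> nat) -> Prop) : Prop :=
  HenkinTheory {
  henkin_valid : forall n (th : fo_form L n) d, valid th -> val n th d;
  henkin_rename : forall n m (th : fo_form L n) (rho : 'I_n -> 'I_m) d,
    val m (rename th rho) d <-> val n th (d \o rho);
  henkin_neg : forall n (th : fo_form L n) d, val n (Neg th) d <-> ~ val n th d;
  henkin_or : forall n (th1 th2 : fo_form L n) d,
    val n (Or th1 th2) d <-> val n th1 d \/ val n th2 d;
  henkin_ex : forall n (th : fo_form L n.+1) d,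
    val n (Ex th) d <-> exists k, val n.+1 th (scons k d) }.

Variable val : forall n, fo_form L n -> ('I_n -> nat) -> Prop.
Arguments val {n}.
Hypothesis hval : henkin_theory (@val).

Lemma henkin_Imps n k (F : 'I_k -> fo_form L n) (b : fo_form L n) d :
  val (Imps F b) d -> (forall i, val (F i) d) -> val b d.
Proof.
elim: k F => //= k IH F /(henkin_or hval)[/(henkin_neg hval)//|Fb Fv].
by apply: IH Fb _ => i; exact: Fv.
Qed.

Lemma henkin_consequence n k (F : 'I_k -> fo_form L n) (b : fo_form L n) d :
  (forall (M : structure L) (v : 'I_n -> M), (forall i, sat (F i) v) -> sat b v) ->
  (forall i, val (F i) d) -> val b d.
Proof.
move=> Fb; apply: henkin_Imps; apply: henkin_valid => // M v.
by apply/sat_Imps; exact: Fb.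
Qed.

Definition tlift n (t : term L n) : term L n.+1 :=
  tsubst (fun j => Var (lift ord0 j)) t.

Lemma eval_tlift (M : structure L) n (t : term L n) x (v : 'I_n -> M) :
  Defs.eval (scons x v) (tlift t) = Defs.eval v t.
Proof.
by rewrite term_eval_subst; congr Defs.eval; apply: funext => i /=; rewrite sconsS.
Qed.

(** The constant [k] denotes the value of [t] at [d]. Constants can be put in for variables only,
    hence the additional variable equated with the lifted term. *)
Definition names n (k : nat) (t : term L n) (d : 'I_n -> nat) : Prop :=
  val (Eq (Var ord0) (tlift t)) (scons k d).

Lemma names_rename n m (t : term L n) (rho : 'I_n -> 'I_m) k d :
  names k (tsubst (fun i => Var (rho i)) t) d <-> names k t (d \o rho).
Proof.
pose rho' : 'I_n.+1 -> 'I_m.+1 := scons ord0 (fun i => lift ord0 (rho i)).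
have -> : names k t (d \o rho) = val (Eq (Var ord0) (tlift t)) (scons k d \o rho').
  congr val; rewrite comp_scons scons0; congr scons.
  by apply: funext => i /=; rewrite sconsS.
rewrite -(henkin_rename hval) /= /rho' scons0 /names.
suff -> : tlift (tsubst (fun i => Var (rho i)) t) =
  tsubst (fun i => Var (scons ord0 (fun j => lift ord0 (rho j)) i)) (tlift t) by [].
by elim: t => [i|f ts IH] /=; rewrite ?sconsS //; congr App; apply: funext.
Qed.

(** Put [d] and [e] side by side as one tuple [de]. The hypotheses become the equations [E i], under
    which [subst th s] and [th], both renamed into the long tuple, are logical consequences of each
    other. *)
Lemma henkin_subst n m (th : fo_form L n) (s : 'I_n -> term L m) d (e : 'I_n -> nat) :
  (forall i, names (e i) (s i) d) -> (val (subst th s) d <-> val th e).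
Proof.
move=> es.
pose de : 'I_(m + n) -> nat := fun i => match fintype.split i with inl j => d j | inr j => e j end.
have del : de \o @lshift m n = d.
  by apply: funext => i; rewrite /de /= (unsplitK (inl i : 'I_m + 'I_n)).
have der : de \o @rshift m n = e.
  by apply: funext => i; rewrite /de /= (unsplitK (inr i : 'I_m + 'I_n)).
pose E i : fo_form L (m + n) :=
  Eq (Var (rshift m i)) (tsubst (fun j => Var (lshift n j)) (s i)).
have Ede i : val (E i) de.
  have := es i; rewrite -del -names_rename /names.
  pose rho : 'I_(m + n).+1 -> 'I_(m + n) := scons (rshift m i) id.
  have -> : scons (e i) de = de \o rho.
    rewrite /rho comp_scons; congr scons.
    by rewrite -der.
  rewrite -(henkin_rename hval) /= /rho scons0 /E.
  set t := tsubst _ (s i); suff -> : tsubst (fun j => Var (scons (rshift m i) id j)) (tlift t) = t by [].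
  by elim: t => [j|f ts IH] /=; rewrite ?sconsS //; congr App; apply: funext.
rewrite -[e in val th e]der -[d in val _ d]del -!(henkin_rename hval); split=> h.
  apply: (@henkin_consequence _ n.+1
    (scons (rename (subst th s) (@lshift m n)) E)); last first.
    by move=> i; case: (unliftP ord0 i) => [j ->|->]; rewrite ?sconsS ?scons0.
  move=> M v hv; apply/sat_subst => /=.
  have := hv ord0; rewrite scons0 => /sat_subst/sat_subst /=.
  suff -> : (fun i => Defs.eval (fun j => v (lshift n j)) (s i)) = (fun i => v (rshift m i)) by [].
  by apply: funext => i; have := hv (lift ord0 i); rewrite sconsS /= term_eval_subst.
apply: (@henkin_consequence _ n.+1
  (scons (rename th (@rshift m n)) E)); last first.
  by move=> i; case: (unliftP ord0 i) => [j ->|->]; rewrite ?sconsS ?scons0.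
move=> M v hv; apply/sat_subst/sat_subst => /=.
have := hv ord0; rewrite scons0 => /sat_subst /=.
suff -> : (fun i => Defs.eval (fun j => v (lshift n j)) (s i)) = (fun i => v (rshift m i)) by [].
by apply: funext => i; have := hv (lift ord0 i); rewrite sconsS /= term_eval_subst.
Qed.

Lemma names_exists n (t : term L n) d : exists k, names k t d.
Proof.
apply/(henkin_ex hval); apply: henkin_valid => // M v /=.
by exists (Defs.eval v t); rewrite scons0 eval_tlift.
Qed.

Lemma names_var n (i : 'I_n) d : names (d i) (Var i) d.
Proof.
pose rho : 'I_n.+1 -> 'I_n := scons i id.
rewrite /names (_ : scons (d i) d = d \o rho); last by rewrite /rho comp_scons.
rewrite -(henkin_rename hval); apply: henkin_valid => // M v /=.
by rewrite /rho sconsS scons0.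
Qed.

Definition same (i j : nat) : Prop := val (eq_form L) (pair_val i j).

Lemma val_Eq n (s t : term L n) d i j :
  names i s d -> names j t d -> (val (Eq s t) d <-> same i j).
Proof.
move=> si tj.
have -> : Eq s t = subst (eq_form L) (pair_val s t) by rewrite /= pair_val0 pair_val1.
apply: henkin_subst => k.
case: (unliftP ord0 k) => [k' ->|->]; rewrite /pair_val ?sconsS ?scons0 //.
by rewrite (ord1 k') !scons0.
Qed.

Lemma names_same n (t : term L n) d i j : names i t d -> same i j -> names j t d.
Proof.
move=> ti ij.
have : val (Eq t t) d by apply: henkin_valid.
have hv : val (Eq (Var ord0) (Var ord0) : fo_form L n.+1) (scons j d).
  exact: henkin_valid.
have nj : names j (Var ord0) (scons j d).
  by have := names_var ord0 (scons j d); rewrite scons0.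
have tj : names i (tlift t) (scons j d).
  apply/names_rename; suff -> : scons j d \o lift ord0 = d by [].
  by apply: funext => k /=; rewrite sconsS.
move=> _; apply/(val_Eq nj tj).
have := @val_Eq 2 (Var ord_max) (Var ord0) (pair_val i j) j i.
rewrite /same.
have := names_var ord_max (pair_val i j); rewrite pair_val1.
have := names_var ord0 (pair_val i j); rewrite pair_val0.
move=> h1 h2 /(_ h2 h1) <-.
apply: (@henkin_consequence _ 1 (fun=> eq_form L)) => // M v /(_ ord0) /=.
by move=> ->.
Qed.

Lemma same_refl i : same i i.
Proof.
have := @val_Eq 1 (Var ord0) (Var ord0) (fun=> i) i i.
by move=> /(_ (names_var _ _) (names_var _ _)) <-; apply: henkin_valid.
Qed.

Lemma same_sym i j : same i j -> same j i.
Proof.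
have := @names_same 1 (Var ord0) (fun=> i) i j (names_var _ _).
move=> h /h nj; have := @val_Eq 1 (Var ord0) (Var ord0) (fun=> i) j i nj (names_var _ _).
by move=> <-; apply: henkin_valid.
Qed.

Lemma same_trans i j k : same i j -> same j k -> same i k.
Proof.
move=> /same_sym ij jk.
have h := @names_same 1 (Var ord0) (fun=> j).
have := @val_Eq 1 (Var ord0) (Var ord0) (fun=> j) i k.
move=> <-; first exact: henkin_valid.
  exact: h (names_var _ _) ij.
exact: h (names_var _ _) jk.
Qed.

Lemma henkin_model : exists (M : structure L) (nm : nat -> M),
  (forall x, exists i, nm i = x) /\
  forall n (th : fo_form L n) d, sat th (nm \o d) <-> val th d.
Proof.
(* Elements are classes of names, taken as sets, so that provable equality of names becomes equality
   in the carrier. *)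
pose T := {X : set nat | exists i, X = same i}.
pose nm i : T := exist _ (same i) (ex_intro _ i erefl).
have nmS x : exists i, nm i = x.
  case: x => X hX; have [i Xi] := hX; exists i; subst X.
  by congr exist; exact: Prop_irrelevance.
have [rep nmK] := choice nmS.
have nmE i j : nm i = nm j <-> same i j.
  split=> [/(congr1 sval) /= ij|ij]; first by rewrite ij; exact: same_refl.
  suff ii : same i = same j.
    by rewrite /nm; move: (ex_intro _ i _) (ex_intro _ j _); rewrite ii => p q;
       congr exist; exact: Prop_irrelevance.
  by apply/seteqP; split=> k; [apply: same_trans; exact: same_sym|exact: same_trans].
have repK i : same (rep (nm i)) i by apply/nmE; rewrite nmK.
have fn f (d : 'I_(fun_ar f) -> nat) : exists k, names k (App f Var) d.
  exact: names_exists.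
have {fn} [fn fnP] : exists g : forall f, ('I_(fun_ar f) -> nat) -> nat,
    forall f d, names (g f d) (App f Var) d.
  by exists (fun f d => sval (cid (fn f d))) => f d; case: cid.
pose M : structure L := @Structure L T (inhabits (nm 0%N))
  (fun r v => val (Rel r Var) (rep \o v)) (fun f v => nm (fn f (rep \o v))).
exists M, nm; split=> // n th.
(* Only the direction from values to names needs induction on [t]; the converse compares [k] with a
   representative of the value. *)
have namesE m (t : term L m) d k : names k t d <-> nm k = Defs.eval (M := M) (nm \o d) t.
  suff h : forall k, nm k = Defs.eval (M := M) (nm \o d) t -> names k t d.
    split=> [tk|]; last exact: h.
    have := h _ (nmK (Defs.eval (M := M) (nm \o d) t)).
    move=> tr; rewrite -[RHS]nmK; apply/nmE/(val_Eq tk tr).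
    exact: henkin_valid.
  elim: t {k} => [i|f ts IH] k /=.
    move=> /nmE/same_sym; apply: names_same; exact: names_var.
  set e := rep \o _ => /nmE/same_sym; apply: names_same.
  rewrite /names /tlift /=.
  have -> : Eq (Var ord0) (App f (fun i => tsubst (fun j : 'I_m => Var (lift ord0 j)) (ts i)))
    = subst (Eq (inf := false) (Var ord0) (tlift (App f Var)))
            (scons (Var ord0) (fun i => tlift (ts i))).
    rewrite /= scons0; congr (Eq _ (App _ _)); apply: funext => i.
    by rewrite sconsS.
  apply/(@henkin_subst _ _ _ _ _ (scons (fn f e) e)); last exact: fnP.
  move=> i; case: (unliftP ord0 i) => [j ->|->]; rewrite ?sconsS ?scons0; last first.
    by have := names_var ord0 (scons (fn f e) d); rewrite scons0.
  apply/names_rename; rewrite (_ : scons _ d \o lift ord0 = d); last first.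
    by apply: funext => l /=; rewrite sconsS.
  by apply: IH; rewrite /e /= nmK.
elim: th => {n} [n t1 t2|n r ts|n th IH|n th1 IH1 th2 IH2|n p ths IH|n th IH] d.
- have [i t1i] := names_exists t1 d; have [j t2j] := names_exists t2 d.
  by rewrite (val_Eq t1i t2j) /= -nmE; move/namesE: t1i => ->; move/namesE: t2j => ->.
- rewrite /= -(@henkin_subst _ _ (Rel r Var) ts d) // => i.
  by apply/namesE => /=; rewrite nmK.
- by rewrite (henkin_neg hval) -IH.
- by rewrite (henkin_or hval) -IH1 -IH2.
- by case: (notF p).
- rewrite (henkin_ex hval) sat_Ex; split=> [[x]|[k]].
    by rewrite -(nmK x) -comp_scons => /IH; exists (rep x).
  by move=> /IH; rewrite comp_scons; exists (nm k).
Qed.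

End Henkin.

(** * Codes of countable structures *)

Section Least.

Definition least (P : nat -> Prop) : nat :=
  if pselect (exists n, `[<P n>]) is left h then ex_minn h else 0%N.

Lemma leastP (P : nat -> Prop) : (exists n, P n) -> P (least P).
Proof.
move=> [n Pn]; rewrite /least; case: pselect => [h|[]]; last by exists n; exact/asboolP.
by case: ex_minnP => m /asboolP.
Qed.

Lemma least_min (P : nat -> Prop) n : P n -> (least P <= n)%N.
Proof.
move=> Pn; rewrite /least; case: pselect => [h|[]]; last by exists n; exact/asboolP.
by case: ex_minnP => m _; apply; exact/asboolP.
Qed.

End Least.

Section Cantor.

Lemma cantor_nbhs (x : cantor_space) n :
  nbhs x [set y : cantor_space | forall i, (i < n)%N -> y i = x i].
Proof.
elim: n => [|n IH]; first by apply: filterS filterT.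
have xn : nbhs x [set y : cantor_space | y n = x n].
  have := @proj_continuous nat (fun=> bool) n x [set x n] (discrete_set1 _).
  by [].
apply: filterS (filterI IH xn) => y [yi yn] i.
by rewrite ltnS leq_eqVlt => /predU1P[->|/yi].
Qed.

(** Compactness makes the image closed, and injectivity carries the limit points of the Cantor space
    over to it. *)
Lemma perfect_image (T : topologicalType) (F : cantor_space -> T) :
  hausdorff_space T -> continuous F -> injective F -> perfect_set (range F).
Proof.
move=> hT cF iF; have clF : closed (range F).
  apply: compact_closed => //; apply: continuous_compact.
    exact: continuous_subspaceT.
  exact: cantor_space_compact.
split=> //; apply/seteqP; split.
  move=> t lt; apply: clF => U /lt[y [_ Ry Uy]].
  by exists y.
move=> _ [x _ <-] U /cF xU.
have [_ perf] := cantor_perfect.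
have : limit_point [set: cantor_space] x by rewrite perf.
move=> /(_ _ xU)[y [yx _ Uy]]; exists (F y); split=> //.
by apply: contra_neq yx => /iF.
Qed.

End Cantor.

Section Codes.
Variable L : signature.

(** One index type for the three factors of a code; with [coord] every entry is a natural number, so
    a Cantor scheme can decide all entries in a single enumeration. *)
Definition coordinate : Type :=
  (nat + ({r : rel_sym L & 'I_(rel_ar r) -> nat} + {f : fun_sym L & 'I_(fun_ar f) -> nat}))%type.

Definition coord (c : code_space L) (k : coordinate) : nat :=
  match k with
  | inl a => c.1.1 a
  | inr (inl rv) => c.1.2 rv
  | inr (inr fv) => c.2 fv
  end.

Lemma coord_inj (c d : code_space L) : coord c = coord d -> c = d.
Proof.
case: c d => [[u r] f] [[u' r'] f'] cd.
congr (_, _, _).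
- by apply: funext => a; have /= := congr1 (fun g => g (inl a)) cd; do 2!case: (_ a).
- by apply: funext => a; have /= := congr1 (fun g => g (inr (inl a))) cd; do 2!case: (_ a).
- by apply: funext => a; have /= := congr1 (fun g => g (inr (inr a))) cd.
Qed.

Lemma countable_coordinate : countable_signature L -> countable [set: coordinate].
Proof.
move=> hL.
have [g gI] : exists g : {r : rel_sym L & 'I_(rel_ar r) -> nat} -> nat, injective g.
  apply/countable_inj/countable_sigT => [|r]; first exact: hL.1.
  exact/countable_ord_fun/countableP.
have [h hI] : exists g : {f : fun_sym L & 'I_(fun_ar f) -> nat} -> nat, injective g.
  apply/countable_inj/countable_sigT => [|r]; first exact: hL.2.
  exact/countable_ord_fun/countableP.
pose e (k : coordinate) : nat + (nat + nat) := match k with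
  | inl a => inl a | inr (inl rv) => inr (inl (g rv)) | inr (inr fv) => inr (inr (h fv)) end.
apply: (@injective_countable _ _ e); last exact: countableP.
by move=> [a|[a|a]] [b|[b|b]] //= [] => [->|/gI->|/hI->].
Qed.

Lemma prod_topology_cvg (I : Type) (T : discreteTopologicalType) (X : Type)
    (G : set_system X) (FG : Filter G) (F : X -> prod_topology (fun _ : I => T))
    (p : prod_topology (fun _ : I => T)) :
  (forall i, G [set y | F y i = p i]) -> F @ G --> p.
Proof.
move=> Gi; apply/cvg_sup => i; apply/(@cvg_image _ _ (fun f => f i)).
  apply/seteqP; split=> // t _; exists (fun _ => t) => //.
move=> Q /(@nbhs_singleton _ _) Qp; exists [set f | Q (f i)] => //.
  change (G [set y | Q (F y i)]); apply: (filterS _ (Gi i)) => y yp.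
  by rewrite /= (yp : F y i = p i).
apply/seteqP; split=> [_ [f Qf <-]//|t Qt]; by exists (fun _ => t).
Qed.

Lemma coord_locally_constant (c : code_space L) k :
  nbhs c [set d | coord d k = coord c k].
Proof.
case: k => [a|[a|a]] /=.
- have h : nbhs c.1.1 [set f : prod_topology (fun _ : nat => bool) | f a = c.1.1 a].
    exact: (@proj_continuous nat (fun=> bool) a c.1.1 [set c.1.1 a] (discrete_set1 _)).
  have cont : {for c, continuous (fun d : code_space L => d.1.1)}.
    by apply: (@continuous_comp _ _ _ fst fst); exact: cvg_fst.
  have H : nbhs c [set d : code_space L | d.1.1 a = c.1.1 a] := cont _ h.
  by apply: (filterS _ H) => d /= ->.
- have h : nbhs c.1.2 [set f : prod_topology (fun _ : {r : rel_sym L & 'I_(rel_ar r) -> nat} => bool) | f a = c.1.2 a].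
    exact: (@proj_continuous {classic _} (fun=> bool) a c.1.2 [set c.1.2 a] (discrete_set1 _)).
  have cont : {for c, continuous (fun d : code_space L => d.1.2)}.
    by apply: (@continuous_comp _ _ _ fst snd); [exact: cvg_fst|exact: cvg_snd].
  have H : nbhs c [set d : code_space L | d.1.2 a = c.1.2 a] := cont _ h.
  by apply: (filterS _ H) => d /= ->.
- have h : nbhs c.2 [set f : prod_topology (fun _ : {f : fun_sym L & 'I_(fun_ar f) -> nat} => nat) | f a = c.2 a].
    exact: (@proj_continuous {classic _} (fun=> nat) a c.2 [set c.2 a] (discrete_set1 _)).
  exact: (@cvg_snd _ _ _ _ _ _ h).
Qed.

Lemma code_space_hausdorff : hausdorff_space (code_space L).
Proof.
move=> p q pq; apply: coord_inj; apply: funext => k.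
by have [r [/= <- <-]] := pq _ _ (coord_locally_constant p k) (coord_locally_constant q k).
Qed.

Lemma continuous_code (F : cantor_space -> code_space L) :
  (forall k x, exists n, forall y : cantor_space, (forall i, (i < n)%N -> y i = x i) ->
     coord (F y) k = coord (F x) k) ->
  continuous F.
Proof.
move=> loc x.
have near k : nbhs x [set y | coord (F y) k = coord (F x) k].
  by have [n h] := loc k x; apply: filterS (cantor_nbhs x n).
have h1 : (fun y => (F y).1.1) @ x --> (F x).1.1.
  apply: prod_topology_cvg => a; apply: (filterS _ (near (inl a))) => y /=.
  by do 2!case: (_ a).
have h2 : (fun y => (F y).1.2) @ x --> (F x).1.2.
  apply: prod_topology_cvg => a; apply: (filterS _ (near (inr (inl a)))) => y /=.
  by do 2!case: (_ a).
have h3 : (fun y => (F y).2) @ x --> (F x).2.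
  by apply: prod_topology_cvg => a; apply: (filterS _ (near (inr (inr a)))) => y.
have -> : F = fun y => ((F y).1.1, (F y).1.2, (F y).2).
  by apply: funext => y; case: (F y) => [[]].
exact: (cvg_pair (cvg_pair h1 h2) h3).
Qed.

Section CodeOf.
Variables (M : structure L) (nm : nat -> M).
Hypothesis nmS : forall x, exists i, nm i = x.

Definition name_of (x : M) : nat := least (fun i => nm i = x).

Lemma name_ofK x : nm (name_of x) = x.
Proof. exact: (@leastP (fun i => nm i = x)). Qed.

(** An element is represented by its least name; distinct numbers of the universe are thus distinct
    elements although [nm] may repeat. *)
Definition code_of : code_space L :=
  ((fun a => `[< name_of (nm a) = a >]) : prod_topology _,
   (fun rv => `[< rel_int (r := projT1 rv) (nm \o projT2 rv) >]) : prod_topology _,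
   (fun fv => name_of (fun_int (f := projT1 fv) (nm \o projT2 fv))) : prod_topology _).

Lemma code_of_univ a : code_univ code_of a <-> name_of (nm a) = a.
Proof. by split=> [/asboolP|h]; last exact/asboolP. Qed.

Lemma code_of_is_code : is_code code_of.
Proof.
have univ x : code_univ code_of (name_of x) by apply/code_of_univ; rewrite name_ofK.
by split=> [|f v _]; [constructor; exists (name_of (nm 0%N)); exact: univ|exact: univ].
Qed.

Lemma code_ofP (hc : is_code code_of) inf (psi : formula L inf 0) :
  models (code_structure hc) psi <-> models M psi.
Proof.
pose h (x : code_structure hc) : M := nm (sval x).
rewrite /models -(no_varsE (h \o @no_vars _)); apply: sat_bijection.
- move=> n t v; elim: t => [//|f ts IH] /=.
  rewrite /h /= name_ofK; congr fun_int; apply: funext => i.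
  exact: IH.
- by move=> r v; split=> [/asboolP|h']; last exact/asboolP.
- move=> [x ux] [y uy]; rewrite /h /= => xy.
  have {}xy : x = y by move/code_of_univ: (ux) => <-; move/code_of_univ: (uy) => <-; rewrite xy.
  by subst y; congr exist; exact: Prop_irrelevance.
- move=> y; have u : code_univ code_of (name_of y) by apply/code_of_univ; rewrite name_ofK.
  by exists (exist _ _ u); rewrite /h /= name_ofK.
Qed.

End CodeOf.
End Codes.

(** * Cantor schemes *)

Section Fusion.
Variables (Q : Type) (le : Q -> Q -> Prop).
Hypothesis le_refl : forall q, le q q.
Hypothesis le_trans : forall p q r, le p q -> le q r -> le p r.
Variables (D : nat -> Q -> Prop) (R : nat -> Q -> Q -> Prop).
Hypothesis D_le : forall n q r, le r q -> D n q -> D n r.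
Hypothesis R_le : forall n q q' r r', le r q -> le r' q' -> R n q q' -> R n r r'.
Hypothesis D_dense : forall n q, exists2 r, le r q & D n r.
Hypothesis R_dense : forall n q q', exists r r', [/\ le r q, le r' q' & R n r r'].

(** The finitely many demands are met one after the other, and [R_le] preserves those already met
    under later shrinking. *)
Lemma fusion_refine (l : seq (seq bool * seq bool * nat)) (w : seq bool -> Q) :
  exists w', (forall s, le (w' s) (w s)) /\
    forall p, p \in l -> p.1.1 != p.1.2 -> R p.2 (w' p.1.1) (w' p.1.2).
Proof.
elim: l => [|[[s s'] j] l [w' [w'w Rw']]]; first by exists w.
have [ss'|ss'] := eqVneq s s'.
  exists w'; split=> // p; rewrite inE => /predU1P[-> /=|/Rw'//].
  by rewrite ss' eqxx.
have [r [r' [rs rs' Rrr']]] := R_dense j (w' s) (w' s').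
pose w2 u := if u == s then r else if u == s' then r' else w' u.
have w2w' u : le (w2 u) (w' u) by rewrite /w2; do 2?[case: eqP => [->//|_]].
exists w2; split=> [u|p]; first exact: le_trans (w'w u).
rewrite inE => /predU1P[-> /= _|pl p12]; last exact: R_le (Rw' p pl p12).
by rewrite /w2 eqxx eq_sym (negPf ss') eqxx.
Qed.

Lemma fusion_step n (w : seq bool -> Q) : exists w' : seq bool -> Q,
  [/\ forall s b, size s = n -> le (w' (rcons s b)) (w s),
      forall s, size s = n.+1 -> D n (w' s)
    & forall s s' j, size s = n.+1 -> size s' = n.+1 -> s != s' -> (j <= n)%N ->
        R j (w' s) (w' s')].
Proof.
(* For [s] of length [n.+1], [take n s] is its parent. *)
have /choice[w1 w1P] : forall s, exists r, le r (w (take n s)) /\ D n r.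
  by move=> s; have [r rw Dr] := D_dense n (w (take n s)); exists r.
pose T := (n.+1.-tuple bool * n.+1.-tuple bool * 'I_n.+1)%type.
pose l := [seq (val p.1.1 : seq bool, val p.1.2 : seq bool, val p.2) | p <- enum {: T}].
have [w2 [w2w1 Rw2]] := fusion_refine l w1.
exists w2; split=> [s b sn|s sn|s s' j sn s'n ss' jn].
- apply: le_trans (w2w1 _) _; have := (w1P (rcons s b)).1.
  by rewrite -cats1 take_size_cat.
- exact: D_le (w2w1 _) (w1P _).2.
- apply: (Rw2 (s, s', j)) => //; apply/mapP.
  have sP : size s == n.+1 by apply/eqP.
  have s'P : size s' == n.+1 by apply/eqP.
  by exists (Tuple sP, Tuple s'P, Ordinal (jn : (j < n.+1)%N)); rewrite ?mem_enum.
Qed.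

Lemma fusion (q0 : Q) : exists W : seq bool -> Q,
  [/\ le (W [::]) q0,
      forall s b, le (W (rcons s b)) (W s),
      forall s, s != [::] -> D (size s).-1 (W s)
    & forall s s' j, size s = size s' -> s != s' -> (j < size s)%N ->
        R j (W s) (W s')].
Proof.
have /choice[st stP] : forall nw : nat * (seq bool -> Q), exists w' : seq bool -> Q,
    [/\ forall s b, size s = nw.1 -> le (w' (rcons s b)) (nw.2 s),
      forall s, size s = nw.1.+1 -> D nw.1 (w' s)
    & forall s s' j, size s = nw.1.+1 -> size s' = nw.1.+1 -> s != s' -> (j <= nw.1)%N ->
        R j (w' s) (w' s')].
  by case=> n w; exact: fusion_step.
(* Each [w n] is defined on all sequences, but only its values at sequences of length [n] enter the
   scheme. *)
pose fix w n : seq bool -> Q := if n is n'.+1 then st (n', w n') else fun=> q0.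
have wP n := stP (n, w n).
exists (fun s => w (size s) s); split=> //.
- by move=> s b; rewrite size_rcons /=; have [h _ _] := wP (size s); exact: h.
- move=> s; case E : (size s) => [|n]; first by move/size0nil: E => ->.
  by move=> _; have [_ h _] := wP n; exact: h.
- move=> s s' j ss'; rewrite -ss'; case E : (size s) => [//|n] ne jn.
  by have [_ _ h] := wP n; apply: h => //; rewrite -ss'.
Qed.

End Fusion.

(** * Probability *)

Section Probability.
Context d (T : measurableType d) (R : realType) (P : probability T R).

(** If infinitely many of the sets had measure above 1/(n+1), then n+1 of them, being disjoint,
    would have total measure above 1. *)
Lemma disjoint_positive_countable (I : Type) (F : I -> set T) :
  (forall i, measurable (F i)) -> trivIset setT F -> (forall i, (0 < P (F i))%E) ->
  countable [set: I].
Proof.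
move=> mF tF F0.
have -> : [set: I] = \bigcup_n [set i | n.+1%:R^-1 < fine (P (F i))].
  apply/seteqP; split=> // i _.
  have : 0 < fine (P (F i)).
    by rewrite fine_gt0// F0 ltey_eq fin_num_measure.
  by move=> /ltr_add_invr[k /[!add0r] ki]; exists k.
apply: bigcup_countable; first exact: countableP.
move=> n _; apply: finite_set_countable.
apply: contrapT => /infiniteP/card_leP[f].
pose e k : set_type [set: nat] := SigSub (mem_set (Logic.I : [set: nat] k)).
pose q k := val (f (e k)).
have q_fun k : n.+1%:R^-1 < fine (P (F (q k))) by exact: (set_mem (valP (f (e k)))).
have q_inj : injective q.
  by move=> j k /val_inj/(@inj _ _ _ f); rewrite !inE => /(_ Logic.I Logic.I)/(congr1 val).
have /(probability_le1 P) : measurable (\bigcup_k F (q k)).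
  by apply: bigcup_measurable => k _.
rewrite leNgt => /negP; apply.
rewrite [ltRHS](_ : _ = \sum_(0 <= k <oo) P (F (q k)))%E; last first.
  rewrite measure_bigcup//; first by apply: eq_eseriesl =>// i; rewrite in_setT.
  move=> i j _ _ /(tF _ _ Logic.I Logic.I) qij.
  exact: q_inj.
apply: (lt_le_trans _ (nneseries_lim_ge n.+1 _)) => //.
rewrite -EFin_sum_fine//; last by move=> ? _; rewrite fin_num_measure.
rewrite lte_fin (_ : 1%R = (\sum_(0 <= k < n.+1) n.+1%:R^-1:R)%R); last first.
  by rewrite sumr_const_nat subn0 -[RHS]mulr_natr mulVf.
by apply: ltr_sum => // k _; exact: q_fun.
Qed.

Lemma ae_countable (I : Type) (Q : I -> T -> Prop) : countable [set: I] ->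
  (forall i, \forall t \ae P, Q i t) -> \forall t \ae P, forall i, Q i t.
Proof.
move=> cI aeQ; have [[i0]|nI] := pselect (inhabited I); last first.
  by apply: nearW => t i; exfalso; apply: nI.
have [g gS] := countable_enum cI (inhabits i0).
have : \forall t \ae P, forall n, Q (g n) t by apply: ae_foralln => n; exact: aeQ.
by apply: filterS => t gQ i; have [n <-] := gS i.
Qed.

Lemma ae_measurable (Q : T -> Prop) : (\forall t \ae P, Q t) ->
  exists O : set T, [/\ measurable O, P (~` O) = 0%E & O `<=` Q].
Proof.
move=> [A [mA A0 QA]]; exists (~` A); split; first exact: measurableC.
  by rewrite setCK.
by move=> t; apply: contra_notP => nQ; exact: QA.
Qed.

Lemma ae_null (A : set T) : measurable A -> P A = 0%E -> \forall t \ae P, ~ A t.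
Proof.
by move=> mA A0; exists A; split=> // t /contrapT.
Qed.

Lemma null_ae (A : set T) : measurable A -> (\forall t \ae P, ~ A t) -> P A = 0%E.
Proof.
move=> mA [B [mB B0 AB]]; apply/(negligibleP _ mA); exists B; split=> // t At.
by apply: AB; exact.
Qed.

Lemma positive_ae (A : set T) (Q : T -> Prop) : measurable A -> (0 < P A)%E ->
  (\forall t \ae P, Q t) -> exists2 t, A t & Q t.
Proof.
move=> mA A0 aeQ; apply: contrapT => nAQ; move: A0.
rewrite null_ae ?ltxx//; apply: filterS aeQ => t Qt At.
by apply: nAQ; exists t.
Qed.

Lemma null_sub (A B : set T) :
  measurable A -> measurable B -> A `<=` B -> P B = 0%E -> P A = 0%E.
Proof. by move=> mA mB AB B0; exact: (subset_measure0 mA mB AB B0). Qed.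

Lemma positive_sub (A B : set T) :
  measurable A -> measurable B -> A `<=` B -> (0 < P A)%E -> (0 < P B)%E.
Proof. by move=> mA mB AB A0; apply: lt_le_trans A0 _; by apply: le_measure; rewrite ?inE. Qed.

Lemma null_bigcup (F : nat -> set T) : (forall n, measurable (F n)) ->
  (forall n, P (F n) = 0%E) -> P (\bigcup_n F n) = 0%E.
Proof.
move=> mF F0; apply: null_ae; first exact: bigcupT_measurable.
have : \forall t \ae P, forall n, ~ F n t by apply: ae_foralln => n; exact: ae_null.
by apply: filterS => t nF [n _ Fn]; exact: (nF n).
Qed.

Lemma nullVpositive (A : set T) : P A = 0%E \/ (0 < P A)%E.
Proof. by rewrite measure_gt0; case: eqVneq; [left|right]. Qed.

Lemma positive_cover (A : set T) (F : nat -> set T) : measurable A ->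
  (forall n, measurable (F n)) -> A `<=` \bigcup_n F n -> (0 < P A)%E ->
  exists n, (0 < P (A `&` F n))%E.
Proof.
move=> mA mF AF A0; apply: contrapT => nF; move: A0.
have mAF n : measurable (A `&` F n) by exact: measurableI.
rewrite (@null_sub _ (\bigcup_n (A `&` F n))) ?ltxx//.
- exact: bigcupT_measurable.
- by move=> t At; have [n _ Ft] := AF _ At; exists n.
apply: null_bigcup => // n.
by have [//|An] := nullVpositive (A `&` F n); case: nF; exists n.
Qed.

Lemma positive_diff (A B : set T) : measurable A -> measurable B ->
  P (A `&` B) = 0%E -> (0 < P A)%E -> (0 < P (A `&` ~` B))%E.
Proof.
move=> mA mB AB0 A0; have [AnB0|//] := nullVpositive (A `&` ~` B).
have mAB : measurable (A `&` B) by exact: measurableI.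
have mAnB : measurable (A `&` ~` B) by apply: measurableI => //; exact: measurableC.
have ae1 := ae_null mAB AB0; have ae2 := ae_null mAnB AnB0.
move: A0; rewrite (null_ae mA) ?ltxx//; apply: filterS2 ae1 ae2 => t nAB nAnB At.
by apply: nAnB; split=> // Bt; apply: nAB.
Qed.

(** Measurability for the discrete sigma-algebra when [C] is countable, which lets [C] remain a bare
    type. *)
Definition discrete_measurable_map (C : Type) (g : T -> C) : Prop :=
  forall x, measurable [set t | g t = x].

Lemma discrete_measurable_bind (C1 C2 : Type) (g : T -> C1) (F : C1 -> T -> C2) :
  countable [set: C1] -> discrete_measurable_map g ->
  (forall x, discrete_measurable_map (F x)) ->
  discrete_measurable_map (fun t => F (g t) t).
Proof.
move=> cC mg mF y.
rewrite [X in measurable X](_ : _ =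
  \bigcup_x ([set t | g t = x] `&` [set t | F x t = y])); last first.
  by apply/seteqP; split=> [t <-|t [x _ [/= <-]]//]; exists (g t).
by apply: countable_bigcupT_measurable => // x; apply: measurableI; [exact: mg|exact: mF].
Qed.

Lemma discrete_measurable_pred (C : Type) (g : T -> C) (A : C -> set T) :
  countable [set: C] -> discrete_measurable_map g -> (forall x, measurable (A x)) ->
  measurable [set t | A (g t) t].
Proof.
move=> cC mg mA.
rewrite [X in measurable X](_ : _ =
  \bigcup_x ([set t | g t = x] `&` A x)); last first.
  by apply/seteqP; split=> [t At|t [x _ [/= <-]]//]; exists (g t).
by apply: countable_bigcupT_measurable => // x; apply: measurableI; [exact: mg|exact: mA].
Qed.

Lemma measurable_const (Q : Prop) : measurable [set _ : T | Q].
Proof.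
have [q|nq] := pselect Q.
  by rewrite [X in measurable X](_ : _ = setT)//; apply/seteqP; split.
by rewrite [X in measurable X](_ : _ = set0)//; apply/seteqP; split.
Qed.

Lemma measurable_iff (A B : set T) : measurable A -> measurable B ->
  measurable [set t | A t <-> B t].
Proof.
move=> mA mB; rewrite [X in measurable X](_ : _ = (A `&` B) `|` (~` A `&` ~` B)).
  by apply: measurableU; apply: measurableI => //; exact: measurableC.
apply/seteqP; split=> t /=; last by tauto.
by have := EM (A t); tauto.
Qed.

(** The value j is taken on [Q j] minus all earlier [Q i]; the value 0 is also the default where no
    [Q n] holds, whence the second piece of the union. *)
Lemma discrete_measurable_least (Q : nat -> set T) : (forall n, measurable (Q n)) ->
  discrete_measurable_map (fun t => least (fun n => Q n t)).
Proof.
move=> mQ j.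
rewrite [X in measurable X](_ : _ =
  (Q j `&` \bigcap_(i in [set i | (i < j)%N]) ~` Q i) `|`
  (~` (\bigcup_n Q n) `&` [set _ | j = 0%N])).
  apply: measurableU; apply: measurableI => //.
  - by apply: bigcap_measurableType => i _; exact: measurableC.
  - by apply: measurableC; exact: bigcupT_measurable.
  - exact: measurable_const.
apply/seteqP; split=> [t /= tj|t [[Qj minj]|[nQ ->]] /=].
- have [[n Qn]|nQ] := pselect (exists n, Q n t).
    left; rewrite -tj; split; first by apply: (@leastP (fun n => Q n t)); exists n.
    move=> i /= il Qi; have := @least_min (fun n => Q n t) i Qi.
    by rewrite leqNgt il.
  right; split; first by move=> [n _ Qn]; apply: nQ; exists n.
  rewrite -tj /least; case: pselect => // h.
  by exfalso; case: h => n /asboolP Qn; apply: nQ; exists n.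
- apply/eqP; rewrite eqn_leq (@least_min (fun n => Q n t))//= leqNgt.
  apply/negP => lj; apply: (minj _ lj).
  by apply: (@leastP (fun n => Q n t)); exists j.
- rewrite /least; case: pselect => // h.
  by exfalso; case: h => n /asboolP Qn; apply: nQ; exists n.
Qed.

End Probability.

(** * Lebesgue measure on the unit interval *)

Section Unif01.
Variable R : realType.

Lemma measurable_itv01 : measurable (`[0, 1[%classic : set (measurableTypeR R)).
Proof. exact: measurable_itv. Qed.

(** The uniform law is placed on the whole line, where the Borel sets and their regularity are at
    hand; the complement of [0, 1) is a null set. *)
Definition unif01 : set (measurableTypeR R) -> \bar R :=
  mrestr lebesgue_measure measurable_itv01.

HB.instance Definition _ := Measure.on unif01.

Lemma unif01_setT : unif01 setT = 1%E.
Proof.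
by rewrite /unif01 /mrestr setTI lebesgue_measure_itv /= lte_fin ltr01 sube0.
Qed.

HB.instance Definition _ :=
  Measure_isProbability.Build _ _ _ unif01 unif01_setT.

Lemma unif01_inner (A : set (measurableTypeR R)) : measurable A -> (0 < unif01 A)%E ->
  exists K : set R, [/\ compact K, K `<=` A & (0 < unif01 K)%E].
Proof.
move=> mA A0.
pose B : set R := A `&` `[0, 1[%classic.
have mB : measurable B by apply: measurableI => //; exact: measurable_itv01.
have finB : (lebesgue_measure B < +oo)%E.
  apply: (@le_lt_trans _ _ 1%E); last exact: ltry.
  by rewrite -unif01_setT /unif01 /mrestr le_measure ?inE//;
     [apply: measurableI => //; exact: measurable_itv01|exact: setSI].
have B0 : 0 < fine (lebesgue_measure B).
  by rewrite fine_gt0// finB A0.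
(* The allowed error is the whole measure of [B]; as the loss is strictly smaller, [K] cannot be
   null. *)
have [K [cK KB BK]] := lebesgue_regularity_inner mB finB B0.
exists K; split=> // [t /KB[]//|].
have mK : measurable K by exact: compact_measurable.
rewrite /unif01 /mrestr (setIidl (subset_trans KB (@subIsetr _ _ _))) measure_gt0.
apply/negP => /eqP K0; move: BK.
have BK0 : lebesgue_measure (B `&` K) = 0%E.
  by apply: (@subset_measure0 _ _ _ (@lebesgue_measure R) _ K) => //; exact: measurableI.
have BE : lebesgue_measure B = (lebesgue_measure (B `\` K) + lebesgue_measure (B `&` K))%E.
  exact: (@measureDI _ _ _ (@lebesgue_measure R) B K mB mK).
by rewrite fineK ?ge0_fin_numE// BE BK0 adde0 ltxx.
Qed.

End Unif01.

(** * Types in measurable families of structures *)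

Section Compactness.

Lemma compact_decreasing_nonempty (R : realType) (W : nat -> set R) :
  (forall n, compact (W n)) -> (forall n, W n !=set0) ->
  (forall n, W n.+1 `<=` W n) -> \bigcap_n W n !=set0.
Proof.
move=> cW W0 dW.
have leW m n : (m <= n)%N -> W n `<=` W m.
  elim: n => [|n IH]; first by rewrite leqn0 => /eqP ->.
  by rewrite leq_eqVlt => /predU1P[->//|]; rewrite ltnS => /IH h t /dW/h.
have := cW 0%N; rewrite compact_In0 => /(_ nat setT W); apply.
  exists W => [n _|n _]; last by rewrite setIidr//; exact: leW.
  by apply: compact_closed => //; exact: Rhausdorff.
move=> D' _; have [t Wt] := W0 (\max_(i <- finmap.enum_fset D') i)%N.
exists t => i /= iD; apply: leW Wt.
exact: (@leq_bigmax_seq _ _ xpredT id).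
Qed.

End Compactness.

Section MeasurableFamily.
Variables (R : realType) (L : signature).
Notation T := (measurableTypeR R).
Notation P := (@unif01 R).

(* The elements of the structure N t are named by the natural numbers, with
   repetitions. *)
Record measurable_family (N : T -> structure L) (nm : forall t, nat -> N t) : Prop :=
  MeasurableFamily {
  family_onto : forall t x, exists i, nm t i = x;
  family_fo : forall n (th : fo_form L n) d, measurable [set t : T | sat th (nm t \o d)] }.

Variables (N : T -> structure L) (nm : forall t, nat -> N t).
Hypothesis hN : measurable_family nm.

Definition truth_set n (psi : inf_form L n) (d : 'I_n -> nat) : set T :=
  [set t : T | sat psi (nm t \o d)].

(** As the names exhaust each structure, a quantifier is a countable union over names. *)
Lemma measurable_truth_set n (psi : inf_form L n) d : measurable (truth_set psi d).
Proof.
rewrite /truth_set.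
elim: psi d => {n} [n s t|n r ts|n th IH|n th1 IH1 th2 IH2|n p ths IH|n th IH] d.
- exact: (family_fo hN (Eq s t)).
- exact: (family_fo hN (Rel r ts)).
- exact: measurableC (IH d).
- exact: measurableU (IH1 d) (IH2 d).
- rewrite [X in measurable X](_ : _ = \bigcup_k [set t | sat (ths k) (nm t \o d)]).
    by apply: bigcupT_measurable => k; exact: IH.
  by apply/seteqP; split=> [t [k kt]|t [k _ kt]]; exists k.
- rewrite [X in measurable X](_ : _ = \bigcup_k [set t | sat th (nm t \o scons k d)]).
    by apply: bigcupT_measurable => k; exact: IH.
  apply/seteqP; split=> [t|t [k _]] /=; last by rewrite comp_scons; exists (nm t k).
  move=> [x]; have [k <-] := family_onto hN x.
  by rewrite -comp_scons; exists k.
Qed.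

Definition code_at (t : T) : code_space L := code_of (nm t).

Lemma measurable_name (x : forall t : T, N t) :
  (forall i, measurable [set t : T | nm t i = x t]) ->
  discrete_measurable_map (fun t : T => name_of (nm t) (x t)).
Proof. by move=> mx; exact: discrete_measurable_least. Qed.

Lemma measurable_nat_of_asbool (Q : T -> Prop) : measurable [set t | Q t] ->
  discrete_measurable_map (fun t => nat_of_bool `[< Q t >]).
Proof.
move=> mQ j; rewrite [X in measurable X](_ : _ =
  ([set t | Q t] `&` [set _ | j = 1%N]) `|` (~` [set t | Q t] `&` [set _ | j = 0%N])).
  by apply: measurableU; apply: measurableI; rewrite ?measurableC//;
     first [exact: measurable_const|exact: measurableC].
apply/seteqP; split=> [t /= <-|t [[Qt ->]|[Qt ->]]] /=; last first.
- by rewrite asboolF.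
- by rewrite asboolT.
by case: asboolP => Qt; [left|right].
Qed.

Lemma measurable_coord k : discrete_measurable_map (fun t : T => coord (code_at t) k).
Proof.
case: k => [a|[[r v]|[f v]]].
- apply: measurable_nat_of_asbool; apply: (@measurable_name (fun t => nm t a)) => i.
  have := family_fo hN (eq_form L) (pair_val i a).
  congr measurable; apply/seteqP; split=> t /=;
  by rewrite pair_val0 pair_val1.
- apply: measurable_nat_of_asbool.
  exact: (family_fo hN (Rel r Var) v).
- apply: (@measurable_name (fun t => fun_int (nm t \o v))) => i.
  have := family_fo hN (Eq (Var ord0) (App f (fun j => Var (lift ord0 j)))) (scons i v).
  congr measurable; apply/seteqP; split=> t /=; rewrite scons0;
  by under eq_fun do rewrite sconsS.
Qed.

Definition tuple_of (n j : nat) : 'I_n -> nat :=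
  if unpickle j is Some v then (v : {ffun 'I_n -> nat}) else fun=> 0%N.

Lemma tuple_of_onto n (v : 'I_n -> nat) : exists j, @tuple_of n j = v.
Proof.
exists (pickle [ffun i => v i]); rewrite /tuple_of pickleK.
by apply: funext => i; rewrite ffunE.
Qed.

(** * Perfectly many models from a type distribution without atoms *)

Section ScatteredTypes.
Hypothesis hL : countable_signature L.
Variable phi : inf_form L 0.
Variables (n : nat) (psi : nat -> inf_form L n) (d : 'I_n -> nat).

Variable V : set T.
Hypothesis mV : measurable V.
Hypothesis V0 : (0 < P V)%E.
Hypothesis Vphi : V `<=` [set t | models (N t) phi].
Hypothesis Vsplit : forall W : set T, measurable W -> W `<=` V -> (0 < P W)%E ->
  exists i, (0 < P (W `&` truth_set (psi i) d))%E /\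
            (0 < P (W `&` ~` truth_set (psi i) d))%E.

(** The conditions of the fusion: compactness gives every branch a point, positive measure keeps
    [Vsplit] applicable. *)
Definition good_compact := {W : set R | [/\ compact W, W `<=` (V : set R) & (0 < P W)%E]}.

Definition gle (W W' : good_compact) : Prop := sval W `<=` sval W'.

Lemma measurable_good (W : good_compact) : measurable (sval W : set T).
Proof. by case: W => W [cW _ _] /=; exact: compact_measurable. Qed.

Lemma good_inner (W : good_compact) (A : set T) : measurable A ->
  (0 < P (sval W `&` A))%E -> exists2 W', gle W' W & sval W' `<=` (A : set R).
Proof.
move=> mA WA0; have [|K [cK KWA K0]] := unif01_inner _ WA0.
  by apply: measurableI => //; exact: measurable_good.
have KW : K `<=` sval W by move=> t /KWA[].
have KV : K `<=` V by move=> t /KW; case: (W) => W' [_ + _] /=; apply.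
by exists (exist _ K (And3 cK KV K0)) => // t /KWA[].
Qed.

(** Freezes one entry of the code on [W], which will make the code continuous in the branch. *)
Definition decides (k : nat -> coordinate L) (m : nat) (W : good_compact) : Prop :=
  exists j, sval W `<=` ([set t : T | coord (code_at t) (k m) = j] : set R).

(** At a point of [W], the m-th tuple cannot have the type that [d] has at any point of [W']. All
    tuples have to be excluded in this way, since a sentence cannot mention names. *)
Definition separates (m : nat) (W W' : good_compact) : Prop :=
  exists th, sval W' `<=` (truth_set th d : set R) /\
             sval W `<=` (~` truth_set th (@tuple_of n m) : set R).

Lemma gle_trans (U W X : good_compact) : gle U W -> gle W X -> gle U X.
Proof. by move=> UW WX t /UW/WX. Qed.

Lemma decides_le k m W W' : gle W' W -> decides k m W -> decides k m W'.
Proof. by move=> W'W [j Wj]; exists j => t /W'W/Wj. Qed.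

Lemma separates_le m U U' W W' : gle W U -> gle W' U' ->
  separates m U U' -> separates m W W'.
Proof.
by move=> WU WU' [th [h1 h2]]; exists th; split=> t; [move=> /WU'/h1|move=> /WU/h2].
Qed.

Lemma decides_dense k m W : exists2 W', gle W' W & decides k m W'.
Proof.
have [|||j Wj] := @positive_cover _ _ _ P (sval W)
    (fun j => [set t : T | coord (code_at t) (k m) = j]) (measurable_good W).
- by move=> j; exact: measurable_coord.
- by move=> t _; exists (coord (code_at t) (k m)).
- by case: (W) => W' [].
have [|W' W'W W'j] := good_inner _ Wj; first exact: measurable_coord.
by exists W' => //; exists j.
Qed.

(** Some [psi i] splits [W'] into two positive parts at [d]. Shrink [W] until the m-th tuple has a
    constant truth value for [psi i], then keep the part of [W'] with the opposite value. *)
Lemma separates_dense m W W' : exists W1 W1',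
  [/\ gle W1 W, gle W1' W' & separates m W1 W1'].
Proof.
have [i [Wi nWi]] : exists i, (0 < P (sval W' `&` truth_set (psi i) d))%E /\
            (0 < P (sval W' `&` ~` truth_set (psi i) d))%E.
  by apply: Vsplit; [exact: measurable_good|case: (W') => ? []..].
pose B := truth_set (psi i) (@tuple_of n m).
have mB : measurable B := measurable_truth_set _ _.
have [W0|/(good_inner mB)[W1 W1W W1B]] := nullVpositive P (sval W `&` B); last first.
  have [|W1' W1'W' W1'i] := good_inner _ nWi.
    by apply: measurableC; exact: measurable_truth_set.
  exists W1, W1'; split=> //; exists (Neg (psi i)); split=> // t /W1B Bt.
  by apply.
have WnB : (0 < P (sval W `&` ~` B))%E.
  by apply: positive_diff => //; [exact: measurable_good|case: (W) => ? []].
have [|W1 W1W W1B] := good_inner _ WnB; first exact: measurableC.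
have [|W1' W1'W' W1'i] := good_inner _ Wi; first exact: measurable_truth_set.
by exists W1, W1'; split=> //; exists (psi i).
Qed.

Lemma unsplit_not_scattered : ~ scattered phi.
Proof.
apply; have [k kS] := countable_enum (countable_coordinate hL) (inhabits (inl 0%N)).
have [K0 [cK0 K0V K00]] := unif01_inner mV V0.
have [W [_ Wle Wdec Wsep]] := fusion (fun _ _ h => h) gle_trans
  (@decides_le k) separates_le (decides_dense k) separates_dense
  (exist _ K0 (And3 cK0 K0V K00)).
pose pre (x : cantor_space) m := mkseq x m.
have pre_size x m : size (pre x m) = m by rewrite size_mkseq.
have preS x m : pre x m.+1 = rcons (pre x m) (x m).
  by rewrite /pre /mkseq -addn1 iotaD add0n map_cat /= cats1.
have take_pre x m m' : (m <= m')%N -> take m (pre x m') = pre x m.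
  by move=> mm'; rewrite /pre /mkseq -map_take take_iota (minn_idPl mm').
have /choice[tx txP] : forall x, exists t : R, forall m, sval (W (pre x m)) t.
  move=> x; have [||m|t Wt] := @compact_decreasing_nonempty R (fun m => sval (W (pre x m))).
  - by move=> m; case: (W _) => ? [].
  - move=> m; case: (W _) => A [cA _ A0] /=; apply/set0P/negP => /eqP A00.
    by move: A0; rewrite A00 measure0 ltxx.
  - by rewrite preS; exact: Wle.
  - by exists t => m; exact: Wt.
pose F x := code_at (tx x).
have [litf litfP] : exists litf : seq bool -> seq bool -> nat -> inf_form L n,
    forall u' u j, size u' = size u -> u' != u -> (j < size u')%N ->
    sval (W u) `<=` (truth_set (litf u' u j) d : set R) /\
    sval (W u') `<=` (~` truth_set (litf u' u j) (@tuple_of n j) : set R).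
  have h (p : seq bool * seq bool * nat) : exists th : inf_form L n,
      size p.1.1 = size p.1.2 -> p.1.1 != p.1.2 -> (p.2 < size p.1.1)%N ->
      sval (W p.1.2) `<=` (truth_set th d : set R) /\
      sval (W p.1.1) `<=` (~` truth_set th (@tuple_of n p.2) : set R).
    have [ss|ss] := eqVneq (size p.1.1) (size p.1.2); last first.
      by exists (Falsum L true n) => /eqP; rewrite (negPf ss).
    have [uu|uu] := eqVneq p.1.1 p.1.2; first by exists (Falsum L true n).
    have [jj|jj] := ltnP p.2 (size p.1.1); last by exists (Falsum L true n).
    by have [th thP] := Wsep _ _ _ ss uu jj; exists th.
  have [g gP] := choice h.
  by exists (fun u' u j => g (u', u, j)) => u' u j; exact: (gP (u', u, j)).
(* [Psi s] puts the type of the tuple into the closed set attached to [s]: at every level [m] there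
   is a node [u] above [s] such that the tuple satisfies all formulas distinguishing [d] on [W u]
   from the first [m] tuples on the other nodes of that level. *)
pose Psi (s : seq bool) : inf_form L n :=
  BAnd (fun m : nat => (size s <= m)%N) (fun m =>
    BOr (fun u : seq bool => size u = m /\ take (size s) u = s) (fun u =>
      BAnd (fun p : seq bool * nat => [/\ size p.1 = m, p.1 != u & (p.2 < m)%N])
        (fun p => litf p.1 u p.2))).
pose Sig s := exists_closure (Psi s).
have SigT x m : models (N (tx x)) (Sig (pre x m)).
  apply/sat_exists_closure; exists (nm (tx x) \o d); apply/sat_BAnd => m' mm'.
  rewrite pre_size in mm'.
  apply/sat_BOr; exists (pre x m'); first by rewrite !pre_size take_pre.
  apply/sat_BAnd => -[u' j] /= [su' u'x jm'].
  have [||h _] := litfP u' (pre x m') j _ u'x; rewrite ?pre_size ?su'//.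
  exact: h.
have SigF y s : pre y (size s) != s -> ~ models (N (tx y)) (Sig s).
  move=> ys /sat_exists_closure[v /sat_BAnd].
  have [w wv] := choice (family_onto hN (t := tx y)).
  have [j jw] := tuple_of_onto (w \o v).
  have jv : nm (tx y) \o @tuple_of n j = v by rewrite jw; apply: funext => i /=; rewrite wv.
  (* Deep enough for the j-th tuple, which names [v], to have been separated, and for the node [u]
     to extend [s] while [pre y m] does not; the formula for this pair of nodes then fails at
     [v]. *)
  pose m := maxn (size s) j.+1.
  move=> /(_ m (leq_maxl _ _))/sat_BOr[u [su us] /sat_BAnd].
  have yu : pre y m != u.
    apply: contra_neq ys => yu; rewrite -{2}us -yu take_pre//; exact: leq_maxl.
  have jm : (j < m)%N by exact: leq_maxr.
  move=> /(_ (pre y m, j)) /=; rewrite pre_size => /(_ (And3 erefl yu jm)).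
  have [||_ h] := litfP (pre y m) u j _ yu; rewrite ?pre_size ?su//.
  by rewrite -jv; apply: h.
have distinguish (x y : cantor_space) : x <> y -> exists s,
    models (N (tx x)) (Sig s) /\ ~ models (N (tx y)) (Sig s).
  move=> xy; have [m xym] : exists m, x m <> y m.
    by apply/existsNP => h; apply: xy; exact: funext.
  exists (pre x m.+1); split; first exact: SigT.
  apply: SigF; rewrite pre_size; apply/eqP; rewrite !preS => /rcons_inj[_ yx].
  exact: xym.
have codeP x (hc : is_code (F x)) (th : inf_form L 0) : models (code_structure hc) th <-> models (N (tx x)) th.
  exact: (code_ofP (family_onto hN (t := tx x)) hc).
have FI : injective F.
  move=> x y Fxy; apply: contrapT => /distinguish[s [xs ys]]; apply: ys.
  have hc : is_code (F x) by exact: (code_of_is_code (family_onto hN (t := tx x))).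
  move/(codeP x hc): xs => xs.
  move: (hc) xs; rewrite Fxy => hc' xs'.
  exact/(codeP y hc').
have [A [fA SA]] := @fragment_exists L hL (range (fun s => existT _ 0%N (Sig s)))
  (sub_countable (card_image_le _ _) (countableP _)).
exists A; split=> //; exists (range F); split.
- apply: perfect_image => //; first exact: code_space_hausdorff.
  apply: continuous_code => c x; have [m mc] := kS c.
  (* A node of length [m.+1] is the first to decide the m-th coordinate. *)
  exists m.+1 => y yx.
  have xy : pre x m.+1 = pre y m.+1.
    by apply/eq_in_map => i; rewrite mem_iota add0n => /andP[_ im]; rewrite yx.
  have [|j Wj] := Wdec (pre x m.+1); first by rewrite -size_eq0 pre_size.
  rewrite pre_size /= mc in Wj.
  by rewrite (Wj (tx y)) ?(Wj (tx x))// xy; exact: txP.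
- by exists (F (fun=> true)); exists (fun=> true).
- move=> _ [x _ <-]; have hc : is_code (F x) by exact: (code_of_is_code (family_onto hN (t := tx x))).
  exists hc; apply/codeP; apply: (Vphi (t := tx x)).
  by have := txP x 0%N; case: (W _) => ? [_ + _] /=; apply.
- move=> c e hc he [x _ Fx] [y _ Fy] ce; subst c e.
  have [s [xs ys]] : exists s, models (N (tx x)) (Sig s) /\ ~ models (N (tx y)) (Sig s).
    by apply: distinguish => xy; apply: ce; rewrite xy.
  move=> /(_ (Sig s))[|+ _]; first by apply: (SA (existT _ 0%N (Sig s))); exists s.
  by move=> /(_ (proj2 (codeP x hc _) xs))/codeP.
Qed.

End ScatteredTypes.

Definition same_type n (psi : nat -> inf_form L n) (d e : 'I_n -> nat) (t t' : T) : Prop :=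
  forall i, sat (psi i) (nm t \o d) <-> sat (psi i) (nm t' \o e).

Lemma measurable_same_type n (psi : nat -> inf_form L n) (d e : 'I_n -> nat) (t : T) :
  measurable [set t' : T | same_type psi d e t t'].
Proof.
rewrite [X in measurable X](_ : _ = \bigcap_i [set t' | (sat (psi i) (nm t \o d)) <->
   truth_set (psi i) e t']).
  apply: bigcapT_measurable => i; apply: measurable_iff; last exact: measurable_truth_set.
  exact: measurable_const.
by apply/seteqP; split=> t' h i; [move=> _|]; exact: h.
Qed.

(** Remove the countably many type events of positive measure. If what is left were not null, each
    of its positive subsets would be split by some [psi i], and [phi] would not be scattered. *)
Lemma ae_positive_type (hL : countable_signature L) (phi : inf_form L 0) n
    (psi : nat -> inf_form L n) d : scattered phi ->
  (\forall t \ae P, models (N t) phi) ->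
  \forall t \ae P, (0 < P [set t' | same_type psi d d t t'])%E.
Proof.
move=> sc aephi.
pose S (X : set nat) : set T := [set t | [set i | sat (psi i) (nm t \o d)] = X].
have SE t : S [set i | sat (psi i) (nm t \o d)] = [set t' | same_type psi d d t t'].
  apply/seteqP; split=> t' /= h.
    by move=> i; have := congr1 (fun X => X i) h => /= ->.
  by apply/seteqP; split=> i /= hi; apply/h.
have mS X : measurable (S X).
  rewrite [Y in measurable Y](_ : _ = \bigcap_i [set t | truth_set (psi i) d t <-> X i]).
    apply: bigcapT_measurable => i; apply: measurable_iff; first exact: measurable_truth_set.
    exact: measurable_const.
  apply/seteqP; split=> t /=.
    by move=> <- i _.
  by move=> h; apply/seteqP; split=> i /= hi; apply/(h i Logic.I).
pose pos := {X | (0 < P (S X))%E}.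
have cpos : countable [set: pos].
  apply: (@disjoint_positive_countable _ _ _ P pos (fun X => S (sval X))) => //.
    move=> [X X0] [Y Y0] _ _ [t [/= tX tY]].
    have XY : X = Y by rewrite -tX -tY.
    by clear tX tY; subst Y; congr exist; exact: Prop_irrelevance.
  by case.
pose U := \bigcup_(X : pos) S (sval X).
have mU : measurable U by exact: countable_bigcupT_measurable.
have [G [mG G0 Gphi]] := ae_measurable aephi.
pose V := G `&` ~` U.
have mV : measurable V by apply: measurableI => //; exact: measurableC.
have [Vnull|V0] := nullVpositive P V.
  have : \forall t \ae P, ~ V t by exact: ae_null.
  have : \forall t \ae P, ~ (~` G) t by apply: ae_null => //; exact: measurableC.
  apply: filterS2 => t /contrapT Gt nVt.
  have [[X X0] _ /= tX] : U t by apply: contrapT => nU; apply: nVt.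
  by rewrite -SE tX.
exfalso; apply: (@unsplit_not_scattered hL phi n psi d V mV V0) sc.
  by move=> t [/Gphi].
move=> W mW WV W0; apply: contrapT => nsplit.
(* On an unsplit [W] each [psi i] is almost surely true or almost surely false, so the type is
   almost surely the constant [X], which is then an atom already removed. *)
pose X := [set i | P (W `&` ~` truth_set (psi i) d) = 0%E].
have mt i := measurable_truth_set (psi i) d.
have WX : P (W `&` ~` S X) = 0%E.
  pose Z i := W `&` ~` [set t | truth_set (psi i) d t <-> X i].
  have mZ i : measurable (Z i).
    apply: measurableI => //; apply: measurableC; apply: measurable_iff => //.
    exact: measurable_const.
  apply: (@null_sub _ _ _ P _ (\bigcup_i Z i)).
  - by apply: measurableI => //; exact: measurableC.
  - exact: bigcupT_measurable.
  - move=> t [Wt nSt]; apply: contrapT => nZ; apply: nSt.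
    have h i : truth_set (psi i) d t <-> X i.
      by apply: contrapT => nh; apply: nZ; exists i.
    by apply/seteqP; split=> i /= hi; apply/h.
  apply: null_bigcup => // i.
  have [Xi|nXi] := pselect (X i).
    apply: (null_sub _ _ _ Xi) => //; first by apply: measurableI => //; exact: measurableC.
    by move=> t [Wt nh]; split=> // h; apply: nh; split.
  have Wi : P (W `&` truth_set (psi i) d) = 0%E.
    have [//|W1] := nullVpositive P (W `&` truth_set (psi i) d).
    exfalso; apply: nsplit; exists i; split=> //.
    by have [/nXi|] := nullVpositive P (W `&` ~` truth_set (psi i) d).
  apply: null_sub Wi => //; first exact: measurableI.
  by move=> t [Wt nh]; split=> //; apply: contrapT => h; apply: nh; split.
have : (0 < P (S X))%E.
  have := @positive_diff _ _ _ P W (~` S X) mW (measurableC (mS X)) WX W0.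
  by rewrite setCK; apply: positive_sub => //; exact: measurableI.
move=> SX0; move: W0; rewrite (@null_sub _ _ _ P W (W `&` ~` S X))// ?ltxx//.
  by apply: measurableI => //; exact: measurableC.
move=> t Wt; split=> // St.
by have [_] := WV t Wt; apply; exists (exist _ X SX0).
Qed.

End MeasurableFamily.

(** * Stable sets of formulas and measurable isomorphisms *)

Section Stabilization.
Variables (R : realType) (F : Type) (le : F -> F -> Prop).
Hypothesis leF_trans : forall a b c, le a b -> le b c -> le a c.
Hypothesis leF_sup : forall s : nat -> F, exists a, forall k, le (s k) a.

(** For each [j] choose elements whose [q j] approaches the infimum over the elements above [a0]. An
    upper bound of all these countably many elements attains every infimum at once. *)
Lemma sigma_directed_stable (q : nat -> F -> R) (a0 : F) :
  (forall j a, 0 <= q j a) -> (forall j a b, le a b -> q j b <= q j a) ->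
  exists2 a, le a0 a & forall j b, le a b -> q j b = q j a.
Proof.
move=> q0 qle.
have h (jm : nat * nat) : exists a, le a0 a /\
    q jm.1 a < inf [set x | exists2 a, le a0 a & x = q jm.1 a] + jm.2.+1%:R^-1.
  set S := [set x | _].
  have [a1 a01] : exists a, le a0 a by have [a ha] := leF_sup (fun=> a0); exists a; exact: (ha 0%N).
  have hS : has_inf S.
    split; first by exists (q jm.1 a1), a1.
    by exists 0 => _ [a _ ->].
  have p0 : 0 < jm.2.+1%:R^-1 :> R by rewrite invr_gt0.
  have [_ [a a0a ->] lt] := inf_adherent p0 hS.
  by exists a.
have [s sP] := choice h.
have [a aP] := leF_sup (fun k => if unpickle k is Some jm then s jm else s (0, 0)%N).
have sa jm : le (s jm) a by have := aP (pickle jm); rewrite pickleK.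
exists a; first exact: leF_trans (sP (0, 0)%N).1 (sa _).
move=> j b ab; apply/eqP; rewrite eq_le qle//=.
apply/ler_addgt0Pr => e e0.
have [m me] := ltr_add_invr (e0 : 0 < e); rewrite add0r in me.
have [_ lt] := sP (j, m).
apply: (le_trans (qle _ _ _ (sa (j, m)))).
apply: (le_trans (ltW lt)); apply: lerD; last exact: ltW.
apply: ge_inf => //.
  by exists 0 => _ [c _ ->].
by exists b => //; apply: leF_trans ab; exact: leF_trans (sP (0, 0)%N).1 (sa _).
Qed.

End Stabilization.

Section FormulaSets.
Variable L : signature.

(* A countable set of formulas of each arity, given by an enumeration. *)
Definition formula_set := forall n, nat -> inf_form L n.

Definition fle (A B : formula_set) : Prop := forall n i, exists j, A n i = B n j.

Lemma fle_trans (A B C : formula_set) : fle A B -> fle B C -> fle A C.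
Proof. by move=> AB BC n i; have [j ->] := AB n i; exact: BC. Qed.

Lemma formula_set_of (S : set {n & inf_form L n}) : countable S ->
  exists A : formula_set, forall n th, S (existT _ n th) -> exists i, A n i = th.
Proof.
move=> cS; have [[x0 Sx0]|S0] := pselect (S !=set0); last first.
  exists (fun n _ => Falsum L true n) => n th Sth; exfalso; apply: S0.
  by exists (existT _ n th).
have [g gS] := countable_set_enum cS (ex_intro _ x0 Sx0).
exists (fun n i => match eqVneq (projT1 (g i)) n with
   | EqNotNeq e => ecast n (inf_form L n) e (projT2 (g i))
   | _ => Falsum L true n end) => n th.
rewrite gS => -[i _ gi]; exists i.
by rewrite gi /=; case: eqVneq => [e|/eqP//]; rewrite (eq_irrelevance e erefl).
Qed.

Lemma fle_sup (s : nat -> formula_set) : exists A, forall k, fle (s k) A.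
Proof.
exists (fun n k => if unpickle k is Some ki then s (ki : nat * nat).1 n ki.2 else s 0%N n 0%N).
by move=> k n i; exists (pickle (k, i)); rewrite pickleK.
Qed.

End FormulaSets.

Section Classification.
Variables (R : realType) (L : signature).
Notation T := (measurableTypeR R).
Notation P := (@unif01 R).
Notation PP := (P \x P)%E.
Variables (N : T -> structure L) (nm : forall t, nat -> N t).
Hypothesis hN : measurable_family nm.

Notation same psi d e t t' := (same_type nm psi d e t t').

Lemma same_type_sym n (psi : nat -> inf_form L n) d e t t' :
  same psi d e t t' -> same psi e d t' t.
Proof. by move=> h i; split=> /h. Qed.

Lemma same_type_trans n (psi : nat -> inf_form L n) d e f t t' t'' :
  same psi d e t t' -> same psi e f t' t'' -> same psi d f t t''.
Proof. by move=> h1 h2 i; split=> [/h1/h2|/h2/h1]. Qed.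

Lemma measurable_same_typel n (psi : nat -> inf_form L n) d e (t' : T) :
  measurable [set t : T | same psi d e t t'].
Proof.
have := measurable_same_type hN psi e d t'.
by congr measurable; apply/seteqP; split=> t /same_type_sym.
Qed.

Definition coincidence (A : formula_set L) n (d e : 'I_n -> nat) : set (T * T) :=
  [set p | same (A n) d e p.1 p.2].

Lemma measurable_coincidence A n d e : measurable (@coincidence A n d e).
Proof.
rewrite /coincidence [X in measurable X](_ : _ =
  \bigcap_i [set p : T * T | (fst @^-1` truth_set nm (A n i) d) p <->
    (snd @^-1` truth_set nm (A n i) e) p]).
  apply: bigcapT_measurable => i; apply: measurable_iff.
    by rewrite -[X in measurable X]setTI; apply: measurable_fst => //; exact: (measurable_truth_set hN).
  by rewrite -[X in measurable X]setTI; apply: measurable_snd => //; exact: (measurable_truth_set hN).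
by apply/seteqP; split=> p h i; [move=> _|]; exact: h.
Qed.

Lemma coincidence_le (A B : formula_set L) n (d e : 'I_n -> nat) :
  fle A B -> coincidence B d e `<=` coincidence A d e.
Proof. by move=> AB p h i; have [j ->] := AB n i; exact: h. Qed.

(** There are only countably many pairs of tuples of names, hence countably many coincidence
    measures to minimize. *)
Lemma stable_formula_set (A0 : formula_set L) : exists2 A, fle A0 A &
  forall B, fle A B -> forall n (d e : 'I_n -> nat),
    PP (coincidence B d e) = PP (coincidence A d e).
Proof.
have cJ : countable [set: {n & (('I_n -> nat) * ('I_n -> nat))%type}].
  apply: countable_sigT => [|n]; first exact: countableP.
  by rewrite -setXTT; apply: countableX; apply: countable_ord_fun; exact: countableP.
have [g gS] := countable_enum cJ (inhabits (existT _ 0%N (@no_vars _, @no_vars _))).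
pose q j A := fine (PP (coincidence A (projT2 (g j)).1 (projT2 (g j)).2)).
have fin A n (d e : 'I_n -> nat) : PP (coincidence A d e) \is a fin_num.
  exact: (fin_num_measure ((P \x P)%E : probability _ R) _ (measurable_coincidence A d e)).
have [||A A0A AP] := @sigma_directed_stable R _ (@fle L) (@fle_trans L) (@fle_sup L) q A0.
- by move=> j A; rewrite fine_ge0.
- move=> j A B AB; rewrite fine_le// le_measure ?inE//; try exact: measurable_coincidence.
  exact: coincidence_le.
exists A => // B AB n d e0; have [j gj] := gS (existT _ n (d, e0)).
have := AP j B AB; rewrite /q gj /= => e.
by rewrite -(fineK (fin B n d e0)) -(fineK (fin A n d e0)) e.
Qed.

Definition type_event n (psi : nat -> inf_form L n) d (X : set nat) : set T :=
  [set t | forall i, sat (psi i) (nm t \o d) <-> X i].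

Lemma measurable_type_event n (psi : nat -> inf_form L n) d X :
  measurable (type_event psi d X).
Proof.
rewrite [Y in measurable Y](_ : _ = \bigcap_i [set t | truth_set nm (psi i) d t <-> X i]).
  apply: bigcapT_measurable => i; apply: measurable_iff; first exact: (measurable_truth_set hN).
  exact: measurable_const.
by apply/seteqP; split=> p h i; [move=> _|]; exact: h.
Qed.

Lemma countable_positive_types n (psi : nat -> inf_form L n) d :
  countable [set X | (0 < P (type_event psi d X))%E].
Proof.
set pos := [set X | _].
suff : countable [set: {X | pos X}].
  move=> /countable_inj[g gI]; apply/countable_injP.
  exists (fun X => if pselect (pos X) is left h then g (exist _ X h) else 0%N).
  move=> X Y; rewrite !inE => hX hY; case: pselect => // pX; case: pselect => // pY.
  by move=> /gI[].
apply: (@disjoint_positive_countable _ _ _ P _ (fun X => type_event psi d (sval X))).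
- by move=> X; exact: measurable_type_event.
- move=> [X X0] [Y Y0] _ _ [t [/= tX tY]].
  have XY : X = Y by apply/seteqP; split=> i; [move=> /tX/tY|move=> /tY/tX].
  by clear tX tY; subst Y; congr exist; exact: Prop_irrelevance.
- by case.
Qed.

Definition realized_type n (psi : nat -> inf_form L n.+1) (X : set nat) : inf_form L n :=
  Ex (BAnd (fun _ : nat => True) (fun i => if pselect (X i) then psi i else Neg (psi i))).

Lemma sat_realized_type (M : structure L) n (psi : nat -> inf_form L n.+1) X (v : 'I_n -> M) :
  sat (realized_type psi X) v <-> exists x, forall i, sat (psi i) (scons x v) <-> X i.
Proof.
rewrite sat_Ex; split=> -[x h]; exists x.
  move: h => /sat_BAnd h i; have := h i Logic.I.
  by case: pselect => // nX /= h1; split.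
by apply/sat_BAnd => i _; case: pselect => [/h//|nX /h].
Qed.

(** For each tuple only countably many types have positive probability, so countably many new
    formulas suffice. *)
Lemma type_extension (A : formula_set L) : exists2 B : formula_set L, fle A B &
  forall n (d : 'I_n.+1 -> nat) X, (0 < P (type_event (A n.+1) d X))%E ->
    exists i, B n i = realized_type (A n.+1) X.
Proof.
pose S1 : set {n & inf_form L n} := [set x | exists n i, x = existT _ n (A n i)].
pose S2 : set {n & inf_form L n} := [set x | exists n (d : 'I_n.+1 -> nat) X,
  (0 < P (type_event (A n.+1) d X))%E /\ x = existT _ n (realized_type (A n.+1) X)].
have cim (U V : Type) (f : U -> V) (C : set U) : countable C -> countable (f @` C).
  by move=> cC; apply: sub_countable cC; exact: card_image_le.
have cS1 : countable S1.
  apply: sub_countable (cim _ _ (fun p : nat * nat => existT (inf_form L) p.1 (A p.1 p.2)) setT (countableP _)).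
  by apply: subset_card_le => _ [n [i ->]]; exists (n, i).
have cS2 : countable S2.
  have -> : S2 = \bigcup_n \bigcup_(d : 'I_n.+1 -> nat)
     ((fun X => existT (inf_form L) n (realized_type (A n.+1) X)) @`
       [set X | (0 < P (type_event (A n.+1) d X))%E]).
    apply/seteqP; split=> [_ [n [d [X [X0 ->]]]]|_ [n _ [d _ [X X0 <-]]]].
      by exists n => //; exists d => //; exists X.
    by exists n, d, X.
  apply: bigcup_countable => [|n _]; first exact: countableP.
  apply: bigcup_countable => [|d _]; first exact/countable_ord_fun/countableP.
  by apply: cim; exact: countable_positive_types.
have [|B BP] := @formula_set_of L (S1 `|` S2).
  rewrite -bigcup2E; apply: bigcup_countable; first exact: countableP.
  by case=> [|[|?]] _.
exists B; first by move=> n i; have [|j <-] := BP n (A n i); [left; exists n, i|exists j].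
by move=> n d X X0; apply: BP; right; exists n, d, X.
Qed.

(** A finite partial isomorphism is a list of pairs of names, newest first, in accordance with
    [scons]. *)
Definition lefts (l : seq (nat * nat)) : 'I_(size l) -> nat := fun i => (nth (0, 0)%N l i).1.
Definition rights (l : seq (nat * nat)) : 'I_(size l) -> nat := fun i => (nth (0, 0)%N l i).2.

Arguments lefts l _ : clear implicits.
Arguments rights l _ : clear implicits.

Lemma lefts_cons p l : lefts (p :: l) = scons p.1 (lefts l).
Proof.
apply: funext => i; case: (unliftP ord0 i) => [j ->|->]; rewrite ?scons0 ?sconsS //.
Qed.

Lemma rights_cons p l : rights (p :: l) = scons p.2 (rights l).
Proof.
apply: funext => i; case: (unliftP ord0 i) => [j ->|->]; rewrite ?scons0 ?sconsS //.
Qed.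

Section Matching.
Variables (A B : formula_set L) (G : set T).
Hypothesis AB : fle A B.
Hypothesis stable : forall n (d e : 'I_n -> nat),
  PP (coincidence B d e) = PP (coincidence A d e).
Hypothesis Bext : forall n (d : 'I_n.+1 -> nat) X,
  (0 < P (type_event (A n.+1) d X))%E -> exists i, B n i = realized_type (A n.+1) X.
Hypothesis GB : forall t, G t -> forall n (d : 'I_n -> nat),
  (0 < P [set t' | same (B n) d d t t'])%E.
Hypothesis A_Eq : forall n (s t : term L n), exists i, A n i = Eq s t.
Hypothesis A_Rel : forall n r (ts : _ -> term L n), exists i, A n i = Rel r ts.

Lemma same_type_le n (d e : 'I_n -> nat) t t' : same (B n) d e t t' -> same (A n) d e t t'.
Proof. exact: (@coincidence_le A B n d e AB (t, t')). Qed.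

(* A discrepancy would give a rectangle of positive measure in the difference
   of the two coincidence sets. *)
Lemma same_type_upgrade n (d e : 'I_n -> nat) t t' : G t -> G t' ->
  same (A n) d e t t' -> same (B n) d e t t'.
Proof.
move=> Gt Gt' sA; apply: contrapT => nsB.
pose X := [set s | same (B n) d d t s].
pose X' := [set s | same (B n) e e t' s].
have mX : measurable X by exact: measurable_same_type.
have mX' : measurable X' by exact: measurable_same_type.
have mXX : measurable (X `*` X') by exact: measurableX.
have mA := measurable_coincidence A d e.
have mB := measurable_coincidence B d e.
have XX0 : (0 < PP (X `*` X'))%E.
  by rewrite product_measure1E// mule_gt0//; exact: GB.
have sub : coincidence B d e `|` (X `*` X') `<=` coincidence A d e.
  move=> p [|[Xp X'p]]; first exact: coincidence_le.
  apply: (same_type_trans (same_type_sym (same_type_le Xp))).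
  exact: (same_type_trans sA (same_type_le X'p)).
have disj : coincidence B d e `&` (X `*` X') = set0.
  apply/seteqP; split=> // p [Bp [Xp X'p]]; apply: nsB.
  exact: (same_type_trans Xp (same_type_trans Bp (same_type_sym X'p))).
have : (PP (coincidence B d e `|` (X `*` X')) <= PP (coincidence A d e))%E.
  apply: (le_measure ((P \x P)%E : probability _ R)); rewrite ?inE//; exact: measurableU.
have -> : PP (coincidence B d e `|` (X `*` X')) = (PP (coincidence B d e) + PP (X `*` X'))%E.
  exact: (measureU ((P \x P)%E : probability _ R) mB mXX disj).
rewrite stable leNgt => /negP; apply; rewrite lteDl//.
exact: (fin_num_measure ((P \x P)%E : probability _ R)).
Qed.

(** By [GB] the type [X] of the extended tuple has positive probability, so [B] contains the formula
    asserting that [X] is realized. By [same_type_upgrade] this formula passes from [d] to [e]. *)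
Lemma back_and_forth n (d e : 'I_n -> nat) t t' b : G t -> G t' ->
  same (A n) d e t t' -> exists b', same (A n.+1) (scons b d) (scons b' e) t t'.
Proof.
move=> Gt Gt' sA; pose X := [set i | sat (A n.+1 i) (nm t \o scons b d)].
have X0 : (0 < P (type_event (A n.+1) (scons b d) X))%E.
  have := GB Gt (scons b d); apply: positive_sub.
  - exact: (measurable_same_type hN).
  - exact: measurable_type_event.
  - move=> s /same_type_le h i; have := h i; rewrite /X /=; tauto.
have [i Bi] := Bext X0.
have := same_type_upgrade Gt Gt' sA i; rewrite Bi.
move=> [+ _]; move=> /(_ _)/sat_realized_type[|x xP].
  by apply/sat_realized_type; exists (nm t b) => j; rewrite /X /= comp_scons.
have [b' b'x] := family_onto hN x; exists b' => j.
by rewrite [nm t' \o _]comp_scons b'x; have := xP j; rewrite /X /=; tauto.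
Qed.

Definition matched (t t' : T) (l : seq (nat * nat)) : Prop :=
  same (A (size l)) (lefts l) (rights l) t t'.

(** Step [n] treats the name [n./2], on the left for even [n] and on the right for odd [n]. The
    least partner is measurable in [t]. *)
Definition match_step (t t' : T) (n : nat) (l : seq (nat * nat)) : seq (nat * nat) :=
  if odd n then (least (fun a => matched t t' ((a, n./2) :: l)), n./2) :: l
  else (n./2, least (fun b => matched t t' ((n./2, b) :: l))) :: l.

Fixpoint matching (t t' : T) (n : nat) : seq (nat * nat) :=
  if n is n'.+1 then match_step t t' n' (matching t t' n') else [::].

(** Step [a.*2] is the one that treats [a] on the left; its new pair is the head of the list of
    length [a.*2.+1]. *)
Definition transfer (t t' : T) (a : nat) : nat := (head (0, 0)%N (matching t t' a.*2.+1)).2.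

Lemma matching_matched t t' n : G t -> G t' -> matched t t' [::] ->
  matched t t' (matching t t' n).
Proof.
move=> Gt Gt' m0; elim: n => //= n IH; rewrite /match_step; case: ifP => _.
  apply: (@leastP (fun a => matched t t' ((a, n./2) :: _))).
  have [a aP] := back_and_forth n./2 Gt' Gt (same_type_sym IH).
  by exists a; rewrite /matched lefts_cons rights_cons; exact: same_type_sym.
apply: (@leastP (fun b => matched t t' ((n./2, b) :: _))).
have [b bP] := back_and_forth n./2 Gt Gt' IH.
by exists b; rewrite /matched lefts_cons rights_cons.
Qed.

Lemma matching_sub t t' m n p : (m <= n)%N -> p \in matching t t' m -> p \in matching t t' n.
Proof.
elim: n => [|n IH]; first by rewrite leqn0 => /eqP ->.
rewrite leq_eqVlt => /predU1P[->//|]; rewrite ltnS => mn /(IH mn) pn.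
by rewrite /= /match_step; case: ifP => _; rewrite inE pn orbT.
Qed.

Lemma transfer_matching t t' a : (a, transfer t t' a) \in matching t t' a.*2.+1.
Proof.
by rewrite /transfer /= /match_step odd_double /= doubleK inE eqxx.
Qed.

Lemma matching_right t t' b : exists a, (a, b) \in matching t t' b.*2.+2.
Proof.
rewrite /= {1}/match_step /= odd_double /= uphalf_double.
by eexists; exact: mem_head.
Qed.

(** The given pairs sit at positions [rho i] of the list, so [th] renamed along [rho] is a formula
    about the whole matched tuple. *)
Lemma matched_atoms t t' l n (v w : 'I_n -> nat) (th : inf_form L n) :
  matched t t' l -> (forall i, (v i, w i) \in l) ->
  (forall m (s : 'I_n -> term L m), exists i, A m i = subst th s) ->
  sat th (nm t \o v) <-> sat th (nm t' \o w).
Proof.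
move=> ml vwl Ath.
pose rho i : 'I_(size l) := Ordinal (etrans (index_mem (v i, w i) l) (vwl i)).
have vE : v = lefts l \o rho by apply: funext => i; rewrite /lefts /= nth_index.
have wE : w = rights l \o rho by apply: funext => i; rewrite /rights /= nth_index.
have [i Ai] := Ath _ (fun j => Var (rho j)).
have := ml i; rewrite Ai !sat_subst /=.
by rewrite vE wE.
Qed.

Lemma transfer_sat t t' : G t -> G t' -> matched t t' [::] ->
  (forall inf n (th : formula L inf n) v,
     sat th (nm t \o v) <-> sat th (nm t' \o (transfer t t' \o v))) /\
  forall b, exists a, nm t' (transfer t t' a) = nm t' b.
Proof.
move=> Gt Gt' m0.
have common n (v : 'I_n -> nat) : exists k, forall i, (v i, transfer t t' (v i)) \in matching t t' k.
  exists (\max_(i < n) (v i).*2.+1)%N => i.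
  apply: matching_sub (transfer_matching _ _ _).
  exact: (@leq_bigmax _ (fun i => (v i).*2.+1)).
have Eqs n (s u : term L n) v w l : matched t t' l -> (forall i, (v i, w i) \in l) ->
    sat (Eq (inf := true) s u) (nm t \o v) <-> sat (Eq (inf := true) s u) (nm t' \o w).
  by move=> ml vwl; apply: matched_atoms ml vwl _ => m f; exact: A_Eq.
have onto b : exists a, nm t' (transfer t t' a) = nm t' b.
  have [a ab] := matching_right t t' b; exists a.
  (* At this stage [a] is paired both with [transfer t t' a] and with [b]; the truth of a = a on the
     left forces these two names to denote the same element on the right. *)
  pose k := maxn a.*2.+1 b.*2.+2.
  have := @Eqs 2 (Var ord0) (Var ord_max) (fun=> a) (pair_val (transfer t t' a) b)
    (matching t t' k) (matching_matched k Gt Gt' m0) _.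
  rewrite /= pair_val0 pair_val1 => -[|h _]; last exact: h.
  move=> i; case: (unliftP ord0 i) => [j ->|->]; rewrite /pair_val ?sconsS ?scons0.
    by rewrite (ord1 j) scons0; apply: matching_sub ab; exact: leq_maxr.
  by apply: matching_sub (transfer_matching _ _ _); exact: leq_maxl.
split=> // inf n th v.
apply: (@sat_named L nat (N t) (N t') (nm t) (nm t' \o transfer t t')).
- by move=> x; exact: (family_onto hN).
- by move=> y; have [b <-] := family_onto hN y; exact: onto.
- move=> m s u w; have [k kP] := common _ w.
  exact: (Eqs _ s u w (transfer t t' \o w) _ (matching_matched k Gt Gt' m0) kP).
- move=> m r ts w; have [k kP] := common _ w.
  apply: (matched_atoms (w := transfer t t' \o w) (matching_matched k Gt Gt' m0) kP).
  by move=> m' f; exact: A_Rel.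
Qed.

Lemma measurable_matched (t' : T) l : measurable [set t | matched t t' l].
Proof. exact: measurable_same_typel. Qed.

Lemma measurable_transfer (t' : T) a :
  discrete_measurable_map (fun t => transfer t t' a).
Proof.
have cl : countable [set: seq (nat * nat)] by exact: countableP.
have mconst (C : Type) (x : C) : discrete_measurable_map (fun _ : T => x).
  by move=> y; exact: measurable_const.
have mm n : discrete_measurable_map (fun t => matching t t' n).
  elim: n => [|n IH] /=; first exact: mconst.
  apply: (discrete_measurable_bind (F := fun l t => match_step t t' n l)) => // l.
  rewrite /match_step; case: (odd n).
    apply: (discrete_measurable_bind (C1 := nat) (F := fun x t => (x, n./2) :: l));
      [exact: countableP| |by move=> x; exact: mconst].
    by apply: discrete_measurable_least => m; exact: measurable_matched.
  apply: (discrete_measurable_bind (C1 := nat) (F := fun x t => (n./2, x) :: l));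
    [exact: countableP| |by move=> x; exact: mconst].
  by apply: discrete_measurable_least => m; exact: measurable_matched.
apply: (discrete_measurable_bind (F := fun l t => (head (0, 0)%N l).2)
  cl (mm a.*2.+1)) => l; exact: mconst.
Qed.

End Matching.

Theorem scattered_classification (hL : countable_signature L) (phi : inf_form L 0) :
  scattered phi -> (\forall t \ae P, models (N t) phi) ->
  exists (G : set T) (eqv : T -> T -> Prop) (h : T -> T -> nat -> nat),
    [/\ (measurable G /\ P (~` G) = 0%E) /\ (forall t, G t -> models (N t) phi),
        [/\ forall t, eqv t t, forall t t', eqv t t' -> eqv t' t &
            forall t t' t'', eqv t t' -> eqv t' t'' -> eqv t t''],
        (forall t, measurable [set t' | eqv t t']) /\
        (forall t, G t -> (0 < P [set t' | eqv t t'])%E),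
        forall t' a, discrete_measurable_map (fun t => h t t' a)
      & forall t t', G t -> G t' -> eqv t t' ->
          (forall inf n (th : formula L inf n) v,
             sat th (nm t \o v) <-> sat th (nm t' \o (h t t' \o v))) /\
          forall b, exists a, nm t' (h t t' a) = nm t' b].
Proof.
move=> sc aephi.
(* Starting from the atomic formulas ensures that equal types preserve them. *)
have [A0 A0P] := formula_set_of (countable_atoms hL true).
have [A A0A Ast] := stable_formula_set A0.
have [B AB Bext] := type_extension A.
have : \forall t \ae P, models (N t) phi /\
    forall x : {n & 'I_n -> nat},
      (0 < P [set t' | same (B (projT1 x)) (projT2 x) (projT2 x) t t'])%E.
  have aeB : \forall t \ae P, forall x : {n & 'I_n -> nat},
      (0 < P [set t' | same (B (projT1 x)) (projT2 x) (projT2 x) t t'])%E.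
    apply: ae_countable => [|x]; last exact: (@ae_positive_type R L N nm hN hL phi).
    apply: countable_sigT => [|n]; first exact: countableP.
    exact/countable_ord_fun/countableP.
  by apply: filterS2 aephi aeB => t ? ?; split.
move=> /ae_measurable[G [mG G0 GP]].
(* Matching the empty list means having the same [A]-theory. *)
exists G, (fun t t' => matched A t t' [::]), (fun t t' => transfer A t t').
have GB t : G t -> forall n (d : 'I_n -> nat), (0 < P [set t' | same (B n) d d t t'])%E.
  by move=> /GP[_ h] n d; exact: (h (existT _ n d)).
have same0 (t t' : T) : matched A t t' [::] <-> same (A 0%N) (@no_vars _) (@no_vars _) t t'.
  by rewrite /matched (no_varsE (lefts [::])) (no_varsE (rights [::])).
split.
- by split=> // t /GP[].
- split=> [t|t t' h|t t' t'' h h']; first by apply/same0 => i.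
    exact/same0/same_type_sym/same0.
  by apply/same0; exact: same_type_trans (proj1 (same0 _ _) h) (proj1 (same0 _ _) h').
- split=> [t|t /GB h].
    have := measurable_same_type hN (A 0%N) (@no_vars _) (@no_vars _) t.
    by congr measurable; apply/seteqP; split=> t' /same0.
  apply: positive_sub (h 0%N (@no_vars _)).
  + exact: (measurable_same_type hN).
  + have := measurable_same_type hN (A 0%N) (@no_vars _) (@no_vars _) t.
    by congr measurable; apply/seteqP; split=> t' /same0.
  + by move=> t' tt'; apply/same0; exact: (same_type_le AB tt').
- by move=> t' a; exact: measurable_transfer.
- move=> t t' Gt Gt' m0; apply: (transfer_sat AB (Ast _ AB) Bext GB) => //.
    move=> n s u; have [|i Ai] := A0P n (Eq s u); first by left; exists n, s, u.
    by have [j Aj] := A0A n i; exists j; rewrite -Aj Ai.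
  move=> n r ts; have [|i Ai] := A0P n (Rel r ts); first by right; exists n, r, ts.
  by have [j Aj] := A0A n i; exists j; rewrite -Aj Ai.
Qed.

End Classification.

(** * Events as Borel sets *)

Lemma dist_le_add (R : realType) (a b c d : R) :
  a <= b + c -> b <= a + d -> 0 <= c -> 0 <= d -> `|a - b| <= c + d.
Proof. by move=> *; rewrite ler_norml; apply/andP; split; lra. Qed.

Lemma sub_lt_of_dist (R : realType) (l a b e : R) :
  `|l - a| < e / 2 -> `|l - b| < e / 2 -> b - a < e.
Proof. by rewrite !ltr_norml => /andP[? ?] /andP[? ?]; lra. Qed.

Section RealProbability.
Context d (T : measurableType d) (R : realType) (P : probability T R).

Definition pr (X : set T) : R := fine (P X).

Lemma pr_fineK X : measurable X -> ((pr X)%:E = P X)%E.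
Proof. by move=> mX; rewrite /pr fineK// fin_num_measure. Qed.

Lemma pr_ge0 X : 0 <= pr X.
Proof. by rewrite /pr fine_ge0. Qed.

Lemma pr_set0 : pr set0 = 0.
Proof. by rewrite /pr measure0. Qed.

Lemma pr_setT : pr setT = 1.
Proof. by rewrite /pr probability_setT. Qed.

Lemma pr_split X Y : measurable X -> measurable Y ->
  pr X = pr (X `&` Y) + pr (X `&` ~` Y).
Proof.
move=> mX mY; have mXY : measurable (X `&` Y) by exact: measurableI.
have mXnY : measurable (X `&` ~` Y) by apply: measurableI => //; exact: measurableC.
apply: EFin_inj; rewrite EFinD !pr_fineK// -measureU//.
  by rewrite -setIUr setUCr setIT.
by rewrite setIACA setICr setI0.
Qed.

Lemma le_pr X Y : measurable X -> measurable Y -> X `<=` Y -> pr X <= pr Y.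
Proof. by move=> mX mY XY; rewrite fine_le ?fin_num_measure// le_measure ?inE. Qed.

Lemma pr_eq0 X : measurable X -> pr X = 0 <-> P X = 0%E.
Proof. by move=> mX; rewrite -pr_fineK//; split=> [->//|[]]. Qed.

Lemma prU X Y : measurable X -> measurable Y ->
  pr (X `|` Y) = pr X + pr Y - pr (X `&` Y).
Proof.
move=> mX mY; rewrite (pr_split (measurableU _ _ mX mY) mX) setUK.
rewrite setIUl setICr set0U (pr_split mY mX) setIC.
by rewrite [Y `&` X]setIC; lra.
Qed.

Lemma prU_le X Y : measurable X -> measurable Y -> pr (X `|` Y) <= pr X + pr Y.
Proof. by move=> mX mY; rewrite prU// lerBlDr lerDl pr_ge0. Qed.

Lemma pr_nondecreasing_cvg (F : nat -> set T) : (forall n, measurable (F n)) ->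
  (forall n, F n `<=` F n.+1) -> (fun n => pr (F n)) @ \oo --> pr (\bigcup_n F n).
Proof.
move=> mF iF; apply: fine_cvg; rewrite pr_fineK; last exact: bigcupT_measurable.
apply: (nondecreasing_cvg_mu mF); first exact: bigcupT_measurable.
by apply/nondecreasing_seqP => n; rewrite subsetEset; exact: iF.
Qed.

Lemma pr_nonincreasing_cvg (F : nat -> set T) : (forall n, measurable (F n)) ->
  (forall n, F n.+1 `<=` F n) -> (fun n => pr (F n)) @ \oo --> pr (\bigcap_n F n).
Proof.
move=> mF iF; apply: fine_cvg; rewrite pr_fineK; last exact: bigcapT_measurable.
apply: (nonincreasing_cvg_mu _ mF); last 2 first.
- exact: bigcapT_measurable.
- by apply/nonincreasing_seqP => n; rewrite subsetEset; exact: iF.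
- by rewrite ltey_eq fin_num_measure.
Qed.

End RealProbability.

Section EventAlgebra.
Variables (R : realType) (L : signature) (P : LR_prestructure R L).
Hypothesis hP : is_complete_randomization P.
Hypothesis sepE : separable_dist (@dE _ _ P).

Let rand : is_randomization P. Proof. by case: hP. Qed.
Let pre : is_prestructure P. Proof. exact: rand_pre. Qed.
Let sep_dE : separated (@dE _ _ P). Proof. by case: hP => _ []. Qed.

Implicit Types U V W : rE P.

Lemma dE_refl U : dE U U = 0. Proof. by have [h _ _ _] := pre_dE pre; exact: h. Qed.
Lemma dE_sym U V : dE U V = dE V U. Proof. by have [_ h _ _] := pre_dE pre; exact: h. Qed.
Lemma dE_triangle U V W : dE U W <= dE U V + dE V W.
Proof. by have [_ _ h _] := pre_dE pre; exact: h. Qed.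
Lemma mu_ge0 U : 0 <= mu U. Proof. by have /andP[] := pre_mu01 pre U. Qed.

Lemma ejoinC U V : ejoin U V = ejoin V U. Proof. by apply: sep_dE; exact: rand_joinC. Qed.
Lemma emeetC U V : emeet U V = emeet V U. Proof. by apply: sep_dE; exact: rand_meetC. Qed.
Lemma emeetA U V W : emeet U (emeet V W) = emeet (emeet U V) W.
Proof. by apply: sep_dE; exact: rand_meetA. Qed.
Lemma emeetUr U V W : emeet U (ejoin V W) = ejoin (emeet U V) (emeet U W).
Proof. by apply: sep_dE; exact: rand_meetUr. Qed.
Lemma emeetUl U V W : emeet (ejoin V W) U = ejoin (emeet V U) (emeet W U).
Proof. by rewrite emeetC emeetUr ![emeet U _]emeetC. Qed.
Lemma ejoin0 U : ejoin U (ebot P) = U. Proof. by apply: sep_dE; exact: rand_join0. Qed.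
Lemma emeet1 U : emeet U (etop P) = U. Proof. by apply: sep_dE; exact: rand_meet1. Qed.
Lemma ejoinN U : ejoin U (ecompl U) = etop P. Proof. by apply: sep_dE; exact: rand_joinN. Qed.
Lemma emeetN U : emeet U (ecompl U) = ebot P. Proof. by apply: sep_dE; exact: rand_meetN. Qed.

Lemma emeetxx U : emeet U U = U.
Proof. by rewrite -[RHS]emeet1 -(ejoinN U) emeetUr emeetN ejoin0. Qed.

Lemma emeet0 U : emeet U (ebot P) = ebot P.
Proof. by rewrite -(emeetN U) emeetA emeetxx. Qed.

Lemma ejoinxx U : ejoin U U = U.
Proof.
apply: sep_dE; have := @rand_joinIr _ _ _ rand U U (ecompl U).
by rewrite emeetN ejoin0 ejoinN emeet1 /eeq dE_sym.
Qed.

Lemma emeetAC U V W : emeet (emeet U V) W = emeet (emeet U W) V.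
Proof. by rewrite -!emeetA [emeet V W]emeetC. Qed.

Lemma mu_disjoint U V : emeet U V = ebot P -> mu (ejoin U V) = mu U + mu V.
Proof. by move=> UV; rewrite (rand_muU rand) UV (rand_mu0 rand) addr0. Qed.

Lemma mu_split U V : mu U = mu (emeet U V) + mu (emeet U (ecompl V)).
Proof.
rewrite -mu_disjoint; first by rewrite -emeetUr ejoinN emeet1.
by rewrite -emeetA [emeet V _]emeetA [emeet V U]emeetC -[emeet (emeet U V) _]emeetA
  emeetN !emeet0.
Qed.

Lemma mu_meet_le U V : mu (emeet U V) <= mu U.
Proof. by rewrite (mu_split U V) lerDl mu_ge0. Qed.

(** With this form a representation is isometric as soon as it respects [mu] and the meet in
    question ([rep_dist]). *)
Lemma dE_mu U V : dE U V = mu U + mu V - mu (emeet U V) *+ 2.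
Proof.
rewrite (rand_dE rand) /symdiff mu_disjoint; last first.
  by rewrite -emeetA [emeet (ecompl V) _]emeetA [emeet (ecompl V) V]emeetC emeetN
    [emeet (ebot P) _]emeetC !emeet0.
by rewrite (mu_split U V) (mu_split V U) [emeet V U]emeetC mulr2n; lra.
Qed.

Lemma mu_dist U V : `|mu U - mu V| <= dE U V. Proof. exact: pre_mu. Qed.

Lemma dE_meet U V W : dE (emeet W U) (emeet W V) <= dE U V.
Proof. by have := pre_meet pre W U W V; rewrite dE_refl add0r. Qed.


(** * Events modulo null sets as subsets of the unit interval *)

Section Representation.
Variable e : nat -> rE P.
Hypothesis e_dense : forall U eps, 0 < eps -> exists n, dE U (e n) < eps.
Notation T := (measurableTypeR R).
Notation pr := (pr (@unif01 R)).

(* Cells are indexed by finite binary sequences with the newest bit first; the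
   cell of s is the Boolean combination of e_0, e_1, ... prescribed by s, and it
   is sent to a subinterval of [0, 1[ whose length is its measure. *)
Fixpoint cell (s : seq bool) : rE P :=
  if s is b :: s' then emeet (cell s') (if b then e (size s') else ecompl (e (size s')))
  else etop P.

Fixpoint left_end (s : seq bool) : R :=
  if s is b :: s' then
    if b then left_end s' else left_end s' + mu (emeet (cell s') (e (size s')))
  else 0.

Definition cell_itv (s : seq bool) : set T :=
  [set t : R | left_end s <= t < left_end s + mu (cell s)].

Lemma cell_itv_nil : cell_itv [::] = [set t : R | 0 <= t < 1].
Proof. by rewrite /cell_itv /= (rand_mu1 rand) add0r. Qed.

Lemma cell_itv_split s :
  cell_itv s = cell_itv (true :: s) `|` cell_itv (false :: s).
Proof.
have p1 := mu_ge0 (cell (true :: s)); have p2 := mu_ge0 (cell (false :: s)).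
rewrite /cell_itv; apply/seteqP.
rewrite /= in p1 p2 *; split=> t /=.
  have [lt|ge] := ltP t (left_end s + mu (emeet (cell s) (e (size s)))).
    by move=> /andP[h _]; left; apply/andP.
  by move=> /andP[_ h]; right; apply/andP; split=> //; rewrite -addrA -mu_split.
have := mu_split (cell s) (e (size s)).
by move=> hs [] /andP[h1 h2]; apply/andP; split; lra.
Qed.

Lemma cell_itv_disjoint s : cell_itv (true :: s) `&` cell_itv (false :: s) = set0.
Proof.
apply/seteqP; split=> // t [/= /andP[_ h1] /andP[h2 _]].
by move: h1 h2; rewrite /= ; lra.
Qed.

Lemma cell_itv_cons b s : cell_itv (b :: s) `<=` cell_itv s.
Proof. by rewrite [cell_itv s]cell_itv_split; case: b => t h; [left|right]. Qed.

Lemma cell_itv_cat w s : cell_itv (w ++ s) `<=` cell_itv s.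
Proof. by elim: w => //= b w IH t /cell_itv_cons/IH. Qed.

Lemma cell_itv_01 s : cell_itv s `<=` [set t : R | 0 <= t < 1].
Proof. by rewrite -cell_itv_nil -[s]cats0; exact: cell_itv_cat. Qed.

Lemma cell_itv_inj s s' t : size s = size s' -> cell_itv s t -> cell_itv s' t -> s = s'.
Proof.
elim: s s' => [|b s IH] [|b' s'] //= [ss'] st s't.
have e0 := IH _ ss' (cell_itv_cons st) (cell_itv_cons s't); subst s'.
have := cell_itv_disjoint s; case: b b' st s't => [] [] // st s't /seteqP[+ _];
  by move=> /(_ t) [].
Qed.

Lemma measurable_cell_itv s : measurable (cell_itv s).
Proof.
have := @measurable_itv R `[left_end s, left_end s + mu (cell s)[.
by congr measurable; apply/seteqP; split=> t /=; rewrite in_itv.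
Qed.

Lemma pr_cell_itv s : pr (cell_itv s) = mu (cell s).
Proof.
have -> : pr (cell_itv s) = fine (lebesgue_measure (cell_itv s `&` `[0, 1[%classic)) by [].
rewrite setIidl; last by move=> t /cell_itv_01; rewrite /= in_itv.
have -> : cell_itv s = `[left_end s, left_end s + mu (cell s)[%classic.
  by apply/seteqP; split=> t /=; rewrite in_itv.
rewrite lebesgue_measure_itv /= lte_fin ltrDl; case: ltP => [m0|m0].
  by rewrite EFinD addeAC subee// add0e.
by apply/eqP; rewrite eq_le m0 mu_ge0.
Qed.

Lemma emeet_cell_cat w s : emeet (cell (w ++ s)) (cell s) = cell (w ++ s).
Proof. by elim: w => /= [|b w IH]; rewrite ?emeetxx// emeetAC IH. Qed.

(** Equal measure inside every cell. This is a relation because [X] is determined only up to a null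
    set. *)
Definition rep U (X : set T) : Prop :=
  measurable X /\ forall s, mu (emeet U (cell s)) = pr (X `&` cell_itv s).

(** A shallow cell is the disjoint union of its two children on both sides, so agreement climbs up
    from depth [k]. *)
Lemma rep_deep U X k : measurable X ->
  (forall s, (k <= size s)%N -> mu (emeet U (cell s)) = pr (X `&` cell_itv s)) -> rep U X.
Proof.
move=> mX h; split=> // s.
have [m] := ubnP (k - size s); elim: m s => // m IH s ltm.
have [ks|sk] := leqP k (size s); first exact: h.
have step b : mu (emeet U (cell (b :: s))) = pr (X `&` cell_itv (b :: s)).
  by apply: IH; rewrite /= subnS; lia.
rewrite (mu_split _ (e (size s))) -!emeetA (step true) (step false).
have mI b : measurable (X `&` cell_itv (b :: s)).
  by apply: measurableI => //; exact: measurable_cell_itv.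
have := prU (@unif01 R) (mI true) (mI false).
by rewrite -setIUr -cell_itv_split setIACA setIid cell_itv_disjoint setI0 pr_set0 subr0.
Qed.

Lemma rep_top : rep (etop P) setT.
Proof.
by split=> // s; rewrite emeetC emeet1 setTI pr_cell_itv.
Qed.

Lemma rep_mu U X : rep U X -> mu U = pr X.
Proof.
move=> [mX /(_ [::])]; rewrite /= emeet1 => ->.
have E (Y : set T) : pr Y = fine (lebesgue_measure (Y `&` `[0, 1[%classic)) by [].
rewrite !E; congr (fine (_ _)); rewrite cell_itv_nil; apply/seteqP; split=> t.
  by move=> [[]].
by move=> [Xt]; rewrite /= in_itv /= => h.
Qed.

Lemma rep_compl U X : rep U X -> rep (ecompl U) (~` X).
Proof.
move=> [mX h]; split=> [|s]; first exact: measurableC.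
have mI := measurable_cell_itv s.
have := mu_split (cell s) U; have := pr_split (@unif01 R) mI mX.
by rewrite pr_cell_itv setIC -h [emeet U _]emeetC [~` X `&` _]setIC [emeet (ecompl U) _]emeetC; lra.
Qed.

Lemma rep_dist U X V Y : rep U X -> rep V Y -> rep (emeet U V) (X `&` Y) ->
  dE U V = pr (X `\` Y) + pr (Y `\` X).
Proof.
move=> /[dup] -[mX _] /rep_mu hX /[dup] -[mY _] /rep_mu hY /rep_mu hXY.
rewrite dE_mu hX hY hXY !setDE (pr_split _ mX mY) (pr_split _ mY mX) [Y `&` X]setIC.
by rewrite mulr2n; lra.
Qed.

Definition bit_set n : set T := \bigcup_(s in [set s | size s = n]) cell_itv (true :: s).

Lemma measurable_bit_set n : measurable (bit_set n).
Proof.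
rewrite /bit_set bigcup_mkcond; apply: countable_bigcupT_measurable => // s.
by case: ifP => // _; exact: measurable_cell_itv.
Qed.

(** Every cell of depth above [n] lies entirely inside [e n] or entirely inside its complement, and
    correspondingly for [bit_set n]. *)
Lemma rep_meet_e U X n : rep U X -> rep (emeet U (e n)) (X `&` bit_set n).
Proof.
move=> [mX h]; apply: (@rep_deep _ _ n.+1) => [|s ns].
  by apply: measurableI => //; exact: measurable_bit_set.
have [w [b [s' [ss' sn]]]] : exists w b s', s = w ++ b :: s' /\ size s' = n.
  have := cat_take_drop (size s - n.+1) s.
  have : size (drop (size s - n.+1) s) = n.+1 by rewrite size_drop; lia.
  case: (drop _ s) => // b s' [sn] ss'.
  by exists (take (size s - n.+1) s), b, s'.
rewrite -emeetA -setIA -sn; case: b ss' => ss'.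
  have -> : emeet (e (size s')) (cell s) = cell s.
    by rewrite ss' -emeet_cell_cat /= ![emeet (cell s') _]emeetC !emeetA [emeet (e _) _]emeetC
      -[emeet (emeet _ (e _)) (e _)]emeetA emeetxx.
  have -> : bit_set (size s') `&` cell_itv s = cell_itv s.
    by apply/setIidr; rewrite ss' => t /cell_itv_cat st; exists s'.
  exact: h.
have -> : emeet (e (size s')) (cell s) = ebot P.
  by rewrite ss' -emeet_cell_cat /= emeetC -emeetA -[emeet (emeet (cell s') _) _]emeetA
    [emeet (ecompl _) _]emeetC emeetN !emeet0.
have -> : bit_set (size s') `&` cell_itv s = set0.
  apply/seteqP; split=> // t [[s'' /= s''s' s''t]]; rewrite ss' => /cell_itv_cat st.
  by have := cell_itv_inj _ s''t st => /=; rewrite s''s' => /(_ erefl).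
by rewrite emeet0 (rand_mu0 rand) setI0 pr_set0.
Qed.

Lemma rep_e n : rep (e n) (bit_set n).
Proof. by have := rep_meet_e n rep_top; rewrite emeetC emeet1 setTI. Qed.

Lemma pr_dist_le (X Y Z : set T) : measurable X -> measurable Y -> measurable Z ->
  `|pr (X `&` Z) - pr (Y `&` Z)| <= pr (X `\` Y) + pr (Y `\` X).
Proof.
move=> mX mY mZ.
have mXZ : measurable (X `&` Z) by exact: measurableI.
have mYZ : measurable (Y `&` Z) by exact: measurableI.
have mD A B : measurable A -> measurable B -> measurable (A `\` B : set T).
  by move=> mA mB; exact: measurableD.
have h A B : measurable A -> measurable B -> pr (A `&` Z) <= pr (B `&` Z) + pr (A `\` B).
  move=> mA mB; have mAZ : measurable (A `&` Z) by exact: measurableI.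
  have mBZ : measurable (B `&` Z) by exact: measurableI.
  rewrite (pr_split _ mAZ mB) lerD// le_pr//.
  - exact: measurableI.
  - by move=> t [[]].
  - by apply: measurableI => //; exact: measurableC.
  - exact: mD.
  - by move=> t [[]].
have h1 := h X Y mX mY; have h2 := h Y X mY mX.
have p1 := pr_ge0 (@unif01 R) (X `\` Y); have p2 := pr_ge0 (@unif01 R) (Y `\` X).
exact: dist_le_add.
Qed.

(** Approximate [V] by some [e n], where the meet is already known. That known meet also gives the
    distance of [V] and [e n] on the side of sets, so both errors stay below half of [eps]. *)
Lemma rep_meet U X V Y : rep U X -> rep V Y -> rep (emeet U V) (X `&` Y).
Proof.
move=> rUX rVY; have [mX hX] := rUX; have [mY hY] := rVY.
split=> [|s]; first exact: measurableI.
apply/eqP; rewrite -subr_eq0 -normr_le0; apply/ler_addgt0Pr => eps eps0.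
have [n Vn] := e_dense V (divr_gt0 eps0 (ltr0n R 2)).
have [mN hN] := rep_meet_e n rUX.
have d1 : `|mu (emeet (emeet U V) (cell s)) - mu (emeet (emeet U (e n)) (cell s))| <= dE V (e n).
  apply: le_trans (mu_dist _ _) _; rewrite -!emeetA; apply: le_trans (dE_meet _ _ _) _.
  by rewrite ![emeet _ (cell s)]emeetC; exact: dE_meet.
have d2 : `|pr (X `&` bit_set n `&` cell_itv s) - pr (X `&` Y `&` cell_itv s)| <= dE V (e n).
  rewrite (rep_dist rVY (rep_e n) (rep_meet_e n rVY)) [leRHS]addrC.
  rewrite -!setIA ![X `&` _]setIC -!setIA.
  apply: pr_dist_le => //; first exact: measurable_bit_set.
  by apply: measurableI => //; exact: measurable_cell_itv.
rewrite add0r; rewrite hN in d1.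
move: d1 d2; rewrite !ler_norml => /andP[a1 a2] /andP[b1 b2]; apply/andP; split; lra.
Qed.

Lemma rep_join U X V Y : rep U X -> rep V Y -> rep (ejoin U V) (X `|` Y).
Proof.
move=> rUX rVY; have [mX hX] := rUX; have [mY hY] := rVY.
have [mXY hXY] := rep_meet rUX rVY.
split=> [|s]; first exact: measurableU.
have mI := measurable_cell_itv s.
rewrite emeetUl setIUl prU; try exact: measurableI.
have := rand_muU rand (emeet U (cell s)) (emeet V (cell s)).
have -> : emeet (emeet U (cell s)) (emeet V (cell s)) = emeet (emeet U V) (cell s).
  by rewrite emeetA [emeet (emeet U _) V]emeetAC -emeetA emeetxx.
have -> : (X `&` cell_itv s) `&` (Y `&` cell_itv s) = X `&` Y `&` cell_itv s.
  by rewrite setIACA setIid.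
by rewrite hX hY hXY; lra.
Qed.

Lemma rep_isometry U X V Y : rep U X -> rep V Y -> dE U V = pr (X `\` Y) + pr (Y `\` X).
Proof. by move=> rU rV; apply: rep_dist => //; exact: rep_meet. Qed.

Lemma rep_limit (u : nat -> rE P) (X : nat -> set T) U Y :
  (forall n, rep (u n) (X n)) -> measurable Y ->
  (forall eps, 0 < eps -> exists N, forall n, (N <= n)%N -> dE (u n) U < eps) ->
  (forall s, (fun n => pr (X n `&` cell_itv s)) @ \oo --> pr (Y `&` cell_itv s)) ->
  rep U Y.
Proof.
move=> ruX mY uU XY; split=> // s.
apply/eqP; rewrite -subr_eq0 -normr_le0; apply/ler_addgt0Pr => eps eps0.
have [N1 h1] := uU _ (divr_gt0 eps0 (ltr0n R 2)).
have /cvgrPdist_lt/(_ _ (divr_gt0 eps0 (ltr0n R 2)))[N2 _ h2] := XY s.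
pose n := maxn N1 N2.
have d1 : `|mu (emeet (u n) (cell s)) - mu (emeet U (cell s))| < eps / 2.
  apply: le_lt_trans (mu_dist _ _) _; rewrite ![emeet _ (cell s)]emeetC.
  by apply: le_lt_trans (dE_meet _ _ _) _; apply: h1; exact: leq_maxl.
have d2 := h2 n (leq_maxr _ _); rewrite /= in d2.
rewrite add0r; have [_ hn] := ruX n; rewrite hn in d1.
move: d1 d2; rewrite ler_norml !ltr_norml => /andP[a1 a2] /andP[b1 b2]; apply/andP; split; lra.
Qed.

Fixpoint partial_join (u : nat -> rE P) n : rE P :=
  if n is n'.+1 then ejoin (partial_join u n') (u n) else u 0%N.

Lemma rep_partial_join (u : nat -> rE P) (X : nat -> set T) n :
  (forall k, rep (u k) (X k)) -> rep (partial_join u n) (\bigcup_(k < n.+1) X k).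
Proof.
move=> ruX; elim: n => [|n IH] /=; first by rewrite bigcup_mkord big_ord1.
by rewrite bigcup_mkord big_ord_recr /= -bigcup_mkord; exact: rep_join.
Qed.

Let completeE : complete_dist (@dE _ _ P). Proof. by case: hP => _ _ []. Qed.

(** Distances between partial joins are increments of a bounded increasing sequence of measures, so
    these joins converge by completeness. The convergence is kept in the conclusion for the estimate
    in [rep_set]. *)
Lemma rep_bigcup (u : nat -> rE P) (X : nat -> set T) :
  (forall k, rep (u k) (X k)) -> exists2 U, rep U (\bigcup_k X k) &
  forall eps, 0 < eps -> exists N, forall n, (N <= n)%N -> dE (partial_join u n) U < eps.
Proof.
move=> ruX; have mX k : measurable (X k) by case: (ruX k).
pose Y n := \bigcup_(k < n.+1) X k.
have rJ n : rep (partial_join u n) (Y n) by exact: rep_partial_join.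
have mY n : measurable (Y n) by case: (rJ n).
have iY n : Y n `<=` Y n.+1.
  by move=> t [k /= kn Xt]; exists k => //=; apply: ltnW.
have leY m n : (m <= n)%N -> Y m `<=` Y n.
  by move=> mn t [k /= km Xt]; exists k => //=; apply: leq_trans km _.
have YX : \bigcup_n Y n = \bigcup_k X k.
  apply/seteqP; split=> t [n _]; first by move=> [k _ Xt]; exists k.
  by move=> Xt; exists n => //; exists n => /=.
have cY := pr_nondecreasing_cvg (P := @unif01 R) mY iY.
have distY i j : (i <= j)%N -> dE (partial_join u i) (partial_join u j) = pr (Y j) - pr (Y i).
  move=> ij; rewrite (rep_isometry (rJ i) (rJ j)).
  have -> : Y i `\` Y j = set0 by apply/seteqP; split=> // t [/leY-/(_ _ ij)].
  rewrite pr_set0 add0r (pr_split _ (mY j) (mY i)) setDE.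
  by rewrite (setIidr (leY _ _ ij)); lra.
have [|U UP] := completeE (u := partial_join u).
  move=> eps eps0; have /cvgrPdist_lt/(_ _ (divr_gt0 eps0 (ltr0n R 2)))[N _ hN] := cY.
  have close i j : (N <= i)%N -> (i <= j)%N -> dE (partial_join u i) (partial_join u j) < eps.
    move=> Ni ij; rewrite distY//.
    exact: (sub_lt_of_dist (hN i Ni) (hN j (leq_trans Ni ij))).
  exists N => i j Ni Nj; have [ij|/ltnW ji] := leqP i j; first exact: close.
  by rewrite dE_sym; exact: close.
exists U => //; apply: (rep_limit rJ) UP _; first exact: bigcupT_measurable.
move=> s; rewrite -YX setI_bigcupl; apply: pr_nondecreasing_cvg => n.
  by apply: measurableI => //; exact: measurable_cell_itv.
by apply: setSI; exact: iY.
Qed.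

Lemma cell_path (t : R) : 0 <= t < 1 -> exists p : nat -> seq bool,
  [/\ forall n, size (p n) = n, forall n, cell_itv (p n) t &
      forall n, exists b, p n.+1 = b :: p n].
Proof.
move=> t01; pose b s := `[< cell_itv (true :: s) t >].
exists (fun n => iter n (fun s => b s :: s) [::]); split.
- by elim=> //= n ->.
- elim=> [|n IH] /=; first by rewrite cell_itv_nil.
  move: (iter n _ _) IH => s st; rewrite {1}/b; case: asboolP => // nt.
  by move: st; rewrite cell_itv_split => -[].
- by move=> n; eexists.
Qed.

(** Otherwise the cells around [t] have measures with infimum c at least [eps]. Take such a cell [W]
    of measure nearly c, halve it by atomlessness and approximate the half by some [e n]. A cell
    around [t] deeper than [n] lies in one of the two parts of [W] and has measure near c/2, a
    contradiction. *)
Lemma small_cell (t : R) eps : 0 <= t < 1 -> 0 < eps ->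
  exists2 s, cell_itv s t & mu (cell s) < eps.
Proof.
move=> t01 eps0; apply: contrapT => nsmall.
have [p [sp pt pS]] := cell_path t01.
have big n : eps <= mu (cell (p n)).
  by rewrite leNgt; apply/negP => lt; apply: nsmall; exists (p n).
have pcat m n : (m <= n)%N -> exists w, p n = w ++ p m.
  elim: n => [|n IH]; first by rewrite leqn0 => /eqP ->; exists [::].
  rewrite leq_eqVlt => /predU1P[->|]; first by exists [::].
  by rewrite ltnS => /IH[w pw]; have [b ->] := pS n; exists (b :: w); rewrite pw.
pose S := [set mu (cell (p n)) | n in [set: nat]].
have hS : has_inf S.
  by split; [exists (mu (cell (p 0%N))), 0%N|exists eps => _ [n _ <-]].
have c0 : eps <= inf S by apply: lb_le_inf; [exists (mu (cell (p 0%N))), 0%N|move=> _ [n _ <-]].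
set c := inf S in c0.
(* Errors d in the infimum, the halving and the approximation give c < c/2 + 5d/2, which is false
   for d = [eps / 10]. *)
have d0 : 0 < eps / 10 by rewrite divr_gt0// ltr0n.
have [_ [n0 _ <-] ltn0] := inf_adherent d0 hS.
pose W := cell (p n0).
have [V hV] := rand_atomless rand W d0.
have [n Vn] := e_dense V d0.
pose N := maxn n0 n.+1.
have [w pw] := pcat n0 N (leq_maxl _ _).
have [w' pw'] := pcat n.+1 N (leq_maxr _ _).
have [b pb] := pS n.
have cN : c <= mu (cell (p N)) by apply: ge_inf; [case: hS|exists N].
have WN : emeet (cell (p N)) W = cell (p N) by rewrite pw emeet_cell_cat.
have close : `|mu (emeet W V) - mu (emeet W (e n))| <= eps / 10.
  by apply: le_trans (mu_dist _ _) _; apply: le_trans (dE_meet _ _ _) _; exact: ltW.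
have NB : emeet (cell (p N)) (cell (b :: p n)) = cell (p N).
  by rewrite pw' -pb emeet_cell_cat.
move: hV close; rewrite ltr_norml ler_norml => /andP[a1 a2] /andP[b1 b2].
rewrite -/c -/W in ltn0; have W2 : W = cell (p n0) by [].
case: b pb NB => pb NB.
  have Ne : emeet (cell (p N)) (e n) = cell (p N).
    by rewrite -{1}NB /= sp !emeetA -[emeet (emeet _ (e n)) (e n)]emeetA emeetxx -emeetA -[RHS]NB /= sp.
  have : mu (cell (p N)) <= mu (emeet W (e n)).
    rewrite -{1}Ne -{1}WN -emeetA [emeet (cell (p N)) _]emeetC; exact: mu_meet_le.
  by lra.
have Ne : emeet (cell (p N)) (e n) = ebot P.
  by rewrite -{1}NB /= sp -!emeetA [emeet (ecompl _) _]emeetC emeetN !emeet0.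
have : mu (emeet W (e n)) + mu (cell (p N)) <= mu W.
  rewrite (mu_split W (e n)) lerD2l.
  have -> : cell (p N) = emeet (emeet W (ecompl (e n))) (cell (p N)).
    rewrite emeetAC [emeet W _]emeetC WN.
    by rewrite -{1}[cell (p N)]emeet1 -(ejoinN (e n)) emeetUr Ne ejoinC ejoin0.
  exact: mu_meet_le.
by lra.
Qed.

Lemma rep_cell s : rep (cell s) (cell_itv s).
Proof.
elim: s => [|b s IH].
  split=> [|s]; first exact: measurable_cell_itv.
  rewrite /= emeetC emeet1 cell_itv_nil setIidr ?pr_cell_itv//.
  exact: cell_itv_01.
have re : rep (if b then e (size s) else ecompl (e (size s)))
              (if b then bit_set (size s) else ~` bit_set (size s)).
  by case: b; [|apply: rep_compl]; exact: rep_e.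
suff <- : cell_itv s `&` (if b then bit_set (size s) else ~` bit_set (size s)) = cell_itv (b :: s).
  exact: rep_meet.
have inj b' b'' s'' t : size s'' = size s -> cell_itv (b'' :: s'') t -> cell_itv (b' :: s) t ->
    b'' :: s'' = b' :: s.
  by move=> ss; apply: cell_itv_inj; rewrite /= ss.
clear re; apply/seteqP; split=> t.
  case: b => -[st].
    move=> [s'' /= s''s' s''t]; move: st; rewrite cell_itv_split => -[//|st].
    by have := inj _ _ _ _ s''s' s''t st.
  move=> nb; move: st; rewrite cell_itv_split => -[st|//].
  by exfalso; apply: nb; exists s.
move=> bt; split; first exact: cell_itv_cons bt.
case: b bt => bt; first by exists s.
move=> [s'' /= s''s' s''t].
by have := inj _ _ _ _ s''s' s''t bt.
Qed.

(** Within [0, 1) the ray is the union of the cells that it contains, as every point has arbitrarily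
    short cells. *)
Lemma rep_ray (x : R) : exists U, rep U [set t : R | t < x].
Proof.
pose X s := if pselect (cell_itv s `<=` [set t : R | t < x]) then cell_itv s else set0.
have repX s : exists U, rep U (X s).
  rewrite /X; case: pselect => h; last first.
    exists (ecompl (etop P)); rewrite -setCT; apply: rep_compl; exact: rep_top.
  by exists (cell s); exact: rep_cell.
have [u uX] := choice repX.
have [g gS] := countable_enum (@countableP (seq bool) setT) (inhabits [::]).
have [U [mU hU] _] := @rep_bigcup (fun n => u (g n)) (fun n => X (g n)) (fun n => uX (g n)).
exists U; split=> [|s].
  by have := @measurable_itv R `]-oo, x[; congr measurable; apply/seteqP; split=> t /=; rewrite in_itv.
rewrite hU; congr (pr _); apply/seteqP; split=> t [ut st]; split=> //.
  case: ut => n _; rewrite /X; case: pselect => // h; exact: h.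
have [|s' s't small] := @small_cell t (x - t) (cell_itv_01 st); first by rewrite subr_gt0.
have [n gn] := gS s'; exists n => //; rewrite gn /X; case: pselect => // -[] r /= /andP[_ rs'].
by move: s't => /= /andP[ls' _]; move: (ut) => /=; lra.
Qed.

(** The represented sets form a sigma-algebra that contains the rays. *)
Theorem rep_event (X : set T) : measurable X -> exists U, rep U X.
Proof.
move=> mX; suff : [set X | exists U, rep U X] X by [].
have : <<s @RGenInftyO.G R >> X.
  exact: (eq_ind _ (fun C : set (set R) => C X) mX _ (@RGenInftyO.measurableE R)).
apply: (smallest_sub (X := [set X | exists U, rep U X])) => [|_ [x ->]]; last first.
  have [U rU] := rep_ray x; exists U.
  suff -> : `]-oo, x[%classic = [set t : R | t < x] by [].
  by apply/seteqP; split=> t /=; rewrite in_itv.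
split=> [|A [U rU]|A].
- by exists (ecompl (etop P)); rewrite -setCT; apply: rep_compl; exact: rep_top.
- by exists (ecompl U); rewrite setTD; exact: rep_compl.
- by move=> /choice[u uA]; have [U rU _] := rep_bigcup uA; exists U.
Qed.

(** A Borel-Cantelli argument: choose members of the dense sequence at distance below 2^-k from [U];
    the upper limit of their sets represents [U]. *)
Theorem rep_set U : exists X, rep U X.
Proof.
have h k : exists n, dE (e n) U < (2^-1) ^+ k.
  have p0 : 0 < (2^-1 : R) ^+ k by rewrite exprn_gt0// invr_gt0.
  have [n hn] := e_dense U p0.
  by exists n; rewrite dE_sym.
have [n hn] := choice h.
pose v m k := e (n (m + k)%N); pose Y m := \bigcup_k bit_set (n (m + k)%N).
have /choice[a aP] : forall m, exists a, rep a (Y m) /\ dE a U <= 2 * (2^-1) ^+ m.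
  move=> m; have [a ra alim] := @rep_bigcup (v m) (fun k => bit_set (n (m + k)%N)) (fun k => rep_e _).
  exists a; split=> //; apply/ler_addgt0Pr => eps eps0.
  have [N /(_ N (leqnn _)) hN] := alim _ eps0.
  (* The exact value of the finite geometric sum, which carries the induction. *)
  have bound j : dE (partial_join (v m) j) U <= 2 * (2^-1) ^+ m - (2^-1) ^+ (m + j).
    elim: j => [|j IH] /=.
      by have := hn (m + 0)%N; rewrite /v addn0; lra.
    have := pre_join pre (partial_join (v m) j) (v m j.+1) U U; rewrite ejoinxx.
    have := hn (m + j.+1)%N; rewrite -/(v m j.+1) addnS exprS; lra.
  have := bound N; have := dE_triangle a (partial_join (v m) N) U; rewrite dE_sym in hN.
  have : 0 <= (2^-1 : R) ^+ (m + N) by rewrite exprn_ge0// invr_ge0.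
  by lra.
exists (\bigcap_m Y m).
have mY m : measurable (Y m) by case: (aP m) => -[].
apply: (@rep_limit a Y) => [m|||s].
- by case: (aP m).
- exact: bigcapT_measurable.
- move=> eps eps0.
  have : (fun k => 2 * (2^-1 : R) ^+ k) @ \oo --> (2 * 0 : R).
    apply: cvgM; first exact: cvg_cst.
    by apply: cvg_expr; rewrite ger0_norm; lra.
  rewrite mulr0 => /cvgrPdist_lt/(_ _ eps0)[N _ hN].
  exists N => k Nk; have := hN k Nk; rewrite /= sub0r normrN.
  by have [_ ha] := aP k; rewrite ger0_norm; [apply: le_lt_trans|rewrite mulr_ge0// exprn_ge0// invr_ge0].
- have -> : \bigcap_m Y m `&` cell_itv s = \bigcap_m (Y m `&` cell_itv s).
    apply/seteqP; split=> [t [Yt st] m _|t Yst]; first by split=> //; exact: Yt.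
    by split=> [m _|]; [have [] := Yst m Logic.I|have [] := Yst 0%N Logic.I].
  apply: pr_nonincreasing_cvg => m.
    by apply: measurableI => //; exact: measurable_cell_itv.
  apply: setSI => t [k _ kt]; exists k.+1 => //.
  by rewrite addnS -addSn.
Qed.

End Representation.

Record event_representation (rep : rE P -> set (measurableTypeR R) -> Prop) : Prop :=
  EventRepresentation {
  er_measurable : forall U X, rep U X -> measurable X;
  er_top : rep (etop P) setT;
  er_compl : forall U X, rep U X -> rep (ecompl U) (~` X);
  er_meet : forall U X V Y, rep U X -> rep V Y -> rep (emeet U V) (X `&` Y);
  er_join : forall U X V Y, rep U X -> rep V Y -> rep (ejoin U V) (X `|` Y);
  er_mu : forall U X, rep U X -> mu U = pr (@unif01 R) X;
  er_isometry : forall U X V Y, rep U X -> rep V Y ->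
    dE U V = pr (@unif01 R) (X `\` Y) + pr (@unif01 R) (Y `\` X);
  er_event : forall X, measurable X -> exists U, rep U X;
  er_set : forall U, exists X, rep U X }.

Theorem event_representation_exists : exists rep, event_representation rep.
Proof.
have [D [cD dD]] := sepE.
have [g gD] : exists g : nat -> rE P, D = range g.
  by apply: countable_set_enum => //; have [y Dy _] := dD (etop P) 1 ltr01; exists y.
have e_dense U eps : 0 < eps -> exists n, dE U (g n) < eps.
  by move=> /(dD U)[y]; rewrite gD => -[n _ <-]; exists n.
exists (rep g); split.
- by move=> U X [].
- exact: rep_top.
- exact: rep_compl.
- by move=> U X V Y; exact: rep_meet.
- by move=> U X V Y; exact: rep_join.
- exact: rep_mu.
- by move=> U X V Y; exact: rep_isometry.
- exact: rep_event.
- exact: rep_set.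
Qed.

End EventAlgebra.

(** * The random structure of a randomization *)

Section RandomStructure.
Variables (R : realType) (L : signature) (P : LR_prestructure R L).
Hypothesis hL : countable_signature L.
Hypothesis hP : is_complete_randomization P.
Notation T := (measurableTypeR R).
Notation pr := (pr (@unif01 R)).
Variable rep : rE P -> set T -> Prop.
Hypothesis hrep : event_representation rep.

Let rand : is_randomization P. Proof. by case: hP. Qed.
Let pre : is_prestructure P. Proof. exact: rand_pre. Qed.
Let sep_dE : separated (@dE _ _ P). Proof. by case: hP => _ []. Qed.

Notation "\ae t , Q" := (\forall t \ae (@unif01 R), Q)
  (at level 200, t name, Q at level 200).

Lemma dist0_ae (X Y : set T) : measurable X -> measurable Y ->
  pr (X `\` Y) + pr (Y `\` X) = 0 <-> \ae t, (X t <-> Y t).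
Proof.
move=> mX mY; have mXY : measurable (X `\` Y) by exact: measurableD.
have mYX : measurable (Y `\` X) by exact: measurableD.
split=> [/eqP|aeXY].
  rewrite paddr_eq0 ?pr_ge0// => /andP[/eqP/(pr_eq0 _ mXY) h1 /eqP/(pr_eq0 _ mYX) h2].
  apply: filterS2 (ae_null mXY h1) (ae_null mYX h2) => t nXY nYX.
  by split=> h; apply: contrapT => h'; [apply: nXY|apply: nYX].
rewrite (proj2 (pr_eq0 _ mXY)) ?(proj2 (pr_eq0 _ mYX)) ?addr0//.
  by apply: null_ae => //; apply: filterS aeXY => t [_ YX] [/YX].
by apply: null_ae => //; apply: filterS aeXY => t [XY _] [/XY].
Qed.

Lemma rep_ae_iff U X Y : rep U X -> rep U Y -> \ae t, (X t <-> Y t).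
Proof.
move=> rX rY; apply/dist0_ae; [exact: er_measurable rX|exact: er_measurable rY|].
by rewrite -(er_isometry hrep rX rY); have [h _ _ _] := pre_dE pre.
Qed.

Lemma rep_eq U V X Y : rep U X -> rep V Y -> (\ae t, (X t <-> Y t)) -> U = V.
Proof.
move=> rX rY XY; apply: sep_dE; rewrite (er_isometry hrep rX rY); apply/dist0_ae => //;
  [exact: er_measurable rX|exact: er_measurable rY].
Qed.

Lemma rep_ae U X Y : rep U X -> measurable Y -> (\ae t, (X t <-> Y t)) -> rep U Y.
Proof.
move=> rX mY XY; have [V rV] := er_event hrep mY.
by rewrite (rep_eq rX rV XY).
Qed.

Lemma rep_ele U V X Y : rep U X -> rep V Y -> ele U V <-> \ae t, (X t -> Y t).
Proof.
move=> rX rY; have rXY := er_meet hrep rX rY; rewrite /ele; split=> [UV|XY].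
  by rewrite UV in rXY; apply: filterS (rep_ae_iff rXY rX) => t [_ h] /h[].
by apply: (rep_eq rXY rX); apply: filterS XY => t h; split=> [[]//|Xt]; split=> //; exact: h.
Qed.

(** The union of an uncountable family could fail to be measurable; a countable subfamily that
    almost surely absorbs every member computes the supremum instead. *)
Lemma rep_esup (S : set (rE P)) (u : nat -> rE P) (X : nat -> set T) U :
  (forall k, S (u k)) -> (forall k, rep (u k) (X k)) ->
  (forall W, S W -> exists2 Y, rep W Y & \ae t, (Y t -> (\bigcup_k X k) t)) ->
  is_esup S U -> rep U (\bigcup_k X k).
Proof.
move=> Su uX SX [ub lub]; have mX k : measurable (X k) := er_measurable hrep (uX k).
have mXX : measurable (\bigcup_k X k) by exact: bigcupT_measurable.
have [V rV] := er_event hrep mXX; have [Y rY] := er_set hrep U.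
have UV : ele U V.
  by apply: lub => W /SX[Z rZ ZX]; apply/(rep_ele rZ rV).
have : \ae t, forall k, X k t -> Y t.
  by apply: ae_foralln => k; apply/(rep_ele (uX k) rY); exact: ub.
move/(rep_ele rY rV): UV => YX XY; suff -> : U = V by [].
apply: (rep_eq rY rV); apply: filterS2 YX XY => t YX XY; split=> // -[k _].
exact: XY.
Qed.

(** An arbitrary representative, so the Boolean identities hold for it only almost surely, event by
    event. *)
Definition bset (U : rE P) : set T := sval (cid (er_set hrep U)).
Lemma rep_bset U : rep U (bset U). Proof. by rewrite /bset; case: cid. Qed.
Lemma measurable_bset U : measurable (bset U). Proof. exact: er_measurable (rep_bset U). Qed.

Lemma bset_top : \ae t, bset (etop P) t.
Proof.
by apply: filterS (rep_ae_iff (rep_bset _) (er_top hrep)) => t [_]; apply.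
Qed.

Lemma bset_compl U : \ae t, (bset (ecompl U) t <-> ~ bset U t).
Proof. exact: (rep_ae_iff (rep_bset _) (er_compl hrep (rep_bset U))). Qed.

Lemma bset_join U V : \ae t, (bset (ejoin U V) t <-> bset U t \/ bset V t).
Proof. exact: (rep_ae_iff (rep_bset _) (er_join hrep (rep_bset U) (rep_bset V))). Qed.

Lemma ev_valid n (th : fo_form L n) f : valid th -> ev th f = etop P.
Proof. by move=> v; apply: sep_dE; exact: rand_valid. Qed.
Lemma ev_neg n (th : fo_form L n) (f : 'I_n -> rK P) : ev (Neg th) f = ecompl (ev th f).
Proof. by apply: sep_dE; exact: rand_neg. Qed.
Lemma ev_or n (th1 th2 : fo_form L n) (f : 'I_n -> rK P) :
  ev (Or th1 th2) f = ejoin (ev th1 f) (ev th2 f).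
Proof. by apply: sep_dE; exact: rand_or. Qed.
Lemma ev_rename n m (th : fo_form L n) (rho : 'I_n -> 'I_m) (f : 'I_m -> rK P) :
  ev (subst th (fun i => Var (rho i))) f = ev th (f \o rho).
Proof. by apply: sep_dE; exact: rand_rename. Qed.

Lemma bset_Imps n k (F : 'I_k -> fo_form L n) (b : fo_form L n) f :
  \ae t, (bset (ev (Imps F b) f) t -> (forall i, bset (ev (F i) f) t) -> bset (ev b f) t).
Proof.
elim: k F => [|k IH] F /=; first by apply: nearW.
rewrite /Imp ev_or ev_neg.
apply: filterS3 (bset_join _ _) (bset_compl (ev (F ord0) f)) (IH (fun i => F (lift ord0 i))) => t hj hc hI.
by move=> /hj[/hc//|h] Fi; apply: hI => // i; exact: Fi.
Qed.

Lemma bset_consequence n k (F : 'I_k -> fo_form L n) (b : fo_form L n) f :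
  (forall (M : structure L) (v : 'I_n -> M), (forall i, sat (F i) v) -> sat b v) ->
  \ae t, ((forall i, bset (ev (F i) f) t) -> bset (ev b f) t).
Proof.
move=> Fb; have e : ev (Imps F b) f = etop P.
  by apply: ev_valid => M v; apply/sat_Imps; exact: Fb.
by have := bset_Imps F b f; rewrite e; apply: filterS2 bset_top => t top; apply.
Qed.

(** With [f] and [g] concatenated into one tuple, congruence is a logical consequence with the
    equations as premises. *)
Lemma bset_congr n (th : fo_form L n) (f g : 'I_n -> rK P) :
  \ae t, ((forall i, bset (ev (eq_form L) (pair_val (f i) (g i))) t) ->
          (bset (ev th f) t <-> bset (ev th g) t)).
Proof.
pose fg : 'I_(n + n) -> rK P :=
  fun i => match fintype.split i with inl j => f j | inr j => g j end.
have fgl : fg \o @lshift n n = f.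
  by apply: funext => i; rewrite /fg /= (unsplitK (inl i : 'I_n + 'I_n)).
have fgr : fg \o @rshift n n = g.
  by apply: funext => i; rewrite /fg /= (unsplitK (inr i : 'I_n + 'I_n)).
pose th1 := subst th (fun i => Var (@lshift n n i)).
pose th2 := subst th (fun i => Var (@rshift n n i)).
pose E i : fo_form L (n + n) := Eq (Var (lshift n i)) (Var (rshift n i)).
have evE i : ev (E i) fg = ev (eq_form L) (pair_val (f i) (g i)).
  have -> : E i = subst (eq_form L) (fun j => Var (pair_val (lshift n i) (rshift n i) j)).
    by rewrite /= pair_val0 pair_val1.
  by rewrite ev_rename comp_pair_val -fgl -fgr.
have ev1 : ev th1 fg = ev th f by rewrite /th1 ev_rename fgl.
have ev2 : ev th2 fg = ev th g by rewrite /th2 ev_rename fgr.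
have vE (M : structure L) (v : 'I_(n + n) -> M) : (forall i, sat (E i) v) ->
    (fun i => v (lshift n i)) = (fun i => v (rshift n i)).
  by move=> Ev; apply: funext.
have c1 := @bset_consequence _ n.+1 (scons th1 E) th2 fg _.
have c2 := @bset_consequence _ n.+1 (scons th2 E) th1 fg _.
apply: filterS2 (c1 _) (c2 _) => [t h1 h2 hE|M v hv|M v hv].
- rewrite -ev1 -ev2; split=> h; [apply: h1|apply: h2] => i;
    by case: (unliftP ord0 i) => [j ->|->]; rewrite ?sconsS ?scons0 ?evE.
- have := hv ord0; rewrite scons0 => /sat_subst /= h; apply/sat_subst => /=.
  by rewrite -vE// => i; have := hv (lift ord0 i); rewrite sconsS.
- have := hv ord0; rewrite scons0 => /sat_subst /= h; apply/sat_subst => /=.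
  by rewrite vE// => i; have := hv (lift ord0 i); rewrite sconsS.
Qed.

Lemma ev_witness_le n (th : fo_form L n.+1) g f :
  \ae t, (bset (ev th (scons g f)) t -> bset (ev (Ex th) f) t).
Proof.
pose th' := subst (Ex th) (fun i => Var (lift ord0 i)).
have ev' : ev th' (scons g f) = ev (Ex th) f.
  by rewrite /th' ev_rename; congr ev; apply: funext => i /=; rewrite sconsS.
have := @bset_consequence _ 1 (fun=> th) th' (scons g f) _.
rewrite ev' => h; apply: filterS (h _) => [t|M v /(_ ord0) hv]; first by move=> h' ?; exact: h'.
apply/sat_subst; exists (v ord0).
by rewrite -(scons_eta v).
Qed.

Variable k : nat -> rK P.
Hypothesis k_dense : forall f eps, 0 < eps -> exists n, dK f (k n) < eps.

Lemma dK_refl (f : rK P) : dK f f = 0. Proof. by have [h _ _ _] := pre_dK pre; exact: h. Qed.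

Lemma pr_bset_diff U V : pr (bset U `\` bset V) <= dE U V.
Proof. by rewrite (er_isometry hrep (rep_bset U) (rep_bset V)) lerDl pr_ge0. Qed.

Lemma small_null (X : set T) : measurable X -> (forall eps, 0 < eps -> pr X < eps) ->
  \ae t, ~ X t.
Proof.
move=> mX sX; apply: ae_null => //; apply/(pr_eq0 _ mX)/eqP.
rewrite eq_le pr_ge0 andbT; apply/ler_addgt0Pr => eps eps0.
by rewrite add0r ltW// sX.
Qed.

(** A witness exists up to any error by [rand_full] and may be moved into the dense sequence by the
    Lipschitz bound. Hence the part of the event without a witness among the [k j] is smaller than
    every positive number. *)
Lemma ev_witness n (th : fo_form L n.+1) f :
  \ae t, (bset (ev (Ex th) f) t <-> exists j, bset (ev th (scons (k j) f)) t).
Proof.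
have le : \ae t, forall j, bset (ev th (scons (k j) f)) t -> bset (ev (Ex th) f) t.
  by apply: ae_foralln => j; exact: ev_witness_le.
pose Y := \bigcup_j bset (ev th (scons (k j) f)).
have mY : measurable Y by apply: bigcupT_measurable => j; exact: measurable_bset.
have mD : measurable (bset (ev (Ex th) f) `\` Y).
  by apply: measurableD => //; exact: measurable_bset.
have : \ae t, ~ (bset (ev (Ex th) f) `\` Y) t.
  apply: small_null => // eps eps0.
  have e20 : 0 < eps / 2 by rewrite divr_gt0.
  have [g hg] := rand_full rand th f e20.
  have [j hj] := k_dense g e20.
  have hev := pre_ev pre th (scons g f) (scons (k j) f).
  have : dE (ev th (scons g f)) (ev th (scons (k j) f)) < eps / 2.
    apply: le_lt_trans hev _; rewrite big_ord_recl !scons0 big1 ?addr0// => i _.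
    by rewrite !sconsS dK_refl.
  have [_ symE triE _] := pre_dE pre.
  have := triE (ev (Ex th) f) (ev th (scons g f)) (ev th (scons (k j) f)).
  move=> tri lt2.
  have lt : dE (ev (Ex th) f) (ev th (scons (k j) f)) < eps.
    by apply: le_lt_trans tri _; rewrite [ltRHS]splitr; apply: ltrD => //; rewrite symE.
  apply: le_lt_trans lt; apply: le_trans (pr_bset_diff _ _).
  apply: le_pr => //; first by apply: measurableD; exact: measurable_bset.
  by move=> t [Xt nY]; split=> // h; apply: nY; exists j.
apply: filterS2 le => t le nXY; split=> [Xt|[j]]; last exact: le.
by apply: contrapT => nj; apply: nXY; split=> // -[j _ h]; apply: nj; exists j.
Qed.

Definition bval (t : T) n (th : fo_form L n) (d : 'I_n -> nat) : Prop :=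
  bset (ev th (k \o d)) t.

Lemma ae_henkin : \ae t, henkin_theory (@bval t).
Proof.
have cd n : countable [set: 'I_n -> nat] by exact/countable_ord_fun/countableP.
have cT n : countable [set: fo_form L n * ('I_n -> nat)].
  by rewrite -setXTT; apply: countableX => //; exact: countable_fo_form.
have c1 : \ae t, forall (x : {n & (fo_form L n * ('I_n -> nat))%type}),
    valid (projT2 x).1 -> bval t (projT2 x).1 (projT2 x).2.
  apply: ae_countable => [|[n [th d]] /=]; first by apply: countable_sigT => //; exact: countableP.
  have [v|nv] := pselect (valid th); last by apply: nearW.
  by rewrite /bval ev_valid//; apply: filterS bset_top.
have c2 : \ae t, forall (x : {n & (fo_form L n * ('I_n -> nat))%type}),
    bval t (Neg (projT2 x).1) (projT2 x).2 <-> ~ bval t (projT2 x).1 (projT2 x).2.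
  apply: ae_countable => [|[n [th d]] /=]; first by apply: countable_sigT => //; exact: countableP.
  by rewrite /bval ev_neg; exact: bset_compl.
have c3 : \ae t, forall (x : {n & (fo_form L n * (fo_form L n * ('I_n -> nat)))%type}),
    bval t (Or (projT2 x).1 (projT2 x).2.1) (projT2 x).2.2 <->
    bval t (projT2 x).1 (projT2 x).2.2 \/ bval t (projT2 x).2.1 (projT2 x).2.2.
  apply: ae_countable => [|[n [th1 [th2 d]]] /=].
    apply: countable_sigT => [|n]; first exact: countableP.
    by rewrite -setXTT; apply: countableX => //; exact: countable_fo_form.
  by rewrite /bval ev_or; exact: bset_join.
have c4 : \ae t, forall (x : {n & (fo_form L n.+1 * ('I_n -> nat))%type}),
    bval t (Ex (projT2 x).1) (projT2 x).2 <->
    exists j, bval t (projT2 x).1 (scons j (projT2 x).2).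
  apply: ae_countable => [|[n [th d]] /=].
    apply: countable_sigT => [|n]; first exact: countableP.
    by rewrite -setXTT; apply: countableX => //; exact: countable_fo_form.
  apply: filterS (ev_witness th (k \o d)) => t.
  by rewrite /bval => h; split=> [/h[j hj]|[j hj]]; [exists j|apply/h; exists j];
    move: hj; rewrite comp_scons.
apply: filterS2 (filterI c1 c2) (filterI c3 c4) => t [h1 h2] [h3 h4]; split.
- by move=> n th d; exact: (h1 (existT _ n (th, d))).
- by move=> n m th rho d; rewrite /bval ev_rename.
- by move=> n th d; exact: (h2 (existT _ n (th, d))).
- by move=> n th1 th2 d; exact: (h3 (existT _ n (th1, (th2, d)))).
- by move=> n th d; exact: (h4 (existT _ n (th, d))).
Qed.

(** Filler for the exceptional null set, so that the family is defined and measurable everywhere. *)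
Definition trivial_structure : structure L :=
  @Structure L unit (inhabits tt) (fun _ _ => False) (fun _ _ => tt).

Lemma pointwise_structures : exists (N : T -> structure L) (nm : forall t, nat -> N t),
  measurable_family nm /\
  \ae t, forall n (th : fo_form L n) d, sat th (nm t \o d) <-> bval t th d.
Proof.
have [G [mG G0 GH]] := ae_measurable ae_henkin.
pose triv : {M : structure L & nat -> M} := existT _ trivial_structure (fun=> tt).
have h t : exists Mn : {M : structure L & nat -> M},
    [/\ forall x, exists i, projT2 Mn i = x,
        G t -> forall n (th : fo_form L n) d, sat th (projT2 Mn \o d) <-> bval t th d
      & ~ G t -> Mn = triv].
  have [Gt|nGt] := pselect (G t); last first.
    by exists triv; split=> //= -[]; exists 0%N.
  by have [M [nm [nmS nmP]]] := henkin_model (GH _ Gt); exists (existT _ M nm).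
have [Mn MnP] := choice h.
exists (fun t => projT1 (Mn t)), (fun t => projT2 (Mn t)); split.
  split=> [t|n th d]; first by have [] := MnP t.
  rewrite [X in measurable X](_ : _ = (G `&` bset (ev th (k \o d))) `|`
      (~` G `&` [set _ | sat th (projT2 triv \o d)])).
    apply: measurableU; apply: measurableI => //; first exact: measurable_bset.
      exact: measurableC.
    exact: measurable_const.
  apply/seteqP; split=> t /=; have [_ GP nGP] := MnP t.
    have [Gt|nGt] := pselect (G t); first by move/(GP Gt); left.
    by rewrite (nGP nGt); right.
  by case=> [[Gt /(GP Gt)]//|[nGt]]; rewrite (nGP nGt).
have : \ae t, ~ (~` G) t by apply: ae_null => //; exact: measurableC.
by apply: filterS => t /contrapT Gt; have [_ GP _] := MnP t; exact: GP.
Qed.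

Variables (N : T -> structure L) (nm : forall t, nat -> N t).
Hypothesis hN : measurable_family nm.
Hypothesis hNval : \ae t, forall n (th : fo_form L n) d, sat th (nm t \o d) <-> bval t th d.

Definition name (f : rK P) (t : T) : nat :=
  least (fun j => bset (ev (eq_form L) (pair_val f (k j))) t).

Lemma measurable_name_of f : discrete_measurable_map (name f).
Proof. by apply: discrete_measurable_least => j; exact: measurable_bset. Qed.

Lemma dK_mu (f g : rK P) : dK f g = mu (ecompl (ev (eq_form L) (pair_val f g))).
Proof.
rewrite (rand_dK rand) -ev_neg; congr (mu (ev _ _)).
Qed.

(** If [k j] is within [eps] of [f], the two differ on an event of measure below [eps]; so the
    points where [f] equals no [k j] form a null set. *)
Lemma ae_name f : \ae t, bset (ev (eq_form L) (pair_val f (k (name f t)))) t.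
Proof.
pose Y := \bigcup_j bset (ev (eq_form L) (pair_val f (k j))).
have mY : measurable Y by apply: bigcupT_measurable => j; exact: measurable_bset.
have : \ae t, ~ (~` Y) t.
  apply: small_null; first exact: measurableC.
  move=> eps eps0; have [j hj] := k_dense f eps0.
  apply: le_lt_trans hj; rewrite dK_mu.
  rewrite (er_mu hrep (er_compl hrep (rep_bset _))); apply: le_pr.
  - exact: measurableC.
  - by apply: measurableC; exact: measurable_bset.
  - by apply: subsetC => t h; exists j.
apply: filterS => t /contrapT[j _ h].
by apply: (@leastP (fun j => bset (ev (eq_form L) (pair_val f (k j))) t)); exists j.
Qed.

Definition names_at n (f : 'I_n -> rK P) (t : T) : 'I_n -> nat := fun i => name (f i) t.

Lemma measurable_names_at n (f : 'I_n -> rK P) : discrete_measurable_map (names_at f).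
Proof.
move=> d; rewrite [X in measurable X](_ : _ = ~` \bigcup_i ~` [set t | name (f i) t = d i]).
  apply: measurableC; apply: countable_bigcupT_measurable => [|i]; first exact: countableP.
  by apply: measurableC; exact: measurable_name_of.
apply/seteqP; split=> t /= h; first by move=> [i _]; rewrite /= -h.
by apply: funext => i; apply: contrapT => ne; apply: h; exists i.
Qed.

Definition truth n (psi : inf_form L n) (f : 'I_n -> rK P) : set T :=
  [set t | sat psi (nm t \o names_at f t)].

Lemma measurable_truth n (psi : inf_form L n) f : measurable (truth psi f).
Proof.
apply: (discrete_measurable_pred (A := fun d => truth_set nm psi d)
  _ (measurable_names_at f)).
  exact/countable_ord_fun/countableP.
by move=> d; exact: (measurable_truth_set hN).
Qed.

Lemma rep_truth n (th : fo_form L n) f : rep (ev th f) (truth (fo_inf th) f).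
Proof.
apply: (rep_ae (rep_bset _)); first exact: measurable_truth.
(* The names of [f] vary with [t], so congruence is secured for all tuples [d] at once before [d] is
   specialized. *)
have cong : \ae t, forall d : 'I_n -> nat,
    (forall i, bset (ev (eq_form L) (pair_val (f i) (k (d i)))) t) ->
    (bset (ev th f) t <-> bset (ev th (k \o d)) t).
  apply: ae_countable => [|d]; last exact: bset_congr.
  exact/countable_ord_fun/countableP.
have aen : \ae t, forall i, bset (ev (eq_form L) (pair_val (f i) (k (name (f i) t)))) t.
  by apply: ae_countable => [|i]; [exact: countableP|exact: ae_name].
apply: filterS3 cong aen hNval => t hc hn hv.
rewrite (hc (names_at f t) hn) /truth /=.
by rewrite sat_fo_inf; split=> /hv.
Qed.

Lemma ae_name_k j : \ae t, nm t (name (k j) t) = nm t j.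
Proof.
apply: filterS2 (ae_name (k j)) hNval => t h hv.
have hb : bval t (eq_form L) (pair_val j (name (k j) t)) by rewrite /bval comp_pair_val.
by have := proj2 (hv _ _ _) hb; rewrite /= pair_val0 pair_val1.
Qed.

Lemma rep_inf_truth (J : forall n, inf_form L n -> ('I_n -> rK P) -> rE P) :
  inf_events J -> forall n (psi : inf_form L n) f, rep (J n psi f) (truth psi f).
Proof.
move=> hJ n psi.
elim: psi => {n} [n s t|n r ts|n th IH|n th1 IH1 th2 IH2|n p ths IH|n th IH] f.
- by have := inf_fo hJ (Eq s t) f => /= ->; exact: (rep_truth (Eq s t)).
- by have := inf_fo hJ (Rel r ts) f => /= ->; exact: (rep_truth (Rel r ts)).
- by rewrite (inf_neg hJ); exact: (er_compl hrep (IH f)).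
- by rewrite (inf_or hJ); exact: (er_join hrep (IH1 f) (IH2 f)).
- have -> : truth (BigOr p ths) f = \bigcup_j truth (ths j) f.
    by apply/seteqP; split=> t [j]; [exists j|move=> _; exists j].
  apply: rep_esup (inf_bigor hJ p ths f) => [j|j|_ [j _ <-]].
  + by exists j.
  + exact: IH.
  + by exists (truth (ths j) f); [exact: IH|apply: nearW => t h; exists j].
(* The least name of [k j] may differ from [j] but denotes the same element; so the [k j] supply all
   witnesses, and the supremum over random elements becomes a countable union. *)
- have aek : \ae t, forall j, nm t (name (k j) t) = nm t j.
    by apply: ae_foralln => j; exact: ae_name_k.
  have tE g t : truth th (scons g f) t <-> sat th (scons (nm t (name g t)) (nm t \o names_at f t)).
    rewrite /truth /=; suff -> : nm t \o names_at (scons g f) t = scons (nm t (name g t)) (nm t \o names_at f t) by [].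
    rewrite -comp_scons; congr (_ \o _); apply: funext => i.
    by rewrite /names_at; case: (unliftP ord0 i) => [j ->|->]; rewrite ?sconsS ?scons0.
  have ae_ex : \ae t, ((\bigcup_j truth th (scons (k j) f)) t <-> truth (Ex th) f t).
    apply: filterS aek => t hk; split=> [[j _ /tE h]|[x]].
      by exists (nm t (name (k j) t)).
    have [j <-] := family_onto hN x; rewrite -hk => h.
    by exists j => //; apply/tE.
  apply: (rep_ae (X := \bigcup_j truth th (scons (k j) f))) => //; last exact: measurable_truth.
  apply: rep_esup (inf_ex hJ th f) => [j|j|_ [g _ <-]].
  + by exists (k j).
  + exact: IH.
  + exists (truth th (scons g f)); first exact: IH.
    apply: filterS ae_ex => t h /tE h'; apply/h.
    by exists (nm t (name g t)).
Qed.

End RandomStructure.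

(** * Isomorphism with a basic randomization *)

Section UnitInterval.
Variable R : realType.
Notation T := (measurableTypeR R).
Notation pr := (pr (@unif01 R)).
Implicit Types A B : set (unit_co R).

Notation "\ae t , Q" := (\forall t \ae (@unif01 R), Q)
  (at level 200, t name, Q at level 200).

Lemma to_line_sub A : to_line A `<=` `[0, 1[%classic.
Proof. by rewrite -to_lineT => t [u _ <-]; exists u. Qed.

Lemma leb_pr A : leb A = pr (to_line A).
Proof.
rewrite /leb; suff -> : pr (to_line A) = fine (lebesgue_measure (to_line A `&` `[0, 1[%classic)) by
  rewrite setIidl//; exact: to_line_sub.
by [].
Qed.

Lemma to_line_pull (X : set T) :
  to_line [set u : unit_co R | X (sval u)] = X `&` `[0, 1[%classic.
Proof.
apply/seteqP; split=> t; last first.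
  by move=> [Xt]; rewrite -to_lineT => -[u _ ut]; exists u => //=; rewrite ut.
by move=> [u Xu <-]; split=> //; apply: (@to_line_sub setT); exists u.
Qed.

Lemma borel_pull (X : set T) : measurable X -> borel [set u : unit_co R | X (sval u)].
Proof.
by move=> mX; rewrite /borel to_line_pull; apply: measurableI => //; exact: measurable_itv01.
Qed.

Lemma leb_pull (X : set T) : leb [set u : unit_co R | X (sval u)] = pr X.
Proof.
rewrite leb_pr to_line_pull.
have E (Y : set T) : pr Y = fine (lebesgue_measure (Y `&` `[0, 1[%classic)) by [].
by rewrite !E -setIA setIid.
Qed.

(** Points of the line outside [0, 1) come from no [u] and satisfy the condition vacuously. *)
Definition ae_unit (Q : unit_co R -> Prop) : Prop := \ae t, [set t : T | forall u : unit_co R, sval u = t -> Q u] t.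

Lemma ae_unit_pull (Q : T -> Prop) : (\ae t, Q t) -> ae_unit (fun u => Q (sval u)).
Proof. by rewrite /ae_unit => h1; apply: filterS h1 => t Qt u ->. Qed.

Lemma ae_unitS (Q Q' : unit_co R -> Prop) :
  (forall u, Q u -> Q' u) -> ae_unit Q -> ae_unit Q'.
Proof. by rewrite /ae_unit => QQ' h1; apply: (filterS _ h1) => t Qt u ut; apply: QQ'; exact: Qt. Qed.

Lemma ae_unitS2 (Q1 Q2 Q' : unit_co R -> Prop) :
  (forall u, Q1 u -> Q2 u -> Q' u) -> ae_unit Q1 -> ae_unit Q2 -> ae_unit Q'.
Proof.
rewrite /ae_unit => QQ' h1 h2; apply: (filterS _ (filterI h1 h2)) => t [Q1t Q2t] u ut.
by apply: QQ'; [exact: Q1t|exact: Q2t].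
Qed.

Lemma leb_ge0 A : 0 <= leb A.
Proof. by rewrite leb_pr pr_ge0. Qed.

Lemma leb_eq0 A : borel A -> ae_unit (fun u => ~ A u) -> leb A = 0.
Proof.
move=> mA nA; rewrite leb_pr; apply/(pr_eq0 _ mA); apply: null_ae => //.
by rewrite /ae_unit in nA; apply: (filterS _ nA) => t h [u Au ut]; exact: (h u ut).
Qed.

Lemma le_leb A B : borel A -> borel B -> A `<=` B -> leb A <= leb B.
Proof.
move=> mA mB AB; rewrite !leb_pr; apply: le_pr => //.
by move=> _ [u Au <-]; exists u => //; exact: AB.
Qed.

Lemma lebU_le A B : borel A -> borel B -> leb (A `|` B) <= leb A + leb B.
Proof.
by move=> mA mB; rewrite !leb_pr /to_line image_setU; exact: prU_le.
Qed.

Lemma le_leb_ae A B : borel A -> borel B -> ae_unit (fun u => A u -> B u) ->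
  leb A <= leb B.
Proof.
move=> mA mB AB; have mD : borel (A `\` B) by apply: borelI => //; exact: borelC.
apply: (@le_trans _ _ (leb (B `|` A `\` B))).
  apply: le_leb => //; first exact: borelU.
  by move=> u Au; have [Bu|nBu] := pselect (B u); [left|right].
apply: le_trans (lebU_le mB mD) _; rewrite (leb_eq0 mD) ?addr0//.
by apply: ae_unitS AB => u h [/h].
Qed.

Lemma leb_ae_eq A B : borel A -> borel B -> ae_unit (fun u => A u <-> B u) ->
  leb A = leb B.
Proof.
move=> mA mB AB; apply/eqP; rewrite eq_le; apply/andP; split; apply: le_leb_ae => //;
  by apply: ae_unitS AB => u [].
Qed.

Lemma borelD A B : borel A -> borel B -> borel (A `\` B).
Proof. by move=> mA mB; apply: borelI => //; exact: borelC. Qed.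

End UnitInterval.

Section BasicRandomization.
Variables (R : realType) (L : signature) (phi : inf_form L 0) (D : basic_data R phi).
Notation Q := (basic_randomization D).

Lemma bK_value (F : bK D) i u : block i u -> exists a : bmod i, sval F u = existT _ i a.
Proof.
move=> iu; have [/(_ i u iu) + _] := svalP F.
by case: (sval F u) => j a /= ji; subst j; exists a.
Qed.

Lemma block_exists u : exists i : bidx D, block i u.
Proof.
have : (\bigcup_i @block _ _ _ D i) u by rewrite (block_cover D).
by move=> [i _ iu]; exists i.
Qed.

Lemma existT_inj (i : bidx D) (a b : bmod i) :
  existT (fun i => carrier (bmod i)) i a = existT _ i b -> a = b.
Proof. by move=> /(@eq_from_Tagged {classic bidx D} (fun i => carrier (bmod i))). Qed.

(** Exhibits the set defining [dK] as an event, hence as a Borel set. *)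
Lemma differ_set (F F' : bK D) :
  [set u | sval F u <> sval F' u] = bev_set (neq_form L) (pair_val F F').
Proof.
apply/seteqP; split=> u.
  have [i iu] := block_exists u.
  have [a Fa] := bK_value F iu; have [b Fb] := bK_value F' iu.
  rewrite /= Fa Fb => ab; exists i, (pair_val a b); split=> //.
    move=> j; case: (unliftP ord0 j) => [j' ->|->]; rewrite /pair_val ?sconsS ?scons0 //.
    by rewrite (ord1 j') !scons0.
  by rewrite /= pair_val0 pair_val1 => e; apply: ab; rewrite e.
move=> [i [v [iu vP]]] /= nv e; apply: nv.
have := vP ord0; have := vP ord_max; rewrite pair_val0 pair_val1 -e => ->.
by move=> /existT_inj.
Qed.

Lemma borel_differ (F F' : bK D) : borel [set u | sval F u <> sval F' u].
Proof. by rewrite differ_set; exact: borel_bev. Qed.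

Lemma basic_dK_triangle (F F' F'' : bK D) :
  dK (l := Q) F F'' <= dK (l := Q) F F' + dK (l := Q) F' F''.
Proof.
rewrite /=; apply: le_trans (lebU_le (borel_differ F F') (borel_differ F' F'')).
apply: le_leb; [exact: borel_differ|by apply: borelU; exact: borel_differ|].
move=> u /= FF''; have [e|ne] := pselect (sval F u = sval F' u); last by left.
by right; rewrite -e.
Qed.

Lemma basic_dK_sym (F F' : bK D) : dK (l := Q) F F' = dK (l := Q) F' F.
Proof. by congr leb; apply/seteqP; split=> u /= h /esym. Qed.

Lemma basic_eeq (A B : bE R) : ae_unit (fun u => sval A u <-> sval B u) ->
  eeq (P := Q) A B.
Proof.
move=> AB; apply: leb_eq0.
  apply: borelU; apply: borelD; exact: svalP.
by apply: ae_unitS AB => u [h1 h2] [[/h1]|[/h2]].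
Qed.

Lemma basic_eeq_mu (A B : bE R) : eeq (P := Q) A B -> leb (sval A) = leb (sval B).
Proof.
have bAB : borel (sval A `\` sval B `|` sval B `\` sval A).
  apply: borelU; apply: borelD; exact: svalP.
have h (X Y Z : set (unit_co R)) : borel X -> borel Y -> borel Z -> leb Z = 0 ->
    X `\` Y `<=` Z -> leb X <= leb Y.
  move=> bX bY bZ Z0 XYZ; apply: (@le_trans _ _ (leb (Y `|` Z))).
    apply: le_leb => //; first exact: borelU.
    by move=> u Xu; have [Yu|nYu] := pselect (Y u); [left|right; apply: XYZ].
  by apply: le_trans (lebU_le bY bZ) _; rewrite Z0 addr0.
move=> AB; apply/eqP; rewrite eq_le; apply/andP; split.
  by apply: h bAB AB _; [exact: svalP|exact: svalP|move=> u ?; left].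
by apply: h bAB AB _; [exact: svalP|exact: svalP|move=> u ?; right].
Qed.

End BasicRandomization.

(** * Blocks and the map onto the basic randomization *)

Section Assembly.
Variables (R : realType) (L : signature) (phi : inf_form L 0) (P : LR_prestructure R L).
Hypothesis hP : is_complete_randomization P.
Notation T := (measurableTypeR R).
Notation pr := (pr (@unif01 R)).
Notation "\ae t , Q" := (\forall t \ae (@unif01 R), Q)
  (at level 200, t name, Q at level 200).

Variable rep : rE P -> set T -> Prop.
Hypothesis hrep : event_representation rep.
Variable k : nat -> rK P.
Hypothesis k_dense : forall f eps, 0 < eps -> exists n, dK f (k n) < eps.
Variables (N : T -> structure L) (nm : forall t, nat -> N t).
Hypothesis hN : measurable_family nm.
Hypothesis hNval : \ae t, forall n (th : fo_form L n) d,
  sat th (nm t \o d) <-> bval hrep k t th d.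

Variables (G : set T) (eqv : T -> T -> Prop) (h : T -> T -> nat -> nat).
Hypothesis mG : measurable G.
Hypothesis G0 : unif01 (~` G) = 0%E.
Hypothesis Gphi : forall t, G t -> models (N t) phi.
Hypothesis eqv_refl : forall t, eqv t t.
Hypothesis eqv_sym : forall t t', eqv t t' -> eqv t' t.
Hypothesis eqv_trans : forall t t' t'', eqv t t' -> eqv t' t'' -> eqv t t''.
Hypothesis meqv : forall t, measurable [set t' | eqv t t'].
Hypothesis eqv_pos : forall t, G t -> (0 < unif01 [set t' | eqv t t'])%E.
Hypothesis mh : forall t' a, discrete_measurable_map (fun t => h t t' a).
Hypothesis h_sat : forall t t', G t -> G t' -> eqv t t' ->
  forall inf n (th : formula L inf n) v,
    sat th (nm t \o v) <-> sat th (nm t' \o (h t t' \o v)).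
Hypothesis h_onto : forall t t', G t -> G t' -> eqv t t' ->
  forall b, exists a, nm t' (h t t' a) = nm t' b.

Notation name := (name hrep k).

Let rand : is_randomization P. Proof. by case: hP. Qed.
Let pre : is_prestructure P. Proof. exact: rand_pre. Qed.

Definition eqv_class : Type := {X : set T | exists t, G t /\ X = [set t' | eqv t t']}.

Definition class_of (t : T) (Gt : G t) : eqv_class :=
  exist _ [set t' | eqv t t'] (ex_intro _ t (conj Gt erefl)).

Definition base (i : eqv_class) : T := sval (cid (svalP i)).

Lemma base_good i : G (base i). Proof. by rewrite /base; case: cid => t []. Qed.

Lemma base_class i : sval i = [set t' | eqv (base i) t'].
Proof. by rewrite /base; case: cid => t []. Qed.

Lemma eqv_class_eq (i j : eqv_class) : sval i = sval j -> i = j.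
Proof. by case: i j => [X hX] [Y hY] /= XY; subst Y; congr exist; exact: Prop_irrelevance. Qed.

Lemma ae_good : \ae t, G t.
Proof.
have : \ae t, ~ (~` G) t by apply: ae_null => //; exact: measurableC.
by apply: filterS => t /contrapT.
Qed.

Lemma eqv_class_exists : exists i : eqv_class, True.
Proof.
have [t _ Gt] : exists2 t, [set: T] t & G t.
  apply: (positive_ae (P := @unif01 R)) => //; last exact: ae_good.
  by rewrite probability_setT lte01.
by exists (class_of Gt).
Qed.

(** The blocks must cover all of [0, 1), so the null set outside [G] is thrown into an arbitrary
    class. *)
Definition index_of (t : T) : eqv_class :=
  if pselect (G t) is left hGt then class_of hGt else sval (cid eqv_class_exists).

Lemma index_base t : G t -> eqv t (base (index_of t)).
Proof.
move=> Gt; apply: eqv_sym.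
have : sval (index_of t) t by rewrite /index_of; case: pselect => //= _; exact: eqv_refl.
by rewrite base_class.
Qed.

Lemma index_ofP t i : G t -> (index_of t = i <-> sval i t).
Proof.
move=> Gt; have tb := index_base Gt; split=> [<-|it].
  by rewrite base_class; exact: eqv_sym.
apply: eqv_class_eq; rewrite !base_class; rewrite base_class in it.
have ib : eqv (base i) (base (index_of t)) by exact: eqv_trans it tb.
apply/seteqP; split=> t' /=; first exact: eqv_trans.
by apply: eqv_trans; exact: eqv_sym.
Qed.

Lemma measurable_class (i : eqv_class) : measurable (sval i).
Proof. by rewrite base_class; exact: meqv. Qed.

Lemma countable_eqv_class : countable [set: eqv_class].
Proof.
apply: (@disjoint_positive_countable _ _ _ (@unif01 R) eqv_class (fun i => sval i)).
- exact: measurable_class.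
- move=> i j _ _ [t []]; rewrite base_class [sval j]base_class /= => it jt.
  apply: eqv_class_eq; rewrite !base_class.
  have ij : eqv (base i) (base j) by apply: eqv_trans it _; exact: eqv_sym.
  apply/seteqP; split=> t' /=; last exact: eqv_trans.
  by apply: eqv_trans; exact: eqv_sym.
- by move=> i; rewrite base_class; apply: eqv_pos; exact: base_good.
Qed.

Lemma measurable_index : discrete_measurable_map index_of.
Proof.
move=> i; rewrite [X in measurable X](_ : _ = (G `&` sval i) `|`
    (~` G `&` [set _ | sval (cid eqv_class_exists) = i])).
  apply: measurableU; apply: measurableI => //; first exact: measurable_class.
    exact: measurableC.
  exact: measurable_const.
apply/seteqP; split=> t /=.
  have [Gt|nGt] := pselect (G t); first by move/(index_ofP i Gt); left.
  by rewrite /index_of; case: pselect => // ? <-; right.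
case=> [[Gt it]|[nGt ti]]; first exact/(index_ofP i Gt).
by rewrite /index_of; case: pselect.
Qed.

Definition index_block (i : eqv_class) : set (unit_co R) := [set u | index_of (sval u) = i].

Lemma borel_index_block i : borel (index_block i).
Proof. exact: (borel_pull (measurable_index i)). Qed.

Lemma index_block_pos i : 0 < leb (index_block i).
Proof.
rewrite (leb_pull [set t | index_of t = i]).
have mi := measurable_index i.
suff p : (0 < unif01 [set t : T | index_of t = i])%E.
  by rewrite lt_def pr_ge0 andbT; apply/negP => /eqP/(pr_eq0 _ mi) e; rewrite e ltxx in p.
have := eqv_pos (base_good i); rewrite -base_class => p.
have mi' := measurable_class i.
have [i0|//] := nullVpositive (@unif01 R) [set t : T | index_of t = i].
move: p; rewrite (null_ae (P := @unif01 R) mi') ?ltxx//.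
apply: (filterS _ (filterI ae_good (ae_null mi i0))) => t [Gt nit] it; apply: nit.
exact/(index_ofP i Gt).
Qed.

Lemma index_block_trivIset : trivIset setT index_block.
Proof. by move=> i j _ _ [u [<- <-]]. Qed.

Lemma index_block_cover : \bigcup_i index_block i = setT.
Proof. by apply/seteqP; split=> // u _; exists (index_of (sval u)). Qed.

Lemma countable_base_structure (i : eqv_class) : countable [set: N (base i)].
Proof.
have := card_image_le (nm (base i)) [set: nat].
suff -> : nm (base i) @` [set: nat] = setT.
  by move=> le; apply: (sub_countable le); exact: countableP.
by apply/seteqP; split=> // x _; have [j <-] := family_onto hN x; exists j.
Qed.

Definition block_data : basic_data R phi :=
  @BasicData R L phi eqv_class countable_eqv_class index_block borel_index_block
    index_block_pos index_block_trivIset index_block_cover (fun i => N (base i))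
    countable_base_structure (fun i => Gphi (base_good i)).

Notation Q := (basic_randomization block_data).

(** The value of [f] in [N t], carried by the isomorphism into the structure chosen for the block of
    [t]. *)
Definition block_name (f : rK P) (t : T) : nat := h t (base (index_of t)) (name f t).

Definition block_fun (f : rK P) (u : unit_co R) : {i : eqv_class & N (base i)} :=
  existT (fun i => carrier (N (base i))) (index_of (sval u))
    (nm (base (index_of (sval u))) (block_name f (sval u))).

(** Inside one block the target [base i] is constant, as measurability of [h] in its first argument
    demands. *)
Lemma measurable_h_name f i : discrete_measurable_map (fun t => h t (base i) (name f t)).
Proof.
apply: (discrete_measurable_bind (F := fun j t => h t (base i) j)); first exact: countableP.
  exact: measurable_name_of.
by move=> j; exact: mh.
Qed.

Lemma borel_block_fun f i (a : N (base i)) :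
  borel [set u | index_block i u /\ block_fun f u = existT _ i a].
Proof.
pose X : set T := [set t | index_of t = i] `&`
  [set t | nm (base i) (h t (base i) (name f t)) = a].
have mX : measurable X.
  apply: measurableI; first exact: measurable_index.
  apply: (discrete_measurable_pred (C := nat) (A := fun j => [set _ | nm (base i) j = a])).
  - exact: countableP.
  - exact: measurable_h_name.
  - by move=> j; exact: measurable_const.
have := borel_pull mX; congr borel; apply/seteqP; split=> u /=.
  move=> [ui ua]; split=> //; rewrite /block_fun /block_name.
  by move: ui => /= ui; subst i; rewrite ua.
move=> [ui]; rewrite /block_fun /block_name /X /= => e; split=> //.
move: ui => /= ui; rewrite /index_block /= in ui; subst i.
by move/(@existT_inj _ _ _ block_data): e.
Qed.

Definition block_K (f : rK P) : bK block_data :=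
  exist _ (block_fun f) (conj (fun i u (iu : index_block i u) => iu) (@borel_block_fun f)).

Definition block_E (U : rE P) : bE R :=
  exist _ [set u | bset hrep U (sval u)] (borel_pull (measurable_bset hrep U)).

Lemma block_mu U : mu (l := Q) (block_E U) = mu U.
Proof. by rewrite /= leb_pull (er_mu hrep (rep_bset hrep U)). Qed.

Lemma block_dE U V : dE (l := Q) (block_E U) (block_E V) = dE U V.
Proof.
have mU := measurable_bset hrep U; have mV := measurable_bset hrep V.
have mD (A B : set T) : measurable A -> measurable B -> measurable (A `\` B).
  by move=> mA mB; exact: measurableD.
rewrite (er_isometry hrep (rep_bset hrep U) (rep_bset hrep V)) /=.
rewrite (leb_pull (bset hrep U `\` bset hrep V `|` bset hrep V `\` bset hrep U)).
rewrite prU; [|exact: mD|exact: mD].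
have -> : (bset hrep U `\` bset hrep V) `&` (bset hrep V `\` bset hrep U) = set0.
  by apply/seteqP; split=> // t [[_ ?] []].
by rewrite pr_set0 subr0.
Qed.

Lemma block_eeq U X : rep U X -> forall B : bE R,
  ae_unit (fun u => X (sval u) <-> sval B u) -> eeq (P := Q) (block_E U) B.
Proof.
move=> rU B XB; apply: basic_eeq.
have := ae_unit_pull (rep_ae_iff hP hrep (rep_bset hrep U) rU).
by apply: ae_unitS2 XB => u [h1 h2] [h3 h4]; split=> [/h3/h1|/h2/h4].
Qed.

Lemma block_ev n (th : fo_form L n) (f : 'I_n -> rK P) :
  eeq (P := Q) (block_E (ev th f)) (ev (l := Q) th (block_K \o f)).
Proof.
apply: (@block_eeq _ _ (rep_truth hP k_dense hN hNval th f) (bev th (block_K \o f))).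
apply: ae_unitS (ae_unit_pull ae_good) => u Gu.
have tb := index_base Gu; have bg := base_good (index_of (sval u)).
pose i := index_of (sval u).
pose w : 'I_n -> N (base i) := nm (base i) \o (h (sval u) (base i) \o names_at hrep k f (sval u)).
have tw : truth hrep k nm (fo_inf th) f (sval u) <-> sat th w.
  by rewrite /truth /= (h_sat Gu bg tb) sat_fo_inf.
rewrite tw; split=> [sw|]; first by exists i, w; split.
move=> [j [v [ju vP sv]]]; rewrite /= /index_block /= in ju; move: v vP sv; rewrite -ju => v vP sv.
suff -> : w = v by [].
apply: funext => l; have := vP l; rewrite /= /block_fun.
by move/(@existT_inj _ _ _ block_data).
Qed.

(** On both sides the distance is the measure of the event of [neq_form], which [block_ev] and
    [block_mu] preserve. *)
Lemma block_dK f g : dK (l := Q) (block_K f) (block_K g) = dK f g.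
Proof.
rewrite (rand_dK rand) -block_mu.
have e := basic_eeq_mu (block_ev (neq_form L) (pair_val f g)).
change (leb [set u | sval (block_K f) u <> sval (block_K g) u] =
  leb (sval (block_E (ev (neq_form L) (pair_val f g))))).
by rewrite e differ_set /= comp_pair_val.
Qed.

Lemma block_K_eq : ae_unit (fun u => forall f g,
  nm (sval u) (name f (sval u)) = nm (sval u) (name g (sval u)) <->
  sval (block_K f) u = sval (block_K g) u).
Proof.
apply: ae_unitS (ae_unit_pull ae_good) => u Gu f g.
have tb := index_base Gu; have bg := base_good (index_of (sval u)).
have := h_sat Gu bg tb (eq_form L) (pair_val (name f (sval u)) (name g (sval u))).
rewrite /= !pair_val0 !pair_val1 => ->; rewrite /block_fun /block_name; split=> [->//|].
by move/(@existT_inj _ _ _ block_data).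
Qed.

(* Two random elements are glued along an event by the validity of
   [exists z, (x = y -> z = a) /\ (x <> y -> z = b)], the event being nearly
   [[x = y]] by the event axiom. *)
Lemma glue (X : set T) (a b : rK P) eps : measurable X -> 0 < eps -> exists c,
  leb [set u | (X (sval u) /\ sval (block_K c) u <> sval (block_K a) u) \/
               (~ X (sval u) /\ sval (block_K c) u <> sval (block_K b) u)] < eps.
Proof.
move=> mX eps0; have e20 : 0 < eps / 2 by rewrite divr_gt0.
have [U rU] := er_event hrep mX.
have [a' [b' hab]] := rand_event rand U e20.
pose j0 : 'I_4 := ord0; pose j1 : 'I_4 := lift ord0 (ord0 : 'I_3).
pose j2 : 'I_4 := lift ord0 (lift ord0 (ord0 : 'I_2)).
pose j3 : 'I_4 := lift ord0 (lift ord0 (lift ord0 (ord0 : 'I_1))).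
pose x' (j : 'I_4) : term L 5 := Var (lift ord0 j).
pose th : fo_form L 5 :=
  Or (And (Eq (x' j0) (x' j1)) (Eq (Var ord0) (x' j2)))
     (And (Neg (Eq (x' j0) (x' j1))) (Eq (Var ord0) (x' j3))).
pose f := scons a' (scons b' (scons a (scons b (@no_vars (rK P))))).
have satth (M : structure L) (v : 'I_4 -> M) x : sat th (scons x v) <->
    (v j0 = v j1 /\ x = v j2) \/ (v j0 <> v j1 /\ x = v j3).
  have -> : sat th (scons x v) = (sat (And (inf := false) (Eq (x' j0) (x' j1)) (Eq (Var ord0) (x' j2))) (scons x v) \/
    sat (And (inf := false) (Neg (Eq (x' j0) (x' j1))) (Eq (Var ord0) (x' j3))) (scons x v)) by [].
  by rewrite !sat_And /= !sconsS !scons0.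
have vth : valid (Ex th).
  move=> M v; rewrite sat_Ex; have [e|ne] := pselect (v j0 = v j1).
    by exists (v j2); apply/satth; left.
  by exists (v j3); apply/satth; right.
have [c hc] := rand_full rand th f e20; exists c.
rewrite (ev_valid hP _ vth) in hc.
pose Y := truth hrep k nm (fo_inf th) (scons c f).
pose E := truth hrep k nm (fo_inf (eq_form L)) (pair_val a' b').
have rY : rep _ Y := rep_truth hP k_dense hN hNval th (scons c f).
have rE' : rep _ E := rep_truth hP k_dense hN hNval (eq_form L) (pair_val a' b').
have mY := er_measurable hrep rY; have mE := er_measurable hrep rE'.
rewrite (er_isometry hrep rY (er_top hrep)) in hc.
rewrite (er_isometry hrep rU rE') in hab.
have mXE : measurable (X `\` E) by exact: measurableD.
have mEX : measurable (E `\` X) by exact: measurableD.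
have mTY : measurable (setT `\` Y) by exact: measurableD.
pose Z := (setT `\` Y) `|` ((X `\` E) `|` (E `\` X)).
have mZ : measurable Z by apply: measurableU => //; exact: measurableU.
have prZ : pr Z < eps.
  apply: (@le_lt_trans _ _ (pr (setT `\` Y) + (pr (X `\` E) + pr (E `\` X)))).
    apply: le_trans (prU_le _ mTY (measurableU _ _ mXE mEX)) _.
    by rewrite lerD2l; exact: prU_le.
  rewrite [ltRHS]splitr; apply: ltrD => //.
  apply: le_lt_trans hc; rewrite lerDr; exact: pr_ge0.
apply: le_lt_trans prZ; rewrite -leb_pull; apply: le_leb_ae.
- apply: borelU; apply: borelI; try exact: (borel_differ (block_K _) (block_K _)).
    exact: borel_pull.
  exact: borelC (borel_pull mX).
- exact: borel_pull.
apply: ae_unitS block_K_eq => u heq bad.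
apply: contrapT => nZ.
have Yu : Y (sval u) by apply: contrapT => nY; apply: nZ; left.
have XE : X (sval u) <-> E (sval u).
  by split=> h1; apply: contrapT => h2; apply: nZ; right; [left|right].
have EE : E (sval u) <-> nm (sval u) (name a' (sval u)) = nm (sval u) (name b' (sval u)).
  have -> : E (sval u) <-> sat (eq_form L) (nm (sval u) \o names_at hrep k (pair_val a' b') (sval u)).
    exact: sat_fo_inf.
  by rewrite /= /names_at pair_val0 pair_val1.
have YY : (nm (sval u) (name a' (sval u)) = nm (sval u) (name b' (sval u)) /\
    nm (sval u) (name c (sval u)) = nm (sval u) (name a (sval u))) \/
   (nm (sval u) (name a' (sval u)) <> nm (sval u) (name b' (sval u)) /\
    nm (sval u) (name c (sval u)) = nm (sval u) (name b (sval u))).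
  have : sat th (nm (sval u) \o names_at hrep k (scons c f) (sval u)) by exact/sat_fo_inf.
  have -> : nm (sval u) \o names_at hrep k (scons c f) (sval u) =
      scons (nm (sval u) (name c (sval u))) (nm (sval u) \o names_at hrep k f (sval u)).
    rewrite -comp_scons; congr (_ \o _); apply: funext => i.
    by rewrite /names_at; case: (unliftP ord0 i) => [j ->|->]; rewrite ?sconsS ?scons0.
  by move=> /satth; rewrite /= /names_at /f /j0 /j1 /j2 /j3 !sconsS !scons0.
case: bad => -[Xu ne].
  case: YY => -[e1 e2]; first by apply: ne; exact/heq.
  by apply: e1; apply/EE/XE.
case: YY => -[e1 e2]; last by apply: ne; exact/heq.
by apply: Xu; apply/XE/EE.
Qed.

(** * Surjectivity on random elements *)

Section Surjectivity.
Variable g : bK block_data.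

Definition agree (n : nat) : set (unit_co R) := [set u | sval (block_K (k n)) u = sval g u].

Lemma borel_agree n : borel (agree n).
Proof.
have := borelC (borel_differ (block_K (k n)) g); congr borel.
by apply/seteqP; split=> u /=; [move/contrapT|move=> e; apply].
Qed.

(** The isomorphism onto the structure of the block hits the value of [g] at some name [n], and
    [k n] almost surely has the value named [n]. *)
Lemma agree_cover : ae_unit (fun u => exists n, agree n u).
Proof.
have aek : \ae t, forall j, nm t (name (k j) t) = nm t j.
  by apply: ae_foralln => j; exact: (ae_name_k hP k_dense hNval).
apply: ae_unitS2 (ae_unit_pull ae_good) (ae_unit_pull aek) => u Gu ku.
have tb := index_base Gu; have bg := base_good (index_of (sval u)).
have [a ga] := bK_value g (erefl : index_block (index_of (sval u)) u).
have [b ba] := family_onto hN a.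
have [n nb] := h_onto Gu bg tb b.
exists n; rewrite /agree /= ga /block_fun -ba -nb; congr existT.
have := h_sat Gu bg tb (eq_form L) (pair_val (name (k n) (sval u)) n).
by rewrite /= !pair_val0 !pair_val1 => -[+ _]; apply.
Qed.

Definition agree_before m : set (unit_co R) := [set u | exists2 n, (n < m)%N & agree n u].

Lemma agree_beforeS m : agree_before m.+1 = agree_before m `|` agree m.
Proof.
apply/seteqP; split=> u; last first.
  by case=> [[n nm' nu]|mu']; [exists n => //; exact: ltnW|exists m].
move=> [n]; rewrite ltnS leq_eqVlt => /predU1P[->|nm']; first by right.
by left; exists n.
Qed.

Lemma borel_agree_before m : borel (agree_before m).
Proof.
elim: m => [|m IH]; last by rewrite agree_beforeS; apply: borelU => //; exact: borel_agree.
suff -> : agree_before 0 = set0 by exact: borel0.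
by apply/seteqP; split=> u // [].
Qed.

(** Glue the approximation obtained on [agree_before m] with [k m] outside it, each step with half
    of the remaining error. *)
Lemma approximation_before m eps : 0 < eps -> exists f,
  leb [set u | agree_before m u /\ sval (block_K f) u <> sval g u] < eps.
Proof.
elim: m eps => [|m IH] eps eps0.
  exists (k 0%N); suff -> : [set u | agree_before 0 u /\ sval (block_K (k 0%N)) u <> sval g u] = set0.
    by rewrite leb_pr /to_line image_set0 pr_set0.
  by apply/seteqP; split=> u // [[]].
have e20 : 0 < eps / 2 by rewrite divr_gt0.
have [f hf] := IH _ e20.
have mX : measurable (to_line (agree_before m)) := borel_agree_before m.
have [c hc] := glue f (k m) mX e20; exists c.
rewrite [ltRHS]splitr; apply: le_lt_trans (ltrD hf hc).
have bd F F' : borel [set u | sval F u <> sval F' u] := borel_differ (D := block_data) F F'.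
have b1 : borel [set u | agree_before m u /\ sval (block_K f) u <> sval g u].
  exact: (borelI (borel_agree_before m) (bd _ _)).
set B2 := [set u | _ \/ _] in hc *.
have b2 : borel B2.
  exact: (borelU (borelI (borel_pull mX) (bd _ _)) (borelI (borelC (borel_pull mX)) (bd _ _))).
apply: le_trans (lebU_le b1 b2); apply: le_leb.
- exact: (borelI (borel_agree_before m.+1) (bd _ _)).
- exact: borelU.
move=> u [mu' cg].
have [um|num] := pselect (agree_before m u).
  have [cf|ncf] := pselect (sval (block_K c) u = sval (block_K f) u).
    by left; split=> //; rewrite -cf.
  by right; left; split=> //; apply/to_lineE.
right; right; split; first by move/to_lineE.
by move: mu'; rewrite agree_beforeS => -[//|e]; rewrite (e : sval (block_K (k m)) u = sval g u).
Qed.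

Lemma approximation eps : 0 < eps -> exists f, dK (l := Q) (block_K f) g < eps.
Proof.
move=> eps0; have e20 : 0 < eps / 2 by rewrite divr_gt0.
pose X m := to_line (agree_before m).
have mX m : measurable (X m) := borel_agree_before m.
have iX m : X m `<=` X m.+1.
  by move=> t [u um <-]; exists u => //; rewrite agree_beforeS; left.
have cX := pr_nondecreasing_cvg (P := @unif01 R) mX iX.
have X1 : pr (\bigcup_m X m) = 1.
  have -> : \bigcup_m X m = to_line [set u | exists n, agree n u].
    apply/seteqP; split=> [t [m _ [u [n _ nu] <-]]|t [u [n nu] <-]].
      by exists u => //; exists n.
    by exists n.+1 => //; exists u => //; exists n.
  have bA : borel [set u | exists n, agree n u].
    have := @borel_bigcupT R nat agree (@countableP _ _) borel_agree; congr borel.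
    by apply/seteqP; split=> u; [move=> [n _]; exists n|move=> [n]; exists n].
  rewrite -leb_pr (@leb_ae_eq _ _ setT)//; first by rewrite (leb_pull setT) pr_setT.
    exact: borelT.
  by apply: ae_unitS agree_cover => u; split.
have [m hm] : exists m, leb (~` agree_before m) < eps / 2.
  move: cX; rewrite X1 => /cvgrPdist_lt/(_ _ e20)[m _ /(_ m (leqnn _))] /=.
  rewrite ltr_norml => /andP[_ lt]; exists m; apply: le_lt_trans lt.
  have := pr_split (@unif01 R) (@measurableT _ _) (mX m).
  rewrite pr_setT !setTI => ->; rewrite addrC addKr leb_pr; apply: le_pr.
  - exact: borelC (borel_agree_before m).
  - exact: measurableC.
  - by move=> t [u num <-] /to_lineE.
have [f hf] := approximation_before m e20; exists f.
have bd : borel [set u | sval (block_K f) u <> sval g u] := borel_differ (D := block_data) _ _.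
have bm := borel_agree_before m.
rewrite [ltRHS]splitr; apply: le_lt_trans (ltrD hf hm).
have b1 : borel [set u | agree_before m u /\ sval (block_K f) u <> sval g u].
  exact: (borelI bm bd).
apply: le_trans (lebU_le b1 (borelC bm)); apply: le_leb => //.
  by apply: borelU => //; exact: borelC.
by move=> u fg; have [um|num] := pselect (agree_before m u); [left|right].
Qed.

(** Since [block_K] is isometric, the approximating random elements form a Cauchy sequence, and the
    image of its limit is at distance 0 from [g]. *)
Lemma block_K_surjective : exists f, dK (l := Q) (block_K f) g = 0.
Proof.
have inv0 n : 0 < n.+1%:R^-1 :> R by rewrite invr_gt0.
have [f fP] := choice (fun n => approximation (inv0 n)).
have completeK : complete_dist (@dK _ _ P) by case: hP => _ _ [].
have small eps : 0 < eps -> exists n0, forall n, (n0 <= n)%N -> dK (l := Q) (block_K (f n)) g < eps.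
  move=> eps0; have [n0 n0e] := ltr_add_invr (eps0 : 0 < eps); exists n0 => n n0n.
  apply: (lt_le_trans (fP n)); apply: le_trans (ltW n0e); rewrite add0r.
  by rewrite lef_pV2 ?posrE ?ltr0n// ler_nat ltnS.
have [eps eps0|c cP] := completeK f.
  have [n0 hn0] := small _ (divr_gt0 eps0 (ltr0n R 2)); exists n0 => i j n0i n0j.
  rewrite -block_dK; apply: le_lt_trans (basic_dK_triangle _ g _) _.
  by rewrite [ltRHS]splitr ltrD ?hn0// basic_dK_sym hn0.
exists c; apply/eqP; rewrite eq_le; apply/andP; split; last exact: leb_ge0.
apply/ler_addgt0Pr => eps eps0; rewrite add0r.
have e20 := divr_gt0 eps0 (ltr0n R 2).
have [n1 hn1] := small _ e20; have [n2 hn2] := cP _ e20.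
pose n := maxn n1 n2.
apply: le_trans (basic_dK_triangle _ (block_K (f n)) _) _.
rewrite block_dK [leRHS]splitr lerD//; apply: ltW.
  have [_ symK _ _] := pre_dK pre; rewrite symK; apply: hn2; exact: leq_maxr.
by apply: hn1; exact: leq_maxl.
Qed.

End Surjectivity.

Lemma block_isomorphism : is_isomorphism (Q := Q) block_K block_E.
Proof.
have rB := rep_bset hrep.
split.
- exact: block_dK.
- exact: block_dE.
- exact: block_mu.
- exact: block_ev.
- by apply: (block_eeq (er_top hrep)); apply: nearW.
- have -> : ebot P = ecompl (etop P).
    by rewrite -[RHS](emeet1 hP) (emeetC hP) (emeetN hP).
  by apply: (block_eeq (er_compl hrep (er_top hrep))); apply: nearW => t u _ /=; tauto.
- by move=> U V; apply: (block_eeq (er_join hrep (rB U) (rB V))); apply: nearW.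
- by move=> U V; apply: (block_eeq (er_meet hrep (rB U) (rB V))); apply: nearW.
- by move=> U; apply: (block_eeq (er_compl hrep (rB U))); apply: nearW.
- exact: block_K_surjective.
- move=> B; have [U rU] := er_event hrep (svalP B : measurable (to_line (sval B))).
  by exists U; apply: (block_eeq rU); apply: nearW => t u _; exact: to_lineE.
Qed.

End Assembly.

Theorem theorem3p1 (R : realType) (L : signature) (hL : countable_signature L)
    (phi : formula L true 0) (h2 : implies phi (two_elements L true)) :
  scattered phi -> few_separable_randomizations R phi.
Proof.
move=> sc P hP [sepK sepE] [J [hJ J1]].
have [rep hrep] := event_representation_exists hP sepE.
have [DK [cDK dDK]] := sepK.
have rand : is_randomization P by case: hP.
have [k kD] : exists k : nat -> rK P, DK = range k.
  apply: countable_set_enum => //.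
  (* The event axiom yields a random element, so the dense set is nonempty and can be enumerated. *)
  have [a _] := rand_event rand (etop P) ltr01.
  by have [y Dy _] := dDK a 1 ltr01; exists y.
have k_dense f eps : 0 < eps -> exists n, dK f (k n) < eps.
  by move=> /(dDK f)[y]; rewrite kD => -[n _ <-]; exists n.
have [N [nm [hN hNval]]] := pointwise_structures hL hP hrep k_dense.
have aephi : \forall t \ae (@unif01 R), models (N t) phi.
  have rphi := rep_inf_truth hP k_dense hN hNval hJ phi (@no_vars (rK P)).
  have rtop := er_top hrep.
  have mphi := er_measurable hrep rphi.
  have n0 : unif01 (~` truth hrep k nm phi (@no_vars (rK P))) = 0%E.
    have mC := measurableC mphi; apply/(pr_eq0 _ mC).
    have := pr_split (@unif01 R) (@measurableT _ _) mphi.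
    by rewrite pr_setT !setTI -(er_mu hrep rphi) J1 => e; apply: (addrI 1); rewrite addr0 -e.
  apply: filterS (ae_null (measurableC mphi) n0) => t /contrapT.
  by rewrite /truth /models /= (no_varsE (_ \o _)).
have [G [eqv [h [[[mG G0] Gphi] [er es et] [meqv epos] mh hP']]]] :=
  scattered_classification hN hL sc aephi.
exists (block_data hN mG G0 Gphi er es et meqv epos).
do 2!eexists.
apply: (@block_isomorphism R L phi P hP rep hrep k k_dense N nm hN hNval G eqv h
  mG G0 Gphi er es et meqv epos mh) => t t' Gt Gt' /(hP' _ _ Gt Gt')[] //.
Qed.
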